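(* Let $N\ge 1$, let $\Omega\subseteq\mathbb{R}^N$ be a bounded domain, and let $\beta>1$, $\tau>0$, $r>0$, and $0<t_1<\dots<t_p<\tau$. Let $M\in L^\infty((0,\tau)\times\Omega)$, $g:\mathbb{R}\to\mathbb{R}$, $f:[0,\tau]\times\mathbb{R}^3\to\mathbb{R}$ and $I_k:[0,\tau]\times\mathbb{R}^3\to\mathbb{R}$ ($k=1,\dots,p$) be such that: (H1) for every initial function $\Phi=(\phi_1,\phi_2)\in C([-r,0];\mathcal{Z}^1)$ and every control $u\in L^2(0,\tau;L^2(\Omega))$, the system (S) below has exactly one mild solution on $[-r,\tau]$; (H2) there are constants $a,b\ge 0$ such that $|f(t,y,v,u)|\le a\sqrt{|y|^2+|v|^2}+b$ for all $t\in[0,\tau]$ and $y,v,u\in\mathbb{R}$. Consider the impulsive semilinear beam equation with memory and delay $$ \text{(S)}\quad \begin{cases} w_{tt}-2\beta\Delta w_t+\Delta^2 w=u(t,x)+f\big(t,w(t-r),w_t(t-r),u\big)+\displaystyle\int_0^t M(t-s)\,g(w(s-r,x))\,ds, & t\in(0,\tau],\ t\ne t_k,\ x\in\Omega,\\ w=\Delta w=0 & \text{on }(0,\tau)\times\partial\Omega,\\ w(s,x)=\phi_1(s,x),\quad w_t(s,x)=\phi_2(s,x) & \text{in }[-r,0]\times\Omega,\\ w_t(t_k^+,x)=w_t(t_k^-,x)+I_k\big(t_k,w(t_k,x),w_t(t_k,x),u(t_k,x)\big), & k=1,\dots,p. \end{cases} $$ Then (S) is approximately controllable on $[0,\tau]$: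 for every $\epsilon>0$, every $\Phi\in C([-r,0];\mathcal{Z}^1)$ and every $z_1\in\mathcal{Z}^1$ there exists a control $u\in L^2(0,\tau;L^2(\Omega))$ such that the corresponding mild solution $z^u=(w,w_t)$ of (S) satisfies $z^u(0)=\Phi(0)$ and $\|z^u(\tau)-z_1\|_{\mathcal{Z}^1}<\epsilon$.
   Context: Let $\mathcal{X}=\mathcal{U}=L^2(\Omega)$ with its usual norm $\|\cdot\|$, and let $\mathcal{A}=-\Delta$ with homogeneous Dirichlet boundary conditions, with distinct eigenvalues $0<\lambda_1<\lambda_2<\dots\to\infty$, each of finite multiplicity, and with $E_j$ the orthogonal projection of $\mathcal{X}$ onto the eigenspace of $\lambda_j$. For $\alpha\ge0$ put $\mathcal{A}^\alpha x=\sum_j\lambda_j^\alpha E_jx$ and $\mathcal{X}^\alpha=D(\mathcal{A}^\alpha)=\{x\in \mathcal{X}:\sum_j\lambda_j^{2\alpha}\|E_jx\|^2<\infty\}$, with norm $\|x\|_\alpha=\|\mathcal{A}^\alpha x\|$. In particular $\mathcal{X}^1=D(\mathcal{A})$ (which is $H^2(\Omega)\cap H^1_0(\Omega)$), and $\mathcal{A}^2$ is the realization of $\Delta^2$ with boundary conditions $w=\Delta w=0$. The state space is the Hilbert space $\mathcal{Z}^1=\mathcal{X}^1\times\mathcal{X}$ with norm $\|(w,v)\|_{\mathcal{Z}^1}^2=\|w\|_1^2+\|v\|^2$. Let $\mathbb{A}=\begin{pmatrix}0&I\\-\mathcal{A}^2&-2\beta\mathcal{A}\end{pmatrix}$ with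 domain $D(\mathcal{A}^2)\times D(\mathcal{A})$; it generates a strongly continuous semigroup $\{T(t)\}_{t\ge0}$ on $\mathcal{Z}^1$, given by $T(t)z=\sum_{j\ge1}e^{K_jt}P_jz$, where $P_j=\mathrm{diag}(E_j,E_j)$ and $K_j=\begin{pmatrix}0&1\\-\lambda_j^2&-2\beta\lambda_j\end{pmatrix}$ acts on the range of $P_j$. Let $\mathbb{B}:\mathcal{U}\to\mathcal{Z}^1$, $\mathbb{B}u=(0,u)$. For $z=(w,v)\in\mathcal{Z}^1$ and $u\in\mathcal{U}$ define, with pointwise composition in $x\in\Omega$, $$\mathbb{F}(t,z,u)=\big(0,\,f(t,w(\cdot),v(\cdot),u(\cdot))\big),\quad \mathbb{M}_g(t,s,z)=\big(0,\,M(t-s,\cdot)\,g(w(\cdot))\big),\quad \mathbb{I}_k(t,z,u)=\big(0,\,I_k(t,w(\cdot),v(\cdot),u(\cdot))\big).$$ The functions $g,f,I_k$ are assumed smooth enough that these expressions define elements of $\mathcal{Z}^1$ and that the integrals below make sense (as Bochner integrals in $\mathcal{Z}^1$). A mild solution of (S) on $[-r,\tau]$ for initial function $\Phi$ and control $u$ is a function $z=z^u:[-r,\tau]\to\mathcal{Z}^1$ with $z=\Phi$ on $[-r,0]$, whose restriction to $[0,\tau]$ is continuous except possibly at the points $t_k$, where it is left continuous and has a right limit, and such that for all $t\in[0,\tau]$ $$ z(t)=T(t)\Phi(0)+\int_0^tT(t-s)\Big[\mathbb{B}u(s)+\int_0^s\mathbb{M}_g(s,l,z(l-r))\,dl\Big]ds+\int_0^tT(t-s)\,\mathbb{F}(s,z(s-r),u(s))\,ds+\sum_{0<t_k<t}T(t-t_k)\,\mathbb{I}_k(t_k,z(t_k),u(t_k)).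 $$ Since $u(t_k)$ appears in the impulses, a control $u\in L^2(0,\tau;\mathcal{U})$ is understood as an everywhere defined, square-integrable function $[0,\tau]\to\mathcal{U}$. *)

(* Defs.v *)
From HB Require Import structures.
From mathcomp Require Import all_boot all_order all_algebra.
From mathcomp Require Import ring lra.
From mathcomp Require Import all_classical all_reals all_analysis.
Set Implicit Arguments.
Unset Strict Implicit.
Unset Printing Implicit Defensive.
Import Order.TTheory GRing.Theory Num.Theory.
Import numFieldNormedType.Exports.
Local Open Scope classical_set_scope.
Local Open Scope ring_scope.

Definition rV_coord (R : realType) (n : nat) (i : 'I_n) (x : 'rV[R]_n) :
  measurableTypeR R := x ord0 i.

Section rV_measurable.
Context (R : realType) (n : nat).
Local Notation rV_coord := (@rV_coord R n).

Let rV_set0 : g_sigma_preimage rV_coord set0.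
Proof. exact: sigma_algebra0. Qed.

Let rV_setC A : g_sigma_preimage rV_coord A -> g_sigma_preimage rV_coord (~` A).
Proof. exact: sigma_algebraC. Qed.

Let rV_bigcup (F : _^nat) : (forall i, g_sigma_preimage rV_coord (F i)) ->
  g_sigma_preimage rV_coord (\bigcup_i (F i)).
Proof. exact: sigma_algebra_bigcup. Qed.

HB.instance Definition _ := @isMeasurable.Build default_measure_display
  'rV[R]_n (g_sigma_preimage rV_coord) rV_set0 rV_setC rV_bigcup.

Lemma measurable_rV_coord (i : 'I_n) : measurable_fun [set: 'rV[R]_n] (rV_coord i).
Proof.
move=> _ Y mY; rewrite setTI; apply: sub_sigma_algebra => /=.
rewrite -bigcup_seq/=; exists i => /=; first by rewrite mem_index_enum.
by exists Y => //; rewrite setTI.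
Qed.

End rV_measurable.

Lemma measurable_fun_rVP (R : realType) n d (T : measurableType d) (f : T -> 'rV[R]_n) :
  (forall i, measurable_fun [set: T] (rV_coord i \o f)) ->
  measurable_fun [set: T] f.
Proof.
move=> mf.
have sub : g_sigma_preimage (fun i => rV_coord i \o f) `<=` measurable.
  apply: smallest_sub; first exact: sigma_algebra_measurable.
  case: n f mf => [|m] f mf; first by rewrite big_ord0.
  rewrite -bigcup_mkord_ord; apply: bigcup_sub => i Ii.
  by move=> A [B mB <-]; exact: mf.
move=> _ A mA; apply: sub; rewrite g_sigma_preimage_comp.
by exists A.
Qed.

Lemma open_measurable_rV (R : realType) (n : nat) (U : set 'rV[R]_n) :
  open U -> measurable U.
Proof.
move=> oU.
pose q (c : 'rV[rat]_n) : 'rV[R]_n := map_mx ratr c.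
pose B (p : 'rV[rat]_n * nat) : set 'rV[R]_n := ball (q p.1) p.2.+1%:R^-1.
have mB p : measurable (B p).
  have -> : B p = \bigcap_(i in [set: 'I_n])
      (rV_coord i @^-1` ball (q p.1 ord0 i : R) p.2.+1%:R^-1).
    apply/seteqP; split => [x [_ xB] i _|x xB].
      exact: (xB ord0 i).
    by split => // i j; rewrite ord1; exact: (xB j).
  apply: fin_bigcap_measurable => // i _.
  rewrite -[X in measurable X]setTI; apply: measurable_rV_coord => //.
  rewrite ball_itv; exact: measurable_itv.
have -> : U = \bigcup_(p in [set p | B p `<=` U]) B p.
  apply/seteqP; split; last by apply: bigcup_sub.
  move=> x Ux; have /nbhs_ballP[e /= e0 xU] := open_nbhs_nbhs (conj oU Ux).
  pose k := Num.truncn (2 * e^-1).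
  have ke : 2 * k.+1%:R^-1 < e.
    rewrite -ltr_pdivlMl// -[ltRHS]invrK ltf_pV2 ?posrE ?invr_gt0//; last first.
      by rewrite mulr_gt0// invr_gt0.
    by rewrite invfM invrK; exact: truncnS_gt.
  have /choice [c cP] : forall i : 'I_n, exists c : rat, ball (ratr c : R) k.+1%:R^-1 (x ord0 i).
    move=> i; have : (x ord0 i - k.+1%:R^-1 < x ord0 i + k.+1%:R^-1).
      by rewrite ltrD2l gtrN// invr_gt0.
    move=> /rat_in_itvoo[c]; rewrite in_itv/= => /andP[c1 c2].
    exists c; rewrite ball_itv/= in_itv/=; move: c1 c2.
    by rewrite !(ltrBlDr, ltrBrDr) addrC => *; apply/andP; split.
  exists (\row_i c i, k).
    move=> y /= [_ yB]; apply: xU; split => // i j.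
    rewrite ord1 {i}.
    have := yB ord0 j; rewrite /= !mxE => cy.
    apply: (@le_ball _ _ _ (2 * k.+1%:R^-1)); first exact: ltW.
    rewrite mulr_natl mulr2n; apply: ball_triangle cy.
    exact/ball_sym.
  split; first by rewrite invr_gt0.
  by move=> i j; rewrite ord1 /= !mxE; exact: cP.
rewrite bigcup_mkcond; apply: countable_bigcupT_measurable => [|p].
  exact: countableP.
by case: ifP.
Qed.

(* Lebesgue measure on R^n, built coordinate by coordinate: lebesgue_rV n.+1 is
   the product of the Lebesgue measures on R and R^n carried to 'rV[R]_n.+1. *)
Section lebesgue_rV.
Context (R : realType).

Definition rV_cons n (p : measurableTypeR R * 'rV[R]_n) : 'rV[R]_n.+1 :=
  \row_i oapp (p.2 ord0) p.1 (unlift ord0 i).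

Lemma measurable_rV_cons n : measurable_fun setT (@rV_cons n).
Proof.
apply: measurable_fun_rVP => i.
have [j ->|->] := unliftP ord0 i.
  rewrite (_ : _ \o _ = @rV_coord R n j \o snd); last first.
    by apply/funext => p; rewrite /rV_coord/= mxE liftK.
  apply: measurableT_comp; last exact: measurable_snd.
  exact: measurable_rV_coord.
rewrite (_ : _ \o _ = fst); first exact: measurable_fst.
by apply/funext => p; rewrite /rV_coord/= mxE unlift_none.
Qed.

Definition rV_uncons n (x : 'rV[R]_n.+1) : measurableTypeR R * 'rV[R]_n :=
  (x ord0 ord0, \row_i x ord0 (lift ord0 i)).

Lemma measurable_rV_uncons n : measurable_fun setT (@rV_uncons n).
Proof.
apply/measurable_fun_pair => /=; first exact: measurable_rV_coord.
apply: measurable_fun_rVP => i.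
rewrite (_ : _ \o _ = @rV_coord R n.+1 (lift ord0 i)).
  exact: measurable_rV_coord.
by apply/funext => x; rewrite /rV_coord/= mxE.
Qed.

Lemma rV_consK n : cancel (@rV_cons n) (@rV_uncons n).
Proof.
move=> [a v]; rewrite /rV_uncons mxE unlift_none/=; congr (_, _).
by apply/rowP => i; rewrite !mxE liftK.
Qed.

Section step.
Context (n : nat) (mu : {sigma_finite_measure set 'rV[R]_n -> \bar R}).

Definition lebesgue_rV_step : set 'rV[R]_n.+1 -> \bar R :=
  pushforward (lebesgue_measure \x mu)%E (@rV_cons n).

HB.instance Definition _ := isMeasurableFun.Build _ _ _ _ _
  (@measurable_rV_cons n).

Let step0 : lebesgue_rV_step set0 = 0%E.
Proof. exact: measure0. Qed.

Let step_ge0 A : (0 <= lebesgue_rV_step A)%E.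
Proof. exact: measure_ge0. Qed.

Let step_sigma_additive : semi_sigma_additive lebesgue_rV_step.
Proof. exact: measure_semi_sigma_additive. Qed.

HB.instance Definition _ := isMeasure.Build _ _ _ lebesgue_rV_step
  step0 step_ge0 step_sigma_additive.

Let step_sigma_finite : sigma_finite setT lebesgue_rV_step.
Proof.
have /sigma_finiteP[F [TF ndF Foo]] := sigma_finiteT (@lebesgue_measure R).
have /sigma_finiteP[G [TG ndG Goo]] := sigma_finiteT mu.
exists (fun i => @rV_uncons n @^-1` (F i `*` G i)) => [|i].
  rewrite -preimage_bigcup (_ : \bigcup_i _ = setT) ?preimage_setT//.
  apply/seteqP; split => // -[x y] _.
  have [i _ Fix] : (\bigcup_i F i) x by rewrite -TF.
  have [j _ Gjy] : (\bigcup_i G i) y by rewrite -TG.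
  exists (maxn i j) => //; split.
  - by move: x Fix; exact/subsetPset/ndF/leq_maxl.
  - by move: y Gjy; exact/subsetPset/ndG/leq_maxr.
have [mF Fi] := Foo i; have [mG Gi] := Goo i; split.
  rewrite -[X in measurable X]setTI; apply: measurable_rV_uncons => //.
  exact: measurableX.
rewrite /lebesgue_rV_step /pushforward -comp_preimage.
rewrite (_ : _ \o _ = id) ?preimage_id; last first.
  by apply/funext => p /=; exact: rV_consK.
by rewrite product_measure1E// lte_mul_pinfty// ge0_fin_numE.
Qed.

HB.instance Definition _ := Measure_isSigmaFinite.Build _ _ _
  lebesgue_rV_step step_sigma_finite.

End step.

Fixpoint lebesgue_rV n : {sigma_finite_measure set 'rV[R]_n -> \bar R} :=
  match n return {sigma_finite_measure set 'rV[R]_n -> \bar R} with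
  | 0 => \d_(0 : 'rV[R]_0)
  | m.+1 => lebesgue_rV_step (lebesgue_rV m)
  end.

End lebesgue_rV.

Lemma lebesgue_rV_box (R : realType) n (a b : 'I_n -> R) :
  (forall i, a i <= b i) ->
  lebesgue_rV R n [set x | forall i, a i < x ord0 i <= b i] =
  (\prod_(i < n) (b i - a i))%:E.
Proof.
elim: n a b => [|n IH] a b ab.
  by rewrite big_ord0 /= diracE mem_set// => -[].
pose B := [set x : 'rV[R]_n |
  forall i, a (lift ord0 i) < x ord0 i <= b (lift ord0 i)].
have mB : measurable B.
  rewrite (_ : B = \bigcap_(i in [set: 'I_n])
      (@rV_coord R n i @^-1` `]a (lift ord0 i), b (lift ord0 i)])).
    apply: fin_bigcap_measurable => // i _.
    by rewrite -[X in measurable X]setTI; exact: measurable_rV_coord.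
  apply/seteqP; split => x /= H i => [_|]; first by rewrite /= in_itv; exact: H.
  by have := H i I; rewrite /= in_itv.
rewrite /= /lebesgue_rV_step /pushforward.
transitivity ((lebesgue_measure \x lebesgue_rV R n)%E (`]a ord0, b ord0] `*` B)).
  congr (_ _); apply/seteqP; split => -[y x] /= H.
    split; first by have := H ord0; rewrite mxE unlift_none /= in_itv.
    by move=> i; have := H (lift ord0 i); rewrite mxE liftK.
  move: H => [H1 H2] i; rewrite mxE; have [j ->|->] := unliftP ord0 i => /=.
    exact: H2.
  by rewrite in_itv /= in H1.
rewrite product_measure1E// IH// big_ord_recl EFinM; congr (_ * _)%E.
have := lebesgue_measure_itv `]a ord0, b ord0].
rewrite /= lte_fin => ->; case: ltP => // ba.
by rewrite (_ : b ord0 = a ord0) ?subrr//; apply/le_anti; rewrite ba ab.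
Qed.

(* Bochner integration over subsets of R, with values in a subspace D of a
   vector space V, for a (semi)norm nrm on D. *)
Section bochner.
Context (R : realType) (V : lmodType R) (D : set V) (nrm : V -> R).

Record vsfun := VSfun {
  vs_size : nat ;
  vs_dom : 'I_vs_size -> set (measurableTypeR R) ;
  vs_cst : 'I_vs_size -> V ;
  vs_measurable : forall i, measurable (vs_dom i) ;
  vs_in : forall i, D (vs_cst i) }.

Definition vs_val (s : vsfun) (t : R) : V :=
  \sum_(i < vs_size s) \1_(vs_dom i) t *: vs_cst i.

Definition vs_integral (J : set (measurableTypeR R)) (s : vsfun) : V :=
  \sum_(i < vs_size s) fine (lebesgue_measure (vs_dom i `&` J)) *: vs_cst i.

Definition ae_limit_vsfun (J : set (measurableTypeR R)) (h : R -> V)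
    (s : nat -> vsfun) : Prop :=
  {ae lebesgue_measure, forall t : measurableTypeR R, J t ->
    D (h t) /\ nrm (h t - vs_val (s n) t) @[n --> \oo] --> (0 : R)}.

Definition strongly_measurable J h : Prop :=
  exists s : nat -> vsfun, ae_limit_vsfun J h s.

(* h is Bochner integrable on J, with integral I.  The integrand
   nrm (h - s n) is Lebesgue measurable, being an a.e. limit of simple
   functions; on such nonnegative functions \int[lebesgue_measure], a supremum
   over Borel simple functions, agrees with the completed Lebesgue measure. *)
Definition is_bochner J h (I : V) : Prop :=
  D I /\ exists s : nat -> vsfun,
  [/\ ae_limit_vsfun J h s,
      (\int[lebesgue_measure]_(t in J) (nrm (h t - vs_val (s n) t))%:E)%E
        @[n --> \oo] --> 0%E &
      nrm (vs_integral J (s n) - I) @[n --> \oo] --> (0 : R)].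

End bochner.

Section dirichlet_laplacian.
Context (R : realType) (N : nat) (Omega : set 'rV[R]_N) (oO : open Omega).

Definition lebesgue_dom : set 'rV[R]_N -> \bar R :=
  mrestr (lebesgue_rV R N) (open_measurable_rV oO).

HB.instance Definition _ := Measure.on lebesgue_dom.

(* Elements are square-integrable functions, not classes: equality in
   L^2(Omega) is l2norm (x - y) = 0. *)
Local Notation L2 := (LfunType lebesgue_dom (lee1n 2)).

Definition l2enorm (x : 'rV[R]_N -> R) : \bar R :=
  ('N[lebesgue_dom]_2%:E[EFin \o x])%E.

Definition l2norm (x : L2) : R := fine (l2enorm x).

Definition l2dot (x y : 'rV[R]_N -> R) : R :=
  \int[lebesgue_dom]_s (x s * y s).

Definition partial (i : 'I_N) (phi : 'rV[R]_N -> R) : 'rV[R]_N -> R :=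
  fun x => 'D_(delta_mx ord0 i) phi x.

Fixpoint Cn (n : nat) (phi : 'rV[R]_N -> R) : Prop :=
  continuous phi /\
  if n is m.+1 then
    forall i, (forall x, derivable phi x (delta_mx ord0 i)) /\
              Cn m (partial i phi)
  else True.

Definition test_function (phi : 'rV[R]_N -> R) : Prop :=
  [/\ forall n, Cn n phi,
      compact (closure [set x | phi x != 0]) &
      closure [set x | phi x != 0] `<=` Omega].

(* x belongs to H^1_0(Omega), the H^1-closure of the test functions, and has
   gradient g *)
Definition H10 (x : L2) (g : 'I_N -> L2) : Prop :=
  exists phi : nat -> 'rV[R]_N -> R,
  [/\ forall n, test_function (phi n),
      l2enorm (x \- phi n) @[n --> \oo] --> 0%E &
      forall i, l2enorm (g i \- partial i (phi n)) @[n --> \oo] --> 0%E].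

(* x is in the domain of the Dirichlet Laplacian and - Delta x = y *)
Definition dirichlet_laplacian (x y : L2) : Prop :=
  exists2 g, H10 x g &
  forall phi, test_function phi ->
    \sum_(i < N) l2dot (g i) (partial i phi) = l2dot y phi.

Definition eigenspace (mu : R) : set L2 :=
  [set x | dirichlet_laplacian x (mu *: x)].

(* lam enumerates the distinct eigenvalues in increasing order, from index 0,
   and E j is the orthogonal projection onto the j-th eigenspace; the last
   clause is the completeness of the eigenspaces. *)
Record dirichlet_spectrum (lam : nat -> R) (E : nat -> L2 -> L2) : Prop := {
  spectrum_gt0 : 0 < lam 0%N ;
  spectrum_lt : forall j, lam j < lam j.+1 ;
  spectrum_cvgy : lam @ \oo --> +oo ;
  spectrumP : forall mu, (exists2 x, eigenspace mu x & l2norm x != 0) <->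
                         (exists j, mu = lam j) ;
  spectrum_finite : forall j, exists (m : nat) (e : 'I_m -> L2),
    forall x, eigenspace (lam j) x ->
      exists c : 'I_m -> R, l2norm (x - \sum_(i < m) c i *: e i) = 0 ;
  spectrum_projE : forall j x, eigenspace (lam j) (E j x) ;
  spectrum_proj_orth : forall j x y, eigenspace (lam j) y ->
    l2dot (x - E j x : L2) y = 0 ;
  spectrum_complete : forall x,
    l2norm (x - \sum_(j < n) E j x) @[n --> \oo] --> (0 : R) }.

Section beam.
Context (lam : nat -> R) (E : nat -> L2 -> L2).

(* the domain D(A^alpha), for A the Dirichlet Laplacian *)
Definition Xpow (alpha : R) : set L2 :=
  [set x | (\sum_(0 <= j <oo)
    (lam j `^ (2 * alpha) * l2norm (E j x) ^+ 2)%:E < +oo)%E].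

Definition Apow (alpha : R) (x : L2) : L2 :=
  xget 0 [set y | l2norm (y - \sum_(j < n) (lam j `^ alpha) *: E j x)
                    @[n --> \oo] --> (0 : R)].

(* Outside of Z1, znorm is a junk value: every use of it below comes with
   membership in Z1. *)
Definition Z1 : set (L2 * L2) := [set z | Xpow 1 z.1].

Definition znorm (z : L2 * L2) : R :=
  Num.sqrt (l2norm (Apow 1 z.1) ^+ 2 + l2norm z.2 ^+ 2).

Definition expmx (A : 'M[R]_2) : 'M[R]_2 :=
  limn (series (fun k => (k`!%:R)^-1 *: A ^+ k)).

Definition Kmx (beta : R) (j : nat) : 'M[R]_2 :=
  block_mx 0 (1%:M : 'M[R]_1) (- lam j ^+ 2)%:M (- (2 * beta * lam j))%:M.

Definition actP (A : 'M[R]_2) (j : nat) (z : L2 * L2) : L2 * L2 :=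
  (A ord0 ord0 *: E j z.1 + A ord0 ord_max *: E j z.2,
   A ord_max ord0 *: E j z.1 + A ord_max ord_max *: E j z.2).

(* T(t) z = sum_j exp(t K_j) P_j z, the series converging in Z^1 *)
Definition Tsg (beta t : R) (z : L2 * L2) : L2 * L2 :=
  xget 0 [set y | Z1 y /\
    znorm (y - \sum_(j < n) actP (expmx (t *: Kmx beta j)) j z)
      @[n --> \oo] --> (0 : R)].

(* y is the element (0, h(w(.), v(.), u(.))) of Z^1 *)
Definition is_nemytskii (h : R -> R -> R -> R) (z : L2 * L2) (u : L2)
    (y : L2 * L2) : Prop :=
  y.1 = 0 /\ {ae lebesgue_dom, forall x, y.2 x = h (z.1 x) (z.2 x) (u x)}.

(* y is the element M_g(t, s, z) of Z^1 *)
Definition is_memory (M : R -> 'rV[R]_N -> R) (g : R -> R) (t s : R)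
    (z y : L2 * L2) : Prop :=
  y.1 = 0 /\ {ae lebesgue_dom, forall x, y.2 x = M (t - s) x * g (z.1 x)}.

Definition L2_control (tau : R) (u : R -> L2) : Prop :=
  strongly_measurable setT l2norm `[0, tau] u /\
  (\int[lebesgue_measure]_(t in `[0%R, tau]) (l2norm (u t) ^+ 2)%:E < +oo)%E.

Definition C_initial (r : R) (Phi : R -> L2 * L2) : Prop :=
  forall s, s \in `[- r, 0] -> Z1 (Phi s) /\
    znorm (Phi s' - Phi s) @[s' --> within `[- r, 0] (nbhs s)] --> (0 : R).

(* M is (a representative of) an element of L^oo(]0, tau[ x Omega) *)
Definition mem_Linfty (tau : R) (M : R -> 'rV[R]_N -> R) : Prop :=
  let Q : set (measurableTypeR R * 'rV[R]_N) := `]0, tau[ `*` Omega in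
  measurable_fun Q (fun q => M q.1 q.2) /\
  exists C : R, {ae (lebesgue_measure \x lebesgue_rV R N)%E,
    forall q : measurableTypeR R * 'rV[R]_N, Q q -> `|M q.1 q.2| <= C}.

Section mild.
Context (beta tau r : R) (p : nat) (tk : 'I_p -> R).
Context (M : R -> 'rV[R]_N -> R) (g : R -> R) (f : R -> R -> R -> R -> R)
  (Ik : 'I_p -> R -> R -> R -> R -> R).

Definition piecewise_continuous (z : R -> L2 * L2) : Prop :=
  (forall t, t \in `[0, tau] -> (forall k, t != tk k) ->
    znorm (z s - z t) @[s --> within `[0, tau] (nbhs t)] --> (0 : R)) /\
  forall k, znorm (z s - z (tk k)) @[s --> (tk k)^'-] --> (0 : R) /\
    exists2 y, Z1 y & znorm (z s - y) @[s --> (tk k)^'+] --> (0 : R).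

(* In the variation of constants formula, FF s = F(s, z(s-r), u(s)),
   MG s l = M_g(s, l, z(l-r)), m s = \int_0^s MG s l dl and
   J k = I_k(t_k, z(t_k), u(t_k)).  That these expressions define elements of
   Z^1 and that the integrals exist is part of being a mild solution. *)
Definition mild_solution (Phi : R -> L2 * L2) (u : R -> L2)
    (z : R -> L2 * L2) : Prop :=
  [/\ forall s, s \in `[- r, tau] -> Z1 (z s),
      forall s, s \in `[- r, 0] -> znorm (z s - Phi s) = 0,
      piecewise_continuous z &
      exists (FF : R -> L2 * L2) (MG : R -> R -> L2 * L2) (m : R -> L2 * L2)
             (J : 'I_p -> L2 * L2),
      [/\ {ae lebesgue_measure, forall s : measurableTypeR R, s \in `[0, tau] ->
            is_nemytskii (f s) (z (s - r)) (u s) (FF s)},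
          {ae lebesgue_measure, forall s : measurableTypeR R, s \in `[0, tau] ->
            {ae lebesgue_measure, forall l : measurableTypeR R, l \in `[0, s] ->
              is_memory M g s l (z (l - r)) (MG s l)} /\
            is_bochner Z1 znorm `[0, s] (MG s) (m s)},
          forall k, is_nemytskii (Ik k (tk k)) (z (tk k)) (u (tk k)) (J k) &
          forall t, t \in `[0, tau] -> exists S1 S2 : L2 * L2,
          [/\ is_bochner Z1 znorm `[0, t]
                (fun s => Tsg beta (t - s) ((0, u s) + m s)) S1,
              is_bochner Z1 znorm `[0, t]
                (fun s => Tsg beta (t - s) (FF s)) S2 &
              znorm (z t - (Tsg beta t (Phi 0) + S1 + S2 +
                \sum_(k < p | tk k < t) Tsg beta (t - tk k) (J k))) = 0]]].

Definition uniquely_solvable : Prop :=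
  forall Phi u, C_initial r Phi -> L2_control tau u ->
  exists2 z, mild_solution Phi u z &
    forall z', mild_solution Phi u z' ->
      forall t, t \in `[- r, tau] -> znorm (z' t - z t) = 0.

Definition approximately_controllable : Prop :=
  forall (eps : R) Phi z1, 0 < eps -> C_initial r Phi -> Z1 z1 ->
  exists2 u, L2_control tau u &
    exists2 z, mild_solution Phi u z &
      znorm (z 0 - Phi 0) = 0 /\ znorm (z tau - z1) < eps.

End mild.
End beam.
End dirichlet_laplacian.

Notation L2 oO := (LfunType (lebesgue_dom oO) (lee1n 2)).

(* Main.v *)
(** Compare the solution z^u driven by a control u that vanishes up to time
    tau - delta with the uncontrolled solution z^0.  By causality they agree up
    to tau - delta; if delta is at most r and at most every tau - t_k, the memory
    term and the impulses see only that common past, so that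
      z^u(tau) - z^0(tau) = int T(tau - s) (0, u(s)) ds
        + int_(tau - delta)^tau T(tau - s) (F^u(s) - F^0(s)) ds.
    The delay makes F^u depend on z^0 near tau - r only, and the growth bound on
    f does not involve u: the last integral is O(delta) uniformly in u, whatever
    the cost of the control.  The first integral can be given any value in finitely
    many eigenmodes by a control taking two values on the two halves of
    (tau - delta, tau], because each K_j has two distinct real eigenvalues. *)
From HB Require Import structures.
Require Import Defs.
From mathcomp Require Import all_boot all_order all_algebra.
From mathcomp Require Import ring lra.
From mathcomp Require Import all_classical all_reals all_analysis.
From mathcomp Require Import measurable_realfun.
Set Implicit Arguments.
Unset Strict Implicit.
Unset Printing Implicit Defensive.
Import Order.TTheory GRing.Theory Num.Theory.
Import numFieldNormedType.Exports HBSimple HBNNSimple.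
Local Open Scope classical_set_scope.
Local Open Scope ring_scope.

(** * The space L^2 *)

(** The control needed on a short window may be huge, so no estimate may see its size. This fixes
    the order of choices: the bound [K] on the uncontrolled solution near time [tau - r], then the
    bound [B] on the forcing, then [delta], and only then the truncation [n] and the control. Half
    of [eps] pays for the modes beyond [n], the other half for the forcing on the window. Elements
    of [L2] are functions rather than classes, and [Apow] and [Tsg] pick arbitrary representatives
    of limits. Additivity and uniqueness therefore hold only up to norm zero and are proved mode by
    mode, completeness of the eigenspaces making the modes decisive. The pointwise operators of the
    equation are themselves given almost everywhere, so null differences pass through them.
    Integrals meet a similar obstacle: the norm of an integrand is only almost everywhere equal to a
    Borel function, so its integral is a lower integral, which is monotone but need not be
    additive. *)

Section l2_inner_product.
Context (R : realType) (N : nat) (Omega : set 'rV[R]_N) (oO : open Omega).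
Local Notation mu := (lebesgue_dom oO).
Local Notation L2 := (L2 oO).
Implicit Types x y z : L2.

Lemma l2norm_ge0 x : 0 <= l2norm x.
Proof. by rewrite fine_ge0// Lnorm_ge0. Qed.

Lemma l2enormE x : l2enorm oO x = (l2norm x)%:E.
Proof. by symmetry; exact: finite_norm_fine. Qed.

Lemma l2normD x y : l2norm (x + y) <= l2norm x + l2norm y.
Proof. exact: ler_LnormD. Qed.

Lemma l2normN x : l2norm (- x) = l2norm x.
Proof. exact: LnormrN. Qed.

Lemma l2normZ a x : l2norm (a *: x) = `|a| * l2norm x.
Proof.
by apply: EFin_inj; rewrite EFinM -!l2enormE; exact: LnormZ.
Qed.

Lemma l2norm0 : l2norm (0 : L2) = 0.
Proof. by rewrite -(scale0r 0) l2normZ normr0 mul0r. Qed.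

Lemma integrable_l2dot x y : mu.-integrable setT (EFin \o (fun s => x s * y s)).
Proof.
by apply/Lfun1_integrable/Lfun2_mul_Lfun1; exact: LfunP.
Qed.

Lemma l2dotC x y : l2dot oO x y = l2dot oO y x.
Proof. by apply: eq_Rintegral => s _; rewrite mulrC. Qed.

Lemma l2dotDl x y z : l2dot oO (x + y : L2) z = l2dot oO x z + l2dot oO y z.
Proof.
rewrite /l2dot -RintegralD//; try exact: integrable_l2dot.
by apply: eq_Rintegral => s _ /=; rewrite -mulrDl.
Qed.

Lemma l2dotZl a x y : l2dot oO (a *: x : L2) y = a * l2dot oO x y.
Proof.
rewrite /l2dot -RintegralZl//; try exact: integrable_l2dot.
by apply: eq_Rintegral => s _ /=; rewrite mulrA.
Qed.

Lemma l2dotDr x y z : l2dot oO z (x + y : L2) = l2dot oO z x + l2dot oO z y.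
Proof. by rewrite !(l2dotC z) l2dotDl. Qed.

Lemma l2dotZr a x y : l2dot oO y (a *: x : L2) = a * l2dot oO y x.
Proof. by rewrite !(l2dotC y) l2dotZl. Qed.

Lemma l2dotNl x y : l2dot oO (- x : L2) y = - l2dot oO x y.
Proof. by rewrite -scaleN1r l2dotZl mulN1r. Qed.

Lemma l2dotBl x y z : l2dot oO (x - y : L2) z = l2dot oO x z - l2dot oO y z.
Proof. by rewrite l2dotDl l2dotNl. Qed.

Lemma l2dotBr x y z : l2dot oO z (x - y : L2) = l2dot oO z x - l2dot oO z y.
Proof. by rewrite !(l2dotC z) l2dotBl. Qed.

Lemma l2dot0l y : l2dot oO (0 : L2) y = 0.
Proof. by rewrite -(scale0r 0) l2dotZl mul0r. Qed.

Lemma l2dot_suml I (s : seq I) (P : pred I) (F : I -> L2) y :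
  l2dot oO (\sum_(i <- s | P i) F i : L2) y = \sum_(i <- s | P i) l2dot oO (F i) y.
Proof.
elim/big_rec2 : _ => [|i a b _ <-]; first by rewrite l2dot0l.
by rewrite l2dotDl.
Qed.

Lemma l2norm_sqrE x : (l2norm x ^+ 2)%:E = (\int[mu]_s ((x s) ^+ 2)%:E)%E.
Proof.
have : ((l2enorm oO x) `^ 2 = \int[mu]_s ((x s) ^+ 2)%:E)%E.
  rewrite /l2enorm powR_Lnorm//; apply: eq_integral => s _ /=.
  by rewrite powR_mulrn// real_normK// num_real.
by rewrite l2enormE poweR_EFin powR_mulrn// l2norm_ge0.
Qed.

Lemma l2norm_sqr x : l2norm x ^+ 2 = l2dot oO x x.
Proof. by rewrite /l2dot /Rintegral -[LHS]/(fine (l2norm x ^+ 2)%:E) l2norm_sqrE. Qed.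

Lemma l2norm_eq0 x : l2dot oO x x = 0 -> l2norm x = 0.
Proof. by rewrite -l2norm_sqr => /eqP; rewrite sqrf_eq0 => /eqP. Qed.

Lemma l2norm0_ae x : l2norm x = 0 -> {ae mu, forall s, x s = 0}.
Proof. by move=> /fine_Lnormr_eq0; apply: filterS => s /(_ I). Qed.

Lemma ae_l2norm0 x : {ae mu, forall s, x s = 0} -> l2norm x = 0.
Proof.
move=> x0; apply: l2norm_eq0; rewrite -l2norm_sqr.
apply: EFin_inj; rewrite l2norm_sqrE (ae_eq_integral (cst 0%E))//.
- by rewrite integral0.
- by apply/measurable_EFinP; exact: measurable_funX.
- by apply: filterS x0 => s /= -> _; rewrite expr0n.
Qed.

Lemma l2normB_ae x y : {ae mu, forall s, x s = y s} -> l2norm (x - y) = 0.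
Proof.
move=> xy; apply: ae_l2norm0; apply: filterS xy => s xy.
by rewrite -[LHS]/(x s - y s) xy subrr.
Qed.

Lemma l2_cauchy_schwarz x y : `|l2dot oO x y| <= l2norm x * l2norm y.
Proof.
have [x0|xn0] := eqVneq (l2norm x) 0.
  rewrite x0 mul0r; have /l2norm0_ae h := x0.
  rewrite /l2dot /Rintegral (ae_eq_integral (cst 0%E))//.
  - by rewrite integral0 normr0.
  - by apply/measurable_EFinP; exact: measurable_funM.
  - by apply: filterS h => s /= -> _; rewrite mul0r.
rewrite -(@ler_pXn2r _ 2)// ?nnegrE ?mulr_ge0 ?l2norm_ge0//.
rewrite real_normK ?num_real// exprMn !l2norm_sqr.
(* This squared norm equals [a * (a * c - b ^+ 2)] in the notation below; dividing by [a] is why the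
   null case was split off. *)
have : 0 <= l2dot oO (l2dot oO x x *: y - l2dot oO x y *: x : L2)
                     (l2dot oO x x *: y - l2dot oO x y *: x : L2).
  by rewrite -l2norm_sqr sqr_ge0.
rewrite !(l2dotBl, l2dotBr, l2dotZl, l2dotZr) (l2dotC y x).
have : 0 < l2dot oO x x by rewrite -l2norm_sqr exprn_gt0// lt_def xn0 l2norm_ge0.
set a := l2dot oO x x; set b := l2dot oO x y; set c := l2dot oO y y => a0.
rewrite (_ : _ - _ = a * (a * c - b ^+ 2)); last by ring.
by rewrite pmulr_rge0// subr_ge0.
Qed.

End l2_inner_product.

(** * The Riesz-Fischer theorem *)

Section riesz_fischer.
Context (R : realType) (N : nat) (Omega : set 'rV[R]_N) (oO : open Omega).
Local Notation mu := (lebesgue_dom oO).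
Local Notation L2 := (L2 oO).

(** Fatou's lemma for the squares. The limit [h] is just a measurable function, so the bound is on
    [l2enorm]; a finite bound is what later places the limit of a Cauchy sequence in L^2. *)
Lemma l2_fatou (w : nat -> L2) (h : 'rV[R]_N -> R) (e : R) : 0 <= e ->
  measurable_fun setT h -> (\forall n \near \oo, l2norm (w n) <= e) ->
  {ae mu, forall s, w n s @[n --> \oo] --> h s} ->
  (l2enorm oO h <= e%:E)%E.
Proof.
move=> e0 mh [K _ wK] wh.
have he : (\int[mu]_s (h s ^+ 2)%:E <= (e ^+ 2)%:E)%E.
  (* Shifting by [K] turns the eventual bound into one valid for all indices. *)
  pose F n s := ((w (n + K)%N s) ^+ 2)%:E.
  have -> : (\int[mu]_s (h s ^+ 2)%:E = \int[mu]_s limn_einf (F ^~ s))%E.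
    apply: ae_eq_integral => //.
    - by apply/measurable_EFinP; exact: measurable_funX.
    - rewrite (_ : (fun s => _) = (fun s => - limn_esup (fun n => - F n s))%E).
        apply: measurableT_comp => //; apply: measurable_fun_limn_esup => n.
        by apply: measurableT_comp => //; apply/measurable_EFinP; exact: measurable_funX.
      by apply/funext => s; rewrite -limn_einfN; congr limn_einf; apply/funext => n; rewrite [RHS]oppeK.
    - apply: filterS wh => s ws _.
      have : F n s @[n --> \oo] --> (h s ^+ 2)%:E.
        apply: cvg_EFin; first by near=> n.
        rewrite /F /comp /=.
        apply: (@cvgM _ _ _ _ (fun n => w (n + K)%N s) (fun n => w (n + K)%N s)).
          by rewrite (cvg_shiftn K (fun n => w n s)).
        by rewrite (cvg_shiftn K (fun n => w n s)).
      by move=> /cvg_limn_einf_sup[].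
  apply: le_trans (fatou _ _ _ _) _ => //.
  - by move=> n; apply/measurable_EFinP; exact: measurable_funX.
  - by move=> n s _; rewrite lee_fin sqr_ge0.
  rewrite limn_einf_lim; apply: lime_le; first exact: is_cvg_einfs.
  apply: nearW => n; rewrite /einfs /=.
  apply: (@le_trans _ _ (\int[mu]_s F n s)%E).
    by apply: ereal_inf_lbound; exists n => /=.
  rewrite -l2norm_sqrE lee_fin ler_pXn2r// ?nnegrE ?l2norm_ge0//.
  by apply: wK => /=; rewrite leq_addl.
rewrite /l2enorm unlock.
apply: (@le_trans _ _ ((e ^+ 2)%:E `^ 2^-1)%E); last first.
  by rewrite poweR_EFin -powR_mulrn// -powRrM mulfV// powRr1.
rewrite gt0_ler_poweR//.
- by rewrite in_itv/= leey integral_ge0// => s _; rewrite poweR_ge0.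
- by rewrite in_itv/= leey lee_fin sqr_ge0.
under eq_integral => s _ do rewrite /= powR_mulrn// real_normK ?num_real//.
exact: he.
Unshelve. all: end_near. Qed.

(* The weighted series [\sum_k 4 ^+ k * (x k.+1 - x k) ^+ 2] is integrable, hence
   a.e. finite, so the increments are a.e. dominated by a geometric sequence. *)
Lemma ae_cvg_of_fast_cauchy (x : nat -> L2) :
  (forall k, 4 ^+ k * l2norm (x k.+1 - x k) ^+ 2 <= 1 / (2 ^ k.+1)%:R) ->
  {ae mu, forall s, cvgn (fun k => x k s)}.
Proof.
move=> xk.
pose F k s := (4 ^+ k * (x k.+1 s - x k s) ^+ 2)%:E.
have mF k : measurable_fun setT (F k).
  apply/measurable_EFinP; apply: measurable_funM => //.
  by apply: measurable_funX; exact: measurable_funB.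
have F0 k s : (0 <= F k s)%E by rewrite lee_fin mulr_ge0// sqr_ge0.
have iF : mu.-integrable setT (fun s => \sum_(0 <= k <oo) F k s)%E.
  apply/integrableP; split.
    by apply: ge0_emeasurable_sum => // k s _.
  rewrite (_ : (\int[mu]_s _ = \int[mu]_s (\sum_(0 <= k <oo) F k s))%E); last first.
    by apply: eq_integral => s _; rewrite gee0_abs// nneseries_ge0.
  rewrite integral_nneseries//.
  apply: (@le_lt_trans _ _ (\sum_(0 <= k <oo) (1 / (2 ^ k.+1)%:R)%:E)%E).
    apply: lee_nneseries => k _; first by move=> _; apply: integral_ge0.
    apply: le_trans (xk k : (_%:E <= _%:E)%E).
    rewrite EFinM l2norm_sqrE -ge0_integralZl//.
    - by apply/measurable_EFinP; exact: measurable_funX.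
    - by move=> s _; rewrite lee_fin sqr_ge0.
  by apply: le_lt_trans (epsilon_trick0 xpredT ler01) _; rewrite ltry.
apply: filterS (integrable_ae measurableT iF) => s /(_ I) fs.
have xE k : x k s = x 0%N s + series (telescope (fun k => x k s)) k.
  exact: eq_sum_telescope.
rewrite (funext xE); apply: is_cvgD; first exact: is_cvg_cst.
apply: normed_cvg.
(* Each term of the series is at most its sum [C ^+ 2], whence
   [2 ^+ k * |x k.+1 s - x k s| <= C]. *)
pose C := Num.sqrt (fine (\sum_(0 <= k <oo) F k s)%E).
apply: (@series_le_cvg _ _ (geometric C 2^-1)).
- by move=> k /=.
- by move=> k /=; rewrite mulr_ge0 ?sqrtr_ge0.
- move=> k; rewrite /= /telescope.
  rewrite -[leLHS](@mulfK _ (2 ^+ k)) ?expf_neq0// exprVn ler_pM2r ?invr_gt0 ?exprn_gt0//.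
  rewrite -[leLHS]ger0_norm ?mulr_ge0// -sqrtr_sqr ler_sqrt ?fine_ge0 ?nneseries_ge0//.
  rewrite -lee_fin fineK//.
  apply: le_trans (@nneseries_lim_ge _ (F^~ s) xpredT 0%N k.+1 _) => //.
  rewrite (big_nat_recr k)//=.
  apply: (@le_trans _ _ (F k s)); last by rewrite leeDr// sume_ge0.
  rewrite /F lee_fin exprMn real_normK ?num_real// -exprM mulnC exprM mulrC.
  by rewrite (_ : (2 ^+ 2 : R) = 4)// -natrX.
- have h : `|2^-1 : R| < 1 by rewrite ger0_norm// invf_lt1// ltr1n.
  exact: (@is_cvg_geometric_series _ C _ h).
Qed.

Lemma l2_complete (x : nat -> L2) :
  (forall e, 0 < e -> exists n0, forall m n, (n0 <= m)%N -> (n0 <= n)%N ->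
     l2norm (x m - x n) < e) ->
  exists y, l2norm (x n - y) @[n --> \oo] --> (0 : R).
Proof.
move=> cx.
have [e eP] : {e : nat -> R | forall k, 0 < e k /\
    4 ^+ k * e k ^+ 2 <= 1 / (2 ^ k.+1)%:R}.
  (* With this choice [4 ^+ k * e k ^+ 2] is [1 / (16 * 4 ^+ k)], below [1 / 2 ^+ k.+1]. *)
  exists (fun k => 4 ^- k.+1) => k; split; first by rewrite invr_gt0 exprn_gt0.
  have a0 : 0 < 4 ^+ k :> R by rewrite exprn_gt0.
  rewrite div1r natrX !exprS.
  rewrite (_ : _ * (_ * _) = (16 * 4 ^+ k)^-1); last first.
    by move: (4 ^+ k) a0 => a a0; field; rewrite gt_eqF.
  rewrite lef_pV2 ?posrE ?mulr_gt0 ?exprn_gt0//.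
  by rewrite ler_pM ?exprn_ge0 ?ler_nat// lerXn2r ?nnegrE ?ler_nat.
have /choice[n0 n0P] : forall k, exists n0, forall m n, (n0 <= m)%N -> (n0 <= n)%N ->
    l2norm (x m - x n) < e k.
  by move=> k; apply: cx; have [] := eP k.
(* Summing the indices makes them strictly increasing while staying above [n0 k]. *)
pose nn k := (\sum_(i < k.+1) (n0 i).+1)%N.
have nn_ge k : (n0 k <= nn k)%N.
  by rewrite /nn big_ord_recr/=; apply: leq_trans (leq_addl _ _); exact: leqnSn.
have nnS k : (nn k < nn k.+1)%N.
  by rewrite /nn [X in (_ < X)%N]big_ord_recr/= addnS ltnS leq_addr.
have nn_id k : (k <= nn k)%N.
  by elim: k => // k IH; apply: leq_ltn_trans (nnS k).
pose X k := x (nn k).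
have Xc : {ae mu, forall s, cvgn (fun k => X k s)}.
  apply: ae_cvg_of_fast_cauchy => k; have [e0 ek] := eP k.
  apply: le_trans ek; rewrite ler_pM2l ?exprn_gt0//.
  rewrite ler_pXn2r ?nnegrE ?l2norm_ge0 ?ltW//.
  by apply: n0P; rewrite ?nn_ge// (leq_trans (nn_ge k))// ltnW.
(* The limsup is measurable on the whole space and agrees with the limit wherever that exists. *)
pose y s := fine (limn_esup (fun k => (X k s)%:E)).
have my : measurable_fun setT y.
  apply: measurableT_comp => //.
  by apply: measurable_fun_limn_esup => n; apply/measurable_EFinP.
have Xy : {ae mu, forall s, X k s @[k --> \oo] --> y s}.
  apply: filterS Xc => s cs.
  have : (X k s)%:E @[k --> \oo] --> (limn (fun k => X k s))%:E.
    by apply: cvg_EFin => //; near=> k.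
  by move=> /cvg_limn_einf_sup[_]; rewrite /y => ->.
have yb n : forall e, 0 < e -> (\forall m \near \oo, l2norm (X m - x n) <= e) ->
    (l2enorm oO (y \- x n)%R <= e%:E)%E.
  move=> a a0 Xn; apply: (@l2_fatou (fun m => X m - x n)) => //.
  - exact: ltW.
  - exact: measurable_funB.
  - apply: filterS Xy => s ys; rewrite /= [X in X @ _ --> _](_ : _ = (fun m => X m s - x n s))//.
    by apply: cvgB => //; exact: cvg_cst.
have cX a : 0 < a -> exists K, forall n, (K <= n)%N -> \forall m \near \oo, l2norm (X m - x n) <= a.
  move=> a0; have [K KP] := cx _ a0; exists K => n Kn.
  exists K => // m /= Km; apply/ltW/KP => //.
  exact: leq_trans (nn_id m).
have yL : y \in Lfun mu 2%:E.
  have [K KP] := cX 1 ltr01.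
  have yK := yb K _ ltr01 (KP _ (leqnn _)).
  have dL : (y \- x K) \in Lfun mu 2%:E.
    apply/andP; split; first by rewrite inE/=; apply: measurable_funB.
    by rewrite inE/=; apply: le_lt_trans yK _; rewrite ltry.
  have -> : y = (Lfun_Sub (lee1n 2) dL + x K : L2).
    by apply/funext => s; rewrite -[RHS]/(y s - x K s + x K s) subrK.
  exact: LfunP.
exists (Lfun_Sub (lee1n 2) yL); apply/cvgrPdist_le => /= a a0.
have [K KP] := cX _ a0; exists K => // n /= Kn.
rewrite sub0r normrN ger0_norm ?l2norm_ge0// -l2normN opprB -lee_fin -l2enormE.
by apply: yb => //; exact: KP.
Unshelve. all: end_near. Qed.

End riesz_fischer.

(** * Spectral projections of the Dirichlet Laplacian *)

Section spectral_projections.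
Context (R : realType) (N : nat) (Omega : set 'rV[R]_N) (oO : open Omega).
Local Notation mu := (lebesgue_dom oO).
Local Notation L2 := (L2 oO).

Lemma continuous_measurable_rV (phi : 'rV[R]_N -> R) :
  continuous phi -> measurable_fun setT phi.
Proof.
move=> cphi; apply: (measurability _ (RGenOInfty.measurableE R)).
move=> _ [_ [a ->] <-]; rewrite setTI; apply: open_measurable_rV.
by apply: open_comp => // x _; exact: cphi.
Qed.

(** The [psi n] are not given as elements of [L2]. Once the norm of [u \- psi n] is finite, this
    difference is some [v] in [L2], and Cauchy-Schwarz applies to [v = u - psi n]. *)
Lemma cvg_l2dotr (z u : L2) (psi : nat -> 'rV[R]_N -> R) :
  (forall n, measurable_fun setT (psi n)) ->
  l2enorm oO (u \- psi n) @[n --> \oo] --> 0%E ->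
  l2dot oO z (psi n) @[n --> \oo] --> l2dot oO z u.
Proof.
move=> mpsi cpsi.
have /fine_cvgP[fpsi cf] := cpsi.
apply/cvgrPdist_le => /= e e0.
have z0 : 0 < l2norm z + 1 by rewrite ltr_wpDl ?l2norm_ge0.
have ez : 0 < e / (l2norm z + 1) by rewrite divr_gt0.
move/cvgrPdist_le/(_ _ ez) : cf => cf.
near=> n.
have fn : l2enorm oO (u \- psi n) \is a fin_num by near: n.
have le : `|0 - fine (l2enorm oO (u \- psi n))| <= e / (l2norm z + 1) by near: n.
have dL : (u \- psi n) \in Lfun mu 2%:E.
  apply/andP; split; first by rewrite inE/=; exact: measurable_funB.
  by rewrite inE/=; move: fn; rewrite ge0_fin_numE// Lnorm_ge0.
pose v : L2 := Lfun_Sub (lee1n 2) dL.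
have -> : psi n = (u - v : L2).
  by apply/funext => s; rewrite -[RHS]/(u s - (u s - psi n s)) subKr.
rewrite l2dotBr subKr; apply: le_trans (l2_cauchy_schwarz _ _) _.
have vle : l2norm v <= e / (l2norm z + 1).
  by move: le; rewrite sub0r normrN ger0_norm// fine_ge0// Lnorm_ge0.
apply: (@le_trans _ _ ((l2norm z + 1) * (e / (l2norm z + 1)))).
  by rewrite ler_pM ?l2norm_ge0// lerDl.
by rewrite mulrC divfK// gt_eqF.
Unshelve. all: end_near. Qed.

(** Density: the weak equation passes from test functions to their H^1-limits. The left-hand side is
    the symmetric Dirichlet form. *)
Lemma dirichlet_laplacian_dot (x y z : L2) (g h : 'I_N -> L2) :
  H10 y h ->
  (forall phi, test_function Omega phi ->
    \sum_(i < N) l2dot oO (g i) (partial i phi) = l2dot oO z phi) ->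
  \sum_(i < N) l2dot oO (g i) (h i) = l2dot oO z y.
Proof.
move=> [phi [tphi yphi hphi]] gz.
have cphi n k : Cn k (phi n) by have [] := tphi n.
have mphi n : measurable_fun setT (phi n).
  by apply: continuous_measurable_rV; have [] := cphi n 0%N.
have mpart n i : measurable_fun setT (partial i (phi n)).
  apply: continuous_measurable_rV.
  by have [_ /(_ i)[_ []]] := cphi n 1%N.
have c1 : l2dot oO z (phi n) @[n --> \oo] --> l2dot oO z y by exact: cvg_l2dotr.
have c2 : (\sum_(i < N) l2dot oO (g i) (partial i (phi n))) @[n --> \oo] -->
    \sum_(i < N) l2dot oO (g i) (h i).
  apply: cvg_big => [|i _]; last exact: cvg_l2dotr (hphi i).
  exact: add_continuous.
rewrite (_ : (fun n => _) = (fun n => l2dot oO z (phi n))) in c2.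
  exact: cvg_unique c2 c1.
by apply/funext => n; exact: gz.
Qed.

(** The Dirichlet form of [x] and [y] equals both [a] times and [b] times their inner product. *)
Lemma eigenspace_orthogonal (a b : R) (x y : L2) : a != b ->
  Defs.eigenspace a x -> Defs.eigenspace b y -> l2dot oO x y = 0.
Proof.
move=> ab [g xg gx] [h yh hy].
have e1 := @dirichlet_laplacian_dot x y _ g h yh gx.
have e2 := @dirichlet_laplacian_dot y x _ h g xg hy.
have : (a - b) * l2dot oO x y = 0.
  rewrite mulrBl -l2dotZl -e1 l2dotC -l2dotZl -e2 -sumrB big1// => i _.
  by rewrite l2dotC subrr.
by move/eqP; rewrite mulf_eq0 subr_eq0 (negbTE ab) => /eqP.
Qed.



Lemma l2dot_null (d z : L2) : l2norm d = 0 -> l2dot oO d z = 0.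
Proof.
move=> d0; have := l2_cauchy_schwarz d z.
by rewrite d0 mul0r normr_le0 => /eqP.
Qed.

Lemma l2norm_distC (x y : L2) : l2norm (x - y) = l2norm (y - x).
Proof. by rewrite -l2normN opprB. Qed.

Lemma l2norm_eqv (x y : L2) : l2norm (x - y) = 0 -> l2norm x = l2norm y.
Proof.
move=> xy; apply/le_anti/andP; split.
  by rewrite -(subrK y x) (le_trans (l2normD _ _))// xy add0r.
by rewrite -(subrK x y) (le_trans (l2normD _ _))// l2norm_distC xy add0r.
Qed.

Lemma l2norm_tri (x y z : L2) : l2norm (x - z) <= l2norm (x - y) + l2norm (y - z).
Proof. by rewrite (le_trans _ (l2normD _ _))// subrKA. Qed.

Lemma l2_pythagoras (y : nat -> L2) (m n : nat) :
  (forall i j, i != j -> l2dot oO (y i) (y j) = 0) ->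
  l2norm (\sum_(m <= i < n) y i) ^+ 2 = \sum_(m <= i < n) l2norm (y i) ^+ 2.
Proof.
move=> yo; rewrite l2norm_sqr l2dot_suml; apply: eq_big_nat => i imn.
rewrite l2dotC l2dot_suml l2norm_sqr (big_rem i) ?mem_index_iota//=.
rewrite big1_seq ?addr0// => j /andP[_].
by rewrite (mem_rem_uniq _ (iota_uniq _ _)) inE => /andP[ji _]; exact: yo.
Qed.

(** * Projections onto the eigenspaces and expansion in modes *)

Variables (lam : nat -> R) (E : nat -> L2 -> L2).
Hypothesis hE : dirichlet_spectrum lam E.
Implicit Types u v w x y z : L2.

Lemma lam_gt0 j : 0 < lam j.
Proof.
elim: j => [|j IH]; first exact: spectrum_gt0 hE.
exact: lt_trans (spectrum_lt hE j).
Qed.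

Lemma lam_homo i j : (i < j)%N -> lam i < lam j.
Proof. by move: i j; exact: (homo_ltn (fun b a c => @lt_trans _ _ b a c) (spectrum_lt hE)). Qed.

Lemma lam_neq i j : i != j -> lam i != lam j.
Proof.
by rewrite neq_ltn => /orP[] /lam_homo h; rewrite ?(lt_eqF h)// gt_eqF.
Qed.

Lemma lam0_le j : lam 0%N <= lam j.
Proof. by case: j => // j; apply/ltW/lam_homo. Qed.

Lemma projE_orth j x w : l2dot oO (x - E j x : L2) (E j w) = 0.
Proof. by apply: (spectrum_proj_orth hE); exact: (spectrum_projE hE). Qed.

Lemma projE_dot j x w : l2dot oO (E j x) (E j w) = l2dot oO x (E j w).
Proof. by apply/eqP; rewrite eq_sym -subr_eq0 -l2dotBl projE_orth. Qed.

Lemma projE_ortho j k x y : j != k -> l2dot oO (E j x) (E k y) = 0.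
Proof.
move=> /lam_neq jk.
by apply: (eigenspace_orthogonal jk); exact: (spectrum_projE hE).
Qed.

(* The eigenspaces need not be shown to be closed under addition: the projections
   are linear up to l2norm 0 by orthogonality alone. *)
Lemma projE_uniq j x v : (forall w, l2dot oO (x - v : L2) (E j w) = 0) ->
  l2dot oO (E j x - v : L2) v = 0 -> l2norm (E j x - v) = 0.
Proof.
move=> xv vv; apply: l2norm_eq0.
rewrite l2dotBr vv subr0.
by rewrite l2dotBl projE_dot -l2dotBl xv.
Qed.

Lemma projE_lin j a x y : l2norm (E j (a *: x + y) - (a *: E j x + E j y)) = 0.
Proof.
have h w : l2dot oO ((a *: x + y) - (a *: E j x + E j y) : L2) (E j w) = 0.
  by rewrite opprD addrACA -scalerBr l2dotDl l2dotZl !projE_orth mulr0 addr0.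
apply: projE_uniq => //; rewrite l2dotDr l2dotZr.
have h' w : l2dot oO (E j (a *: x + y) - (a *: E j x + E j y) : L2) (E j w) = 0.
  by rewrite l2dotBl projE_dot -l2dotBl h.
by rewrite !h' mulr0 addr0.
Qed.

Lemma projE_idem j x : l2norm (E j (E j x) - E j x) = 0.
Proof.
apply: projE_uniq => [w|]; first by rewrite subrr l2dot0l.
by rewrite l2dotBl projE_dot subrr.
Qed.

Lemma projE_neq j k x : j != k -> l2norm (E j (E k x)) = 0.
Proof.
move=> jk; rewrite -[E j _]subr0; apply: projE_uniq => [w|].
  by rewrite subr0 projE_ortho// eq_sym.
by rewrite l2dotC l2dot0l.
Qed.

Lemma projE_le j x : l2norm (E j x) <= l2norm x.
Proof.
have : l2norm (E j x) ^+ 2 <= l2norm x * l2norm (E j x).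
  rewrite l2norm_sqr projE_dot (le_trans (ler_norm _))//.
  exact: l2_cauchy_schwarz.
have [->|n0] := eqVneq (l2norm (E j x)) 0; first by rewrite l2norm_ge0.
by rewrite expr2 ler_pM2r// lt_def n0 l2norm_ge0.
Qed.

(** Membership in the eigenspace up to norm zero, as a fixed-point condition: closure under linear
    combinations then follows from [projE_lin]. *)
Definition mode j (v : L2) := l2norm (E j v - v) = 0.

Lemma mode_projE j x : mode j (E j x).
Proof. exact: projE_idem. Qed.

Lemma mode_lin j a x y : mode j x -> mode j y -> mode j (a *: x + y).
Proof.
move=> mx my; apply/le_anti; rewrite l2norm_ge0 andbT.
apply: le_trans (l2norm_tri _ (a *: E j x + E j y) _) _.
rewrite projE_lin add0r opprD addrACA -scalerBr (le_trans (l2normD _ _))//.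
by rewrite l2normZ mx my mulr0 addr0.
Qed.

Lemma mode0 j : mode j 0.
Proof.
rewrite /mode subr0; apply/le_anti; rewrite l2norm_ge0 andbT.
by rewrite (le_trans (projE_le _ _))// l2norm0.
Qed.

Lemma modeZ j a x : mode j x -> mode j (a *: x).
Proof. by move=> mx; rewrite -[_ *: _]addr0; apply: mode_lin => //; exact: mode0. Qed.

Lemma modeD j x y : mode j x -> mode j y -> mode j (x + y).
Proof. by move=> mx my; rewrite -[x]scale1r; apply: mode_lin. Qed.

Lemma projEB_le j x y : l2norm (E j x - E j y) <= l2norm (x - y).
Proof.
apply: le_trans (projE_le j _).
rewrite (@l2norm_eqv (E j (x - y)) (E j x - E j y))//.
have := projE_lin j (-1) y x.
by rewrite !scaleN1r !(addrC (- _)).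
Qed.

Lemma projE_eqv j x y : l2norm (x - y) = 0 -> l2norm (E j x - E j y) = 0.
Proof. by move=> xy; apply/le_anti; rewrite l2norm_ge0 andbT -xy projEB_le. Qed.

Lemma mode_neq j k v : j != k -> mode k v -> l2norm (E j v) = 0.
Proof.
move=> jk mv; rewrite -(projE_neq v jk); apply: l2norm_eqv.
by apply: projE_eqv; rewrite l2norm_distC.
Qed.

Lemma l2dot_eqv x y z : l2norm (x - y) = 0 -> l2dot oO x z = l2dot oO y z.
Proof. by move=> /l2dot_null h; apply/eqP; rewrite -subr_eq0 -l2dotBl h. Qed.

Lemma mode_orth j k u v : j != k -> mode j u -> mode k v -> l2dot oO u v = 0.
Proof.
move=> jk mu' mv; rewrite -(l2dot_eqv _ mu') l2dotC -(l2dot_eqv _ mv) l2dotC.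
exact: projE_ortho.
Qed.

Lemma parseval_partial x n :
  l2norm (x - \sum_(j < n) E j x) ^+ 2 = l2norm x ^+ 2 - \sum_(j < n) l2norm (E j x) ^+ 2.
Proof.
have xS : l2dot oO x (\sum_(j < n) E j x : L2) = \sum_(j < n) l2norm (E j x) ^+ 2.
  rewrite l2dotC l2dot_suml; apply: eq_bigr => j _.
  by rewrite l2norm_sqr projE_dot l2dotC.
have SS : l2dot oO (\sum_(j < n) E j x : L2) (\sum_(j < n) E j x : L2) =
    \sum_(j < n) l2norm (E j x) ^+ 2.
  rewrite -l2norm_sqr -(big_mkord xpredT (fun j => E j x)) l2_pythagoras ?big_mkord//.
  by move=> i j ij; exact: projE_ortho.
rewrite l2norm_sqr l2dotBl !l2dotBr SS (l2dotC (\sum_(j < n) E j x : L2)) xS -l2norm_sqr.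
by rewrite subrr subr0.
Qed.

Lemma parseval x : \sum_(j < n) l2norm (E j x) ^+ 2 @[n --> \oo] --> l2norm x ^+ 2.
Proof.
have := spectrum_complete hE x => h.
rewrite -[X in _ --> X]subr0 -[X in _ - X](mulr0 0).
rewrite (_ : (fun n => _) = (fun n => l2norm x ^+ 2 -
   l2norm (x - \sum_(j < n) E j x) * l2norm (x - \sum_(j < n) E j x))); last first.
  by apply/funext => n; rewrite -expr2 parseval_partial subKr.
by apply: cvgB; [exact: cvg_cst|exact: cvgM].
Qed.

(** Parseval's identity for [x - y]. It reduces identities between limits of series to identities in
    each mode. *)
Lemma projE_ext x y : (forall j, l2norm (E j x - E j y) = 0) -> l2norm (x - y) = 0.
Proof.
move=> xy; apply/eqP; rewrite -sqrf_eq0; apply/eqP.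
apply: (cvg_unique _ (@parseval (x - y))) => //.
rewrite (_ : (fun n => _) = (fun=> 0)); first exact: cvg_cst.
apply/funext => n; rewrite big1// => j _; apply/eqP; rewrite sqrf_eq0.
have := projE_lin j (-1) y x; rewrite !scaleN1r !(addrC (- _)).
by move=> /l2norm_eqv ->; rewrite xy.
Qed.

Lemma projED j x y : l2norm (E j (x + y) - (E j x + E j y)) = 0.
Proof. by have := projE_lin j 1 x y; rewrite !scale1r. Qed.

Lemma projE_sum_modes j n (y : nat -> L2) : (forall i, mode i (y i)) ->
  l2norm (E j (\sum_(i < n) y i) - (if (j < n)%N then y j else 0)) = 0.
Proof.
move=> my; elim: n => [|n IH]; first by rewrite big_ord0 mode0.
apply/le_anti; rewrite l2norm_ge0 andbT big_ord_recr/=.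
apply: le_trans (l2norm_tri _ (E j (\sum_(i < n) y i) + E j (y n)) _) _.
rewrite projED add0r ltnS leq_eqVlt.
case: (eqVneq j n) IH => [->|jn] IH.
  move: IH; rewrite ltnn subr0 => IH /=.
  by rewrite -addrA (le_trans (l2normD _ _))// IH my addr0.
rewrite /= addrAC (le_trans (l2normD _ _))// IH add0r.
by rewrite (mode_neq jn (my n)).
Qed.

(** By orthogonality the squared distances of partial sums are increments of the bounded monotone
    sequence [q], so the partial sums are Cauchy. Coefficients pass to the limit because [E j] is a
    contraction. *)
Lemma riesz_fischer_modes (y : nat -> L2) (B : R) : (forall j, mode j (y j)) ->
  (forall n, \sum_(j < n) l2norm (y j) ^+ 2 <= B) ->
  exists Y : L2, l2norm (Y - \sum_(j < n) y j) @[n --> \oo] --> (0 : R) /\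
    forall j, l2norm (E j Y - y j) = 0.
Proof.
move=> my yB.
pose S n := \sum_(0 <= j < n) y j.
pose q n := \sum_(0 <= j < n) l2norm (y j) ^+ 2.
have yo i j : i != j -> l2dot oO (y i) (y j) = 0 by move=> ij; exact: mode_orth (my i) (my j).
have SB m n : (m <= n)%N -> l2norm (S n - S m) ^+ 2 = q n - q m.
  have sub (V : zmodType) (F : nat -> V) : (m <= n)%N ->
      \sum_(0 <= j < n) F j - \sum_(0 <= j < m) F j = \sum_(m <= j < n) F j.
    by move=> mn; rewrite (big_cat_nat _ mn)//= addrAC subrr add0r.
  by move=> mn; rewrite /S /q !sub// l2_pythagoras.
have cq : cvgn q.
  apply: nondecreasing_is_cvgn.
    move=> m n mn; rewrite /q (big_cat_nat _ mn)//= lerDl.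
    by apply: sumr_ge0 => i _; rewrite sqr_ge0.
  by exists B => _ [n _ <-]; rewrite /q big_mkord.
have [Y cY] : exists Y : L2, l2norm (S n - Y) @[n --> \oo] --> (0 : R).
  apply: l2_complete => e e0.
  have e20 : 0 < e ^+ 2 / 2 by rewrite divr_gt0// exprn_gt0.
  have /cvgrPdist_lt/(_ _ e20)[n0 _ n0P] := cq; exists n0.
  have wl m n : (n0 <= m)%N -> (n0 <= n)%N -> (m <= n)%N -> l2norm (S m - S n) < e.
    move=> n0m n0n mn; rewrite l2norm_distC -(@ltr_pXn2r _ 2)// ?nnegrE ?l2norm_ge0 ?ltW//.
    rewrite SB//.
    have := n0P m n0m; have := n0P n n0n; rewrite /= !ltr_norml.
    by move=> /andP[? ?] /andP[? ?]; lra.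
  move=> m n n0m n0n; have [mn|nm] := leqP m n; first exact: wl.
  by rewrite l2norm_distC wl// ltnW.
have cY' : l2norm (Y - S n) @[n --> \oo] --> (0 : R).
  by under eq_fun do rewrite l2norm_distC.
exists Y; split; first by under eq_fun do rewrite -(big_mkord xpredT y).
move=> j; apply/le_anti; rewrite l2norm_ge0 andbT.
rewrite -[leRHS](cvg_lim _ cY')//; apply: limr_ge; first exact: cvgP cY'.
near=> n; have jn : (j < n)%N by near: n; exact: nbhs_infty_gt.
apply: le_trans (projEB_le j _ _); apply: le_trans (l2norm_tri _ (E j (S n)) _) _.
have := projE_sum_modes j n my; rewrite jn /S big_mkord => ->.
by rewrite addr0.
Unshelve. all: end_near. Qed.

End spectral_projections.

(** * The energy space *)

Section energy_space.
Context (R : realType) (N : nat) (Omega : set 'rV[R]_N) (oO : open Omega).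
Local Notation mu := (lebesgue_dom oO).
Local Notation L2 := (L2 oO).
Variables (lam : nat -> R) (E : nat -> L2 -> L2).
Hypothesis hE : dirichlet_spectrum lam E.
Implicit Types (x y : L2) (z : L2 * L2).

(** Trades the extended-real series with real exponents for bounds on finite sums, the form in which
    membership in [Z1] is handled from here on. *)
Lemma Xpow1P x : Xpow lam E 1 x <->
  exists B, forall n, \sum_(j < n) lam j ^+ 2 * l2norm (E j x) ^+ 2 <= B.
Proof.
have tE j : ((lam j `^ (2 * 1) * l2norm (E j x) ^+ 2)%:E =
             (lam j ^+ 2 * l2norm (E j x) ^+ 2)%:E)%E.
  by rewrite mulr1 powR_mulrn// ltW// (lam_gt0 hE).
have t0 j : 0 <= lam j ^+ 2 * l2norm (E j x) ^+ 2 by rewrite mulr_ge0 ?sqr_ge0.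
rewrite /Xpow /=; under eq_eseriesr do rewrite tE.
split=> [xB|[B xB]].
  exists (fine (\sum_(0 <= j <oo) (lam j ^+ 2 * l2norm (E j x) ^+ 2)%:E)%E) => n.
  rewrite -lee_fin fineK; last first.
    by rewrite ge0_fin_numE// nneseries_ge0// => j _ _; rewrite lee_fin.
  rewrite -sumEFin -(big_mkord xpredT (fun j => (lam j ^+ 2 * l2norm (E j x) ^+ 2)%:E)).
  by apply: nneseries_lim_ge => j _ _; rewrite lee_fin.
apply: (@le_lt_trans _ _ B%:E); last exact: ltry.
apply: lime_le.
  by apply: is_cvg_nneseries => j _ _; rewrite lee_fin.
by apply: nearW => n; rewrite big_mkord sumEFin lee_fin; exact: xB.
Qed.

(** [Apow] is an [xget]: Riesz-Fischer shows that the set it chooses from is inhabited, and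
    uniqueness of limits up to norm zero makes the choice harmless. *)
Lemma Apow1P x : Xpow lam E 1 x ->
  l2norm (Apow lam E 1 x - \sum_(j < n) lam j *: E j x) @[n --> \oo] --> (0 : R) /\
  forall j, l2norm (E j (Apow lam E 1 x) - lam j *: E j x) = 0.
Proof.
move=> /Xpow1P[B xB].
have my j : mode E j (lam j *: E j x) by apply: (modeZ hE); exact: (mode_projE hE).
have [Y [cY YE]] : exists Y : L2,
    l2norm (Y - \sum_(j < n) lam j *: E j x) @[n --> \oo] --> (0 : R) /\
    forall j, l2norm (E j Y - lam j *: E j x) = 0.
  apply: (riesz_fischer_modes hE my (B := B)) => n.
  apply: le_trans (xB n); apply: ler_sum => j _.
  by rewrite l2normZ exprMn real_normK ?num_real.
have lam1 j : lam j `^ 1 = lam j by rewrite powRr1// ltW// (lam_gt0 hE).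
have cA : l2norm (Apow lam E 1 x - \sum_(j < n) lam j *: E j x) @[n --> \oo] --> (0 : R).
  rewrite /Apow; case: xgetP => [y _ /=|/(_ Y) /=].
    by under eq_fun do under eq_bigr do rewrite lam1.
  by under eq_fun do under eq_bigr do rewrite lam1.
split => // j.
apply/le_anti; rewrite l2norm_ge0 andbT.
apply: le_trans (l2norm_tri _ (E j Y) _) _; rewrite YE addr0.
suff AY : l2norm (Apow lam E 1 x - Y) = 0 by rewrite (projE_eqv hE).
have cs : l2norm (Apow lam E 1 x - \sum_(j < n) lam j *: E j x) +
    l2norm (Y - \sum_(j < n) lam j *: E j x) @[n --> \oo] --> (0 : R).
  by rewrite -[X in _ --> X](addr0 0); exact: cvgD.
apply/le_anti; rewrite l2norm_ge0 andbT.
rewrite -[leRHS](cvg_lim _ cs)//; apply: limr_ge; first exact: cvgP cs.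
apply: nearW => n; rewrite (l2norm_distC Y); exact: l2norm_tri.
Qed.

(** The share of the [j]-th mode in [znorm z ^+ 2], as [znorm_cvg] shows. *)
Definition mode_energy j z : R :=
  lam j ^+ 2 * l2norm (E j z.1) ^+ 2 + l2norm (E j z.2) ^+ 2.

Lemma mode_energy_ge0 j z : 0 <= mode_energy j z.
Proof. by apply: addr_ge0; [apply: mulr_ge0|]; exact: sqr_ge0. Qed.

Lemma znorm_ge0 z : 0 <= znorm lam E z.
Proof. exact: sqrtr_ge0. Qed.

Lemma znorm_sqrE z :
  znorm lam E z ^+ 2 = l2norm (Apow lam E 1 z.1) ^+ 2 + l2norm z.2 ^+ 2.
Proof. by rewrite sqr_sqrtr// addr_ge0 ?sqr_ge0. Qed.

Lemma znorm_cvg z : Z1 lam E z ->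
  \sum_(j < n) mode_energy j z @[n --> \oo] --> znorm lam E z ^+ 2.
Proof.
move=> /Apow1P[_ AE]; rewrite znorm_sqrE.
rewrite (_ : (fun n => _) = (fun n => \sum_(j < n) l2norm (E j (Apow lam E 1 z.1)) ^+ 2 +
   \sum_(j < n) l2norm (E j z.2) ^+ 2)).
  by apply: cvgD; exact: (parseval hE).
apply/funext => n; rewrite -big_split/=; apply: eq_bigr => j _.
by rewrite (l2norm_eqv (AE j)) l2normZ exprMn real_normK ?num_real.
Qed.

Lemma znorm_ge_partial z n : Z1 lam E z ->
  \sum_(j < n) mode_energy j z <= znorm lam E z ^+ 2.
Proof.
move=> zZ; have cz := znorm_cvg zZ.
rewrite -[leRHS](cvg_lim _ cz)//; apply: limr_ge; first exact: cvgP cz.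
near=> m; have nm : (n <= m)%N by near: m; exact: nbhs_infty_ge.
rewrite -(big_mkord xpredT (mode_energy ^~ z)) -(big_mkord xpredT (mode_energy ^~ z)).
rewrite [leRHS](big_cat_nat _ nm)//= lerDl.
by apply: sumr_ge0 => i _; exact: mode_energy_ge0.
Unshelve. all: end_near. Qed.

Lemma znorm_le z B : Z1 lam E z -> 0 <= B ->
  (forall n, \sum_(j < n) mode_energy j z <= B ^+ 2) -> znorm lam E z <= B.
Proof.
move=> zZ B0 zB; have cz := znorm_cvg zZ.
rewrite -(@ler_pXn2r _ 2)// ?nnegrE ?znorm_ge0//.
rewrite -[leLHS](cvg_lim _ cz)//; apply: limr_le; first exact: cvgP cz.
by apply: nearW => n; exact: zB.
Qed.

Lemma Z1P z : Z1 lam E z <-> exists B, forall n, \sum_(j < n) mode_energy j z <= B.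
Proof.
split=> [zZ|[B zB]]; first by exists (znorm lam E z ^+ 2) => n; exact: znorm_ge_partial.
apply/Xpow1P; exists B => n; apply: le_trans (zB n); apply: ler_sum => j _.
by rewrite lerDl sqr_ge0.
Qed.

Lemma mode_energy_le1 j z : Z1 lam E z -> mode_energy j z <= znorm lam E z ^+ 2.
Proof.
move=> zZ; apply: le_trans (znorm_ge_partial j.+1 zZ).
by rewrite big_ord_recr/= lerDr sumr_ge0// => i _; exact: mode_energy_ge0.
Qed.

Lemma znorm_eq0 z : Z1 lam E z -> (forall j, mode_energy j z = 0) -> znorm lam E z = 0.
Proof.
move=> zZ z0; apply/le_anti; rewrite znorm_ge0 andbT; apply: znorm_le => // n.
by rewrite big1 ?sqr_ge0.
Qed.

Lemma mode_energyD j z z' : mode_energy j (z + z') <= 2 * mode_energy j z + 2 * mode_energy j z'.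
Proof.
have h x y : l2norm (E j (x + y)) ^+ 2 <= 2 * l2norm (E j x) ^+ 2 + 2 * l2norm (E j y) ^+ 2.
  rewrite (l2norm_eqv (projED hE j x y)).
  apply: (@le_trans _ _ ((l2norm (E j x) + l2norm (E j y)) ^+ 2)).
    by rewrite ler_pXn2r ?nnegrE ?addr_ge0 ?l2norm_ge0// l2normD.
  rewrite -subr_ge0 (_ : _ - _ = (l2norm (E j x) - l2norm (E j y)) ^+ 2) ?sqr_ge0//.
  by ring.
have h1 := h z.1 z'.1; have h2 := h z.2 z'.2.
rewrite /mode_energy /=.
have := ler_wpM2l (sqr_ge0 (lam j)) h1.
move=> ?; lra.
Qed.

Lemma mode_energyZ j a z : mode_energy j (a *: z) = a ^+ 2 * mode_energy j z.
Proof.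
have h x : l2norm (E j (a *: x)) ^+ 2 = a ^+ 2 * l2norm (E j x) ^+ 2.
  have := projE_lin hE j a x 0; rewrite !addr0 => /l2norm_eqv ->.
  rewrite (@l2norm_eqv _ _ _ _ _ (a *: E j x)).
    by rewrite l2normZ exprMn real_normK ?num_real.
  by rewrite addrAC subrr add0r; have := mode0 hE j; rewrite /mode subr0.
rewrite /mode_energy /= !h; ring.
Qed.

Lemma Z1D z z' : Z1 lam E z -> Z1 lam E z' -> Z1 lam E (z + z').
Proof.
move=> /Z1P[B zB] /Z1P[C zC]; apply/Z1P; exists (2 * B + 2 * C) => n.
apply: (@le_trans _ _ (\sum_(j < n) (2 * mode_energy j z + 2 * mode_energy j z'))).
  by apply: ler_sum => j _; exact: mode_energyD.
rewrite big_split/= -!mulr_sumr.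
by apply: lerD; apply: ler_wpM2l; rewrite ?zB ?zC.
Qed.

Lemma Z1Z a z : Z1 lam E z -> Z1 lam E (a *: z).
Proof.
move=> /Z1P[B zB]; apply/Z1P; exists (a ^+ 2 * B) => n.
under eq_bigr do rewrite mode_energyZ.
by rewrite -mulr_sumr ler_wpM2l ?sqr_ge0.
Qed.

Lemma Z1_snd y : Z1 lam E (0, y).
Proof.
apply/Xpow1P; exists 0 => n; rewrite big1// => j _ /=.
by have := mode0 hE j; rewrite /mode subr0 => ->; rewrite expr0n mulr0.
Qed.

Lemma Z10 : Z1 lam E 0.
Proof. exact: Z1_snd. Qed.

Lemma Z1N z : Z1 lam E z -> Z1 lam E (- z).
Proof. by rewrite -scaleN1r; exact: Z1Z. Qed.

Lemma Z1B z z' : Z1 lam E z -> Z1 lam E z' -> Z1 lam E (z - z').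
Proof. by move=> zZ /Z1N; exact: Z1D. Qed.

Lemma Z1_sum I (s : seq I) (P : pred I) (F : I -> L2 * L2) :
  (forall i, P i -> Z1 lam E (F i)) -> Z1 lam E (\sum_(i <- s | P i) F i).
Proof. by move=> FZ; apply: big_ind => //; [exact: Z10|exact: Z1D]. Qed.

Lemma znormZ a z : Z1 lam E z -> znorm lam E (a *: z) = `|a| * znorm lam E z.
Proof.
move=> zZ; apply: (@pexpIrn _ 2); rewrite ?nnegrE ?mulr_ge0 ?znorm_ge0//.
rewrite exprMn real_normK ?num_real//.
apply: (cvg_unique _ (znorm_cvg (Z1Z a zZ))) => //.
rewrite (_ : (fun n => _) = (fun n => a ^+ 2 * \sum_(j < n) mode_energy j z)); last first.
  by apply/funext => n; rewrite mulr_sumr; apply: eq_bigr => j _; exact: mode_energyZ.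
by apply: cvgM; [exact: cvg_cst|exact: znorm_cvg].
Qed.

Lemma znormN z : Z1 lam E z -> znorm lam E (- z) = znorm lam E z.
Proof. by move=> zZ; rewrite -scaleN1r znormZ// normrN normr1 mul1r. Qed.

Lemma znorm0 : znorm lam E 0 = 0.
Proof. by rewrite -(scale0r 0) znormZ ?normr0 ?mul0r//; exact: Z10. Qed.

(** [Apow] is additive up to norm zero, as its modes are. What remains is Minkowski's inequality in
    the plane for the vectors with coordinates [a], [c] and [b], [d]. *)
Lemma znormD z z' : Z1 lam E z -> Z1 lam E z' ->
  znorm lam E (z + z') <= znorm lam E z + znorm lam E z'.
Proof.
move=> zZ zZ'; have [_ A1] := Apow1P zZ; have [_ A2] := Apow1P zZ'.
have [_ A3] := Apow1P (Z1D zZ zZ').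
have AD : l2norm (Apow lam E 1 (z + z').1 - (Apow lam E 1 z.1 + Apow lam E 1 z'.1)) = 0.
  apply: (projE_ext hE) => j; apply/le_anti; rewrite l2norm_ge0 andbT.
  apply: le_trans (l2norm_tri _ (lam j *: E j (z + z').1) _) _; rewrite A3 add0r.
  apply: le_trans (l2norm_tri _ (lam j *: (E j z.1 + E j z'.1)) _) _.
  rewrite -scalerBr l2normZ (projED hE) mulr0 add0r l2norm_distC.
  apply: le_trans (l2norm_tri _ (E j (Apow lam E 1 z.1) + E j (Apow lam E 1 z'.1)) _) _.
  rewrite (projED hE) add0r scalerDr opprD addrACA (le_trans (l2normD _ _))//.
  by rewrite A1 A2 addr0.
have := l2normD (Apow lam E 1 z.1) (Apow lam E 1 z'.1).
rewrite -(l2norm_eqv AD) => le1.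
have le2 := l2normD z.2 z'.2.
rewrite -(@ler_pXn2r _ 2)// ?nnegrE ?addr_ge0 ?znorm_ge0// sqrrD !znorm_sqrE.
set a := l2norm (Apow lam E 1 z.1) in le1 *.
set b := l2norm (Apow lam E 1 z'.1) in le1 *.
set c := l2norm z.2 in le2 *; set d := l2norm z'.2 in le2 *.
have [a0 b0 c0 d0] : [/\ 0 <= a, 0 <= b, 0 <= c & 0 <= d] by split; exact: l2norm_ge0.
apply: (@le_trans _ _ ((a + b) ^+ 2 + (c + d) ^+ 2)).
  by rewrite lerD// ler_pXn2r ?nnegrE ?addr_ge0 ?l2norm_ge0.
suff : a * b + c * d <= znorm lam E z * znorm lam E z' by move=> ?; nra.
rewrite -(@ler_pXn2r _ 2) ?nnegrE ?addr_ge0 ?mulr_ge0 ?znorm_ge0// exprMn !znorm_sqrE.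
rewrite -/a -/b -/c -/d -subr_ge0.
by rewrite (_ : _ - _ = (a * d - b * c) ^+ 2) ?sqr_ge0//; ring.
Qed.

Lemma znorm_distC z z' : Z1 lam E z -> Z1 lam E z' ->
  znorm lam E (z - z') = znorm lam E (z' - z).
Proof. by move=> zZ zZ'; rewrite -znormN ?opprB//; exact: Z1B. Qed.

Lemma znorm_tri z2 z1 z3 : Z1 lam E z1 -> Z1 lam E z2 -> Z1 lam E z3 ->
  znorm lam E (z1 - z3) <= znorm lam E (z1 - z2) + znorm lam E (z2 - z3).
Proof.
move=> h1 h2 h3; rewrite (_ : z1 - z3 = (z1 - z2) + (z2 - z3)); last by rewrite subrKA.
by apply: znormD; exact: Z1B.
Qed.

Lemma l2norm_snd_le z : l2norm z.2 <= znorm lam E z.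
Proof.
rewrite -(@ler_pXn2r _ 2)// ?nnegrE ?l2norm_ge0 ?znorm_ge0//.
by rewrite znorm_sqrE lerDr sqr_ge0.
Qed.

(** A Poincaré-type inequality, since every weight is at least [lam 0]. Through it the energy norm
    controls the L^2 norm of the displacement, on which the nonlinear terms act. *)
Lemma l2norm_fst_le z : Z1 lam E z -> lam 0%N * l2norm z.1 <= znorm lam E z.
Proof.
move=> zZ; have l0 := lam_gt0 hE 0.
rewrite -(@ler_pXn2r _ 2)// ?nnegrE ?mulr_ge0 ?l2norm_ge0 ?znorm_ge0 ?(ltW l0)//.
rewrite exprMn -ler_pdivlMl ?exprn_gt0//.
have cz := parseval (x := z.1) hE.
rewrite -[leLHS](cvg_lim _ cz)//; apply: limr_le; first exact: cvgP cz.
apply: nearW => n; rewrite ler_pdivlMl ?exprn_gt0//.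
apply: le_trans (znorm_ge_partial n zZ).
rewrite mulr_sumr; apply: ler_sum => j _; apply: (@le_trans _ _ (lam j ^+ 2 * l2norm (E j z.1) ^+ 2)).
  have lj := lam0_le hE j; have lj0 := ltW (lam_gt0 hE j).
  by rewrite ler_wpM2r ?sqr_ge0// ler_pXn2r// nnegrE ltW.
by rewrite lerDl sqr_ge0.
Qed.

Lemma znorm_snd y : znorm lam E (0, y) = l2norm y.
Proof.
apply: (@pexpIrn _ 2); rewrite ?nnegrE ?l2norm_ge0 ?znorm_ge0//.
apply: (cvg_unique _ (znorm_cvg (Z1_snd y))) => //.
rewrite (_ : (fun n => _) = (fun n => \sum_(j < n) l2norm (E j y) ^+ 2)).
  exact: (parseval hE).
apply/funext => n; apply: eq_bigr => j _; rewrite /mode_energy /=.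
by have := mode0 hE j; rewrite /mode subr0 => ->; rewrite expr0n mulr0 add0r.
Qed.

(** Carries equality in the energy space over to [is_nemytskii] and [is_memory], which compose
    pointwise. *)
Lemma znorm0_ae z : Z1 lam E z -> znorm lam E z = 0 ->
  {ae mu, forall s, z.1 s = 0} /\ {ae mu, forall s, z.2 s = 0}.
Proof.
move=> zZ z0; split; apply: l2norm0_ae; apply/le_anti; rewrite l2norm_ge0 andbT.
  by have := l2norm_fst_le zZ; rewrite z0 pmulr_rle0// (lam_gt0 hE).
by rewrite -z0 l2norm_snd_le.
Qed.

End energy_space.

(** * Exponential of the modal matrices *)

Section matrix_exponential.
Context (R : realType).

(** By induction [A ^+ k = a ^+ k *: P + b ^+ k *: Q], so the matrix series splits into two scalar
    exponential series. *)
Lemma expmx_spectral (A P Q : 'M[R]_2) (a b : R) :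
  P + Q = 1 -> A * P = a *: P -> A * Q = b *: Q ->
  expmx A = expR a *: P + expR b *: Q.
Proof.
move=> PQ AP AQ.
have powA k : A ^+ k = a ^+ k *: P + b ^+ k *: Q.
  elim: k => [|k IH]; first by rewrite !expr0 !scale1r PQ.
  by rewrite exprS IH mulrDr -!scalerAr AP AQ !scalerA -!exprSr.
rewrite /expmx; apply: cvg_lim => //.
rewrite (_ : series _ = (fun n => series (exp_coeff a) n *: P + series (exp_coeff b) n *: Q)).
  have c (x : R) (S : 'M[R]_2) : series (exp_coeff x) n *: S @[n --> \oo] --> expR x *: S.
    by apply: (@cvgZr_tmp R 'M[R]_2 nat \oo _ (series (exp_coeff x))); exact: is_cvg_series_exp_coeff.
  exact: (cvgD (c a P) (c b Q)).
apply/funext => n; rewrite /series/= !scaler_suml -big_split/=.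
apply: eq_bigr => k _; rewrite powA scalerDr !scalerA /exp_coeff /=.
by rewrite ![_^-1 * _]mulrC.
Qed.

Lemma matrix2P (A B : 'M[R]_2) : A ord0 ord0 = B ord0 ord0 ->
  A ord0 ord_max = B ord0 ord_max -> A ord_max ord0 = B ord_max ord0 ->
  A ord_max ord_max = B ord_max ord_max -> A = B.
Proof.
move=> h00 h01 h10 h11; apply/matrixP => i j.
have o (k : 'I_2) : k = ord0 \/ k = ord_max.
  by case: k => -[|[|//]] hk; [left|right]; exact/val_inj.
by case: (o i) => ->; case: (o j) => ->.
Qed.

Lemma ord2_lshift : (ord0 : 'I_2) = lshift 1 (ord0 : 'I_1).
Proof. exact/val_inj. Qed.

Lemma ord2_rshift : (ord_max : 'I_2) = rshift 1 (ord0 : 'I_1).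
Proof. exact/val_inj. Qed.

Lemma mulmx2E (A B : 'M[R]_2) i k :
  (A * B) i k = A i ord0 * B ord0 k + A i ord_max * B ord_max k.
Proof.
rewrite mxE big_ord_recl big_ord_recl big_ord0 addr0.
by rewrite (_ : lift ord0 ord0 = ord_max)//; exact/val_inj.
Qed.

Lemma Kmx00 (lam : nat -> R) beta j : Kmx lam beta j ord0 ord0 = 0.
Proof.
rewrite ?ord2_lshift ?ord2_rshift.
exact: etrans (block_mxEul 0 1%:M (- lam j ^+ 2)%:M (- (2 * beta * lam j))%:M ord0 ord0) (mxE _ _ _ _).
Qed.

Lemma Kmx01 (lam : nat -> R) beta j : Kmx lam beta j ord0 ord_max = 1.
Proof.
rewrite ?ord2_lshift ?ord2_rshift.
exact: etrans (block_mxEur 0 1%:M (- lam j ^+ 2)%:M (- (2 * beta * lam j))%:M ord0 ord0) (mxE _ _ _ _).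
Qed.

Lemma Kmx10 (lam : nat -> R) beta j : Kmx lam beta j ord_max ord0 = - lam j ^+ 2.
Proof.
rewrite ?ord2_lshift ?ord2_rshift.
exact: etrans (block_mxEdl 0 1%:M (- lam j ^+ 2)%:M (- (2 * beta * lam j))%:M ord0 ord0) (mxE _ _ _ _).
Qed.

Lemma Kmx11 (lam : nat -> R) beta j : Kmx lam beta j ord_max ord_max = - (2 * beta * lam j).
Proof.
rewrite ?ord2_lshift ?ord2_rshift.
exact: etrans (block_mxEdr 0 1%:M (- lam j ^+ 2)%:M (- (2 * beta * lam j))%:M ord0 ord0) (mxE _ _ _ _).
Qed.

(* The eigenvalues of [Kmx lam beta j] are [- (lam j * rho1 beta)] and
   [- (lam j * rho2 beta)]. *)
Definition rho1 (beta : R) := beta - Num.sqrt (beta ^+ 2 - 1).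
Definition rho2 (beta : R) := beta + Num.sqrt (beta ^+ 2 - 1).

(** These are the roots of [x ^+ 2 - 2 * beta * x + 1], real and distinct because [beta > 1]; the
    last two claims are Vieta's formulas. *)
Lemma rhoP (beta : R) : 1 < beta ->
  [/\ 0 < rho1 beta, rho1 beta < rho2 beta,
      rho1 beta + rho2 beta = 2 * beta & rho1 beta * rho2 beta = 1].
Proof.
move=> b1; rewrite /rho1 /rho2.
have s0 : 0 < beta ^+ 2 - 1 by nra.
have sp : 0 < Num.sqrt (beta ^+ 2 - 1) by rewrite sqrtr_gt0.
have ss : Num.sqrt (beta ^+ 2 - 1) ^+ 2 = beta ^+ 2 - 1 by rewrite sqr_sqrtr// ltW.
set s := Num.sqrt _ in sp ss *.
split; [by nra|by lra|by lra|].
by transitivity (beta ^+ 2 - s ^+ 2); [ring|rewrite ss; ring].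
Qed.

(* Interpolation of exp(t .) at the two eigenvalues of K = Kmx lam beta j:
   exp(t K) = psi K + chi. *)
Definition psi (beta l t : R) : R :=
  (expR (- (l * rho1 beta * t)) - expR (- (l * rho2 beta * t))) /
  (l * (rho2 beta - rho1 beta)).

Definition chi (beta l t : R) : R :=
  (rho2 beta * expR (- (l * rho1 beta * t)) - rho1 beta * expR (- (l * rho2 beta * t))) /
  (rho2 beta - rho1 beta).

Lemma expmx_KmxE (lam : nat -> R) beta j t : 1 < beta -> 0 < lam j ->
  expmx (t *: Kmx lam beta j) =
  psi beta (lam j) t *: Kmx lam beta j + (chi beta (lam j) t)%:M.
Proof.
move=> b1 l0; have [r1 r12 rs rp] := rhoP b1.
set l := lam j in l0 *.
set K := Kmx lam beta j.
pose c := (l * (rho2 beta - rho1 beta))^-1.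
have d0 : l * (rho2 beta - rho1 beta) != 0.
  by rewrite mulf_neq0 ?gt_eqF ?subr_gt0.
have k00 : K ord0 ord0 = 0 by exact: Kmx00.
have k01 : K ord0 ord_max = 1 by exact: Kmx01.
have k10 : K ord_max ord0 = - l ^+ 2 by exact: Kmx10.
have k11 : K ord_max ord_max = - (2 * beta * l) by exact: Kmx11.
clearbody K.
have l0' : l != 0 by rewrite gt_eqF.
have r0' : rho2 beta - rho1 beta != 0 by rewrite gt_eqF// subr_gt0.
(* Cayley-Hamilton: when [- (l * a)] and [- (l * b)] are the eigenvalues, the product of [K + l * a]
   and [K + l * b] vanishes. *)
have fac (a b : R) : a + b = 2 * beta -> a * b = 1 ->
    K * (K + (l * b)%:M) = (- (l * a)) *: (K + (l * b)%:M).
  move=> ab1 ab2.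
  have k10' : K ord_max ord0 = - (l ^+ 2 * (a * b)) by rewrite ab2 mulr1.
  have k11' : K ord_max ord_max = - ((a + b) * l) by rewrite ab1.
  apply: matrix2P;
    rewrite mulmx2E !mxE ?(k00, k01, k10', k11') /= ?mulr1n ?mulr0n; ring.
(* The spectral projections are the Lagrange interpolation polynomials of the two eigenvalues,
   evaluated at [K]. *)
rewrite (@expmx_spectral _ (c *: (K + (l * rho2 beta)%:M))
    (- c *: (K + (l * rho1 beta)%:M)) (- (l * rho1 beta * t)) (- (l * rho2 beta * t))).
- apply/matrixP => i k; rewrite !mxE /psi /chi /c.
  by case: (i == k); rewrite ?mulr1n ?mulr0n; field; rewrite l0' r0'.
- apply/matrixP => i k; rewrite !mxE /c.
  by case: (i == k); rewrite ?mulr1n ?mulr0n; field; rewrite l0' r0'.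
- rewrite -scalerAl -scalerAr (fac _ _ rs rp) !scalerA; congr (_ *: _); ring.
- rewrite -scalerAl -scalerAr (fac (rho2 beta) (rho1 beta)) ?(addrC (rho2 _)) ?(mulrC (rho2 _))//.
  by rewrite !scalerA; congr (_ *: _); ring.
Qed.

(** The numerators bounded in [psi_chi_bound] combine two exponentials in [0, 1] and are at most
    [2 * beta = rho1 beta + rho2 beta]; the value [4 * beta] leaves room and depends on neither mode
    nor time. *)
Definition semigroup_bound (beta : R) : R := 4 * beta / (rho2 beta - rho1 beta).

Lemma semigroup_bound_ge0 beta : 1 < beta -> 0 <= semigroup_bound beta.
Proof.
move=> b1; have [r1 r12 rs rp] := rhoP b1.
by rewrite divr_ge0 ?subr_ge0 ?ltW//; lra.
Qed.

(** Up to sign, these are the entries of the modal exponential in the coordinates [l * w] and [v],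
    in which the energy norm is Euclidean. The rescaling makes the bound uniform in [l]. *)
Lemma psi_chi_bound beta l t : 1 < beta -> 0 < l -> 0 <= t ->
  `|l * psi beta l t| <= semigroup_bound beta /\
  `|chi beta l t| <= semigroup_bound beta /\
  `|chi beta l t - 2 * beta * (l * psi beta l t)| <= semigroup_bound beta.
Proof.
move=> b1 l0 t0; have [r1 r12 rs rp] := rhoP b1.
have r2 : 0 < rho2 beta by exact: lt_trans r12.
have d0 : 0 < rho2 beta - rho1 beta by rewrite subr_gt0.
have e01 (a : R) : 0 < a -> 0 <= expR (- (l * a * t)) <= 1.
  by move=> a0; rewrite expR_ge0 expR_le1 oppr_le0 !mulr_ge0// ltW.
have /andP[a0 a1] := e01 _ r1; have /andP[c0 c1] := e01 _ r2.
rewrite (_ : l * psi beta l t = (expR (- (l * rho1 beta * t)) - expR (- (l * rho2 beta * t))) /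
  (rho2 beta - rho1 beta)); last first.
  by rewrite /psi; field; rewrite !gt_eqF.
rewrite /chi /semigroup_bound mulrA -mulrBl !normrM.
have d0' : 0 <= (rho2 beta - rho1 beta)^-1 by rewrite invr_ge0 ltW.
rewrite !(ger0_norm d0').
set x := expR _ in a0 a1 *; set y := expR _ in c0 c1 *.
rewrite !ler_pM2r ?invr_gt0//.
set r := rho1 beta in r1 r12 rs rp d0 *; set q := rho2 beta in r2 r12 rs rp d0 *.
rewrite !ler_norml; split; [|split]; apply/andP; split; nra.
Qed.

Lemma expmx_Kmx_entries (lam : nat -> R) beta j t : 1 < beta -> 0 < lam j ->
  let A := expmx (t *: Kmx lam beta j) in
  [/\ A ord0 ord0 = chi beta (lam j) t, A ord0 ord_max = psi beta (lam j) t,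
      A ord_max ord0 = - (lam j ^+ 2 * psi beta (lam j) t) &
      A ord_max ord_max = chi beta (lam j) t - 2 * beta * (lam j * psi beta (lam j) t)].
Proof.
move=> b1 l0 A; rewrite /A expmx_KmxE//.
have e00 := Kmx00 lam beta j; have e01 := Kmx01 lam beta j.
have e10 := Kmx10 lam beta j; have e11 := Kmx11 lam beta j.
move: (Kmx lam beta j) e00 e01 e10 e11 => K e00 e01 e10 e11.
by rewrite !mxE e00 e01 e10 e11 /= ?mulr1n ?mulr0n; split; ring.
Qed.

End matrix_exponential.

(** * The semigroup *)

Section semigroup.
Context (R : realType) (N : nat) (Omega : set 'rV[R]_N) (oO : open Omega).
Local Notation mu := (lebesgue_dom oO).
Local Notation L2 := (L2 oO).
Variables (lam : nat -> R) (E : nat -> L2 -> L2).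
Hypothesis hE : dirichlet_spectrum lam E.
Implicit Types (x y : L2) (z : L2 * L2).

Definition l2eqv x y := l2norm (x - y) = 0.

Lemma l2eqv_refl x : l2eqv x x.
Proof. by rewrite /l2eqv subrr l2norm0. Qed.

Lemma l2eqv_sym x y : l2eqv x y -> l2eqv y x.
Proof. by rewrite /l2eqv l2norm_distC. Qed.

Lemma l2eqv_trans y x w : l2eqv x y -> l2eqv y w -> l2eqv x w.
Proof.
rewrite /l2eqv => h1 h2; apply/le_anti; rewrite l2norm_ge0 andbT.
by rewrite (le_trans (l2norm_tri _ y _))// h1 h2 addr0.
Qed.

Lemma l2eqvD x y x' y' : l2eqv x y -> l2eqv x' y' -> l2eqv (x + x') (y + y').
Proof.
rewrite /l2eqv => h1 h2; apply/le_anti; rewrite l2norm_ge0 andbT.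
by rewrite opprD addrACA (le_trans (l2normD _ _))// h1 h2 addr0.
Qed.

Lemma l2eqvZ a x y : l2eqv x y -> l2eqv (a *: x) (a *: y).
Proof. by rewrite /l2eqv => h; rewrite -scalerBr l2normZ h mulr0. Qed.

Lemma l2eqv_projlin j a x y : l2eqv (E j (a *: x + y)) (a *: E j x + E j y).
Proof. exact: (projE_lin hE). Qed.

Definition modes_eqv z z' :=
  forall j, l2eqv (E j z.1) (E j z'.1) /\ l2eqv (E j z.2) (E j z'.2).

Lemma mode_energy_eq0 j z z' : mode_energy lam E j (z - z') = 0 <->
  l2eqv (E j z.1) (E j z'.1) /\ l2eqv (E j z.2) (E j z'.2).
Proof.
have lj := lam_gt0 hE j.
have dE x y : l2norm (E j (x - y)) = l2norm (E j x - E j y).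
  apply: l2norm_eqv; have := projE_lin hE j (-1) y x.
  by rewrite !scaleN1r !(addrC (- _)).
rewrite /mode_energy /= !dE; split=> [/eqP|[-> ->]]; last first.
  by rewrite expr0n mulr0 addr0.
rewrite (paddr_eq0 (mulr_ge0 (sqr_ge0 _) (sqr_ge0 _)) (sqr_ge0 _)) mulf_eq0 !sqrf_eq0 gt_eqF//=.
by move=> /andP[/eqP ? /eqP ?].
Qed.

Lemma znorm_eqvP z z' : Z1 lam E z -> Z1 lam E z' ->
  (znorm lam E (z - z') = 0 <-> modes_eqv z z').
Proof.
move=> zZ zZ'; have dZ := Z1B hE zZ zZ'; split => [d0 j|d0].
  apply/mode_energy_eq0/le_anti; rewrite mode_energy_ge0 andbT.
  by apply: le_trans (mode_energy_le1 hE j dZ) _; rewrite d0 expr0n.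
by apply: (znorm_eq0 hE dZ) => j; apply/mode_energy_eq0.
Qed.

Lemma Z1_mode j z : mode E j z.1 -> Z1 lam E z.
Proof.
move=> mz; pose F i := lam i ^+ 2 * l2norm (E i z.1) ^+ 2.
have F0 i : 0 <= F i by rewrite mulr_ge0 ?sqr_ge0.
have Fi i : i != j -> F i = 0.
  by move=> ij; rewrite /F (mode_neq hE ij mz) expr0n mulr0.
apply/(Xpow1P hE); exists (F j) => n; rewrite -[leLHS]/(\sum_(i < n) F i).
suff -> : \sum_(i < n) F i = if (j < n)%N then F j else 0 by case: ifP.
elim: n => [|n IH]; first by rewrite big_ord0.
rewrite big_ord_recr/= IH ltnS (leq_eqVlt j n); have [->|jn] := eqVneq j n.
  by rewrite ltnn add0r.
by rewrite /= (Fi n) ?addr0// eq_sym.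
Qed.

(** Riesz-Fischer in the energy space. The components are summed separately in L^2; convergence in
    [znorm] then follows because the remainder carries exactly the energy of the modes not yet
    summed. *)
Lemma Z1_modes (y : nat -> L2 * L2) B :
  (forall j, mode E j (y j).1) -> (forall j, mode E j (y j).2) ->
  (forall n, \sum_(j < n) mode_energy lam E j (y j) <= B) ->
  exists Y, [/\ Z1 lam E Y,
    forall j, l2eqv (E j Y.1) (y j).1 /\ l2eqv (E j Y.2) (y j).2 &
    znorm lam E (Y - \sum_(j < n) y j) @[n --> \oo] --> (0 : R)].
Proof.
move=> m1 m2 yB; have l0 := lam_gt0 hE 0.
have n1 j : l2norm (E j (y j).1) = l2norm (y j).1 by exact: l2norm_eqv (m1 j).
have n2 j : l2norm (E j (y j).2) = l2norm (y j).2 by exact: l2norm_eqv (m2 j).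
have [Y1 [_ Y1E]] : exists Y : L2,
    l2norm (Y - \sum_(j < n) (y j).1) @[n --> \oo] --> (0 : R) /\
    forall j, l2norm (E j Y - (y j).1) = 0.
  (* The energy weights are at least [lam 0 ^+ 2], which bounds the unweighted sum. *)
  apply: (riesz_fischer_modes hE m1 (B := (lam 0%N ^+ 2)^-1 * B)) => n.
  rewrite ler_pdivlMl ?exprn_gt0//; apply: le_trans (yB n).
  rewrite mulr_sumr; apply: ler_sum => j _.
  rewrite /mode_energy n1 n2.
  apply: (@le_trans _ _ (lam j ^+ 2 * l2norm (y j).1 ^+ 2)).
    have lj := lam0_le hE j; have lj0 := ltW (lam_gt0 hE j).
    by rewrite ler_wpM2r ?sqr_ge0// ler_pXn2r// nnegrE ltW.
  by rewrite lerDl sqr_ge0.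
have [Y2 [_ Y2E]] : exists Y : L2,
    l2norm (Y - \sum_(j < n) (y j).2) @[n --> \oo] --> (0 : R) /\
    forall j, l2norm (E j Y - (y j).2) = 0.
  apply: (riesz_fischer_modes hE m2 (B := B)) => n.
  apply: le_trans (yB n); apply: ler_sum => j _.
  by rewrite /mode_energy n1 n2 lerDr mulr_ge0 ?sqr_ge0.
pose Y : L2 * L2 := (Y1, Y2).
have YE j : mode_energy lam E j Y = mode_energy lam E j (y j).
  by rewrite /mode_energy n1 n2 (l2norm_eqv (Y1E j)) (l2norm_eqv (Y2E j)).
have YZ : Z1 lam E Y.
  by apply/(Z1P hE); exists B => n; under eq_bigr do rewrite YE.
have SZ n : Z1 lam E (\sum_(j < n) y j).
  by apply: (Z1_sum hE) => j _; exact: Z1_mode (m1 j).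
exists Y; split => // [j|]; first by split; [exact: Y1E|exact: Y2E].
have DZ n := Z1B hE YZ (SZ n).
have ED n j : mode_energy lam E j (Y - \sum_(i < n) y i) =
    if (j < n)%N then 0 else mode_energy lam E j Y.
  have f (w : nat -> L2) (W : L2) : (forall j, mode E j (w j)) -> l2eqv (E j W) (w j) ->
      l2norm (E j (W - \sum_(i < n) w i)) = if (j < n)%N then 0 else l2norm (E j W).
    move=> mw Ww; have := projE_lin hE j (-1) (\sum_(i < n) w i) W.
    rewrite !scaleN1r !(addrC (- _)) => /l2norm_eqv ->.
    have := projE_sum_modes hE j n mw; case: ifP => _ h.
      apply: l2eqv_trans Ww _; exact: l2eqv_sym.
    apply: l2norm_eqv; rewrite addrAC subrr add0r -h subr0.
    by rewrite l2normN.
  rewrite /mode_energy /= (raddf_sum (fst : L2 * L2 -> L2)) (raddf_sum (snd : L2 * L2 -> L2)).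
  rewrite (f (fun i => (y i).1))// (f (fun i => (y i).2))//.
  by case: ifP => _; rewrite // expr0n mulr0 addr0.
have sq n : znorm lam E (Y - \sum_(i < n) y i) ^+ 2 =
    znorm lam E Y ^+ 2 - \sum_(i < n) mode_energy lam E i Y.
  apply: (cvg_unique _ (znorm_cvg hE (DZ n))) => //.
  have cY : \sum_(i < m) mode_energy lam E i Y - \sum_(i < n) mode_energy lam E i Y @[m --> \oo] -->
      znorm lam E Y ^+ 2 - \sum_(i < n) mode_energy lam E i Y.
    exact: (cvgB (znorm_cvg hE YZ) (cvg_cst _)).
  apply: cvg_trans cY; apply: near_eq_cvg; near=> m.
  have nm : (n <= m)%N by near: m; exact: nbhs_infty_ge.
  under [RHS]eq_bigr do rewrite ED.
  rewrite -!(big_mkord xpredT (fun j => mode_energy lam E j Y)).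
  rewrite -(big_mkord xpredT (fun j => if (j < n)%N then 0 else mode_energy lam E j Y)).
  rewrite (big_cat_nat _ nm)//= [RHS](big_cat_nat _ nm)//= addrAC subrr add0r.
  rewrite [X in X + _]big_nat [X in X + _]big1 ?add0r; last by move=> i /andP[_ ->].
  by apply: eq_big_nat => i /andP[ni _]; rewrite ltnNge ni.
have sq0 : znorm lam E (Y - \sum_(i < n) y i) ^+ 2 @[n --> \oo] --> (0 : R).
  have h := cvgB (cvg_cst (znorm lam E Y ^+ 2)) (znorm_cvg hE YZ).
  by rewrite subrr in h; rewrite (funext sq); exact: h.
have h : Num.sqrt (znorm lam E (Y - \sum_(i < n) y i) ^+ 2) @[n --> \oo] --> Num.sqrt (0 : R).
  by apply: continuous_cvg => //; exact: sqrt_continuous.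
have e n : Num.sqrt (znorm lam E (Y - \sum_(i < n) y i) ^+ 2) =
    znorm lam E (Y - \sum_(i < n) y i) by rewrite sqrtr_sqr ger0_norm// znorm_ge0.
by move: h; rewrite sqrtr0 (funext e).
Unshelve. all: end_near. Qed.

(** * Bounds and linearity of the semigroup *)

Variable beta : R.
Hypothesis hbeta : 1 < beta.

(** A 2 by 2 matrix with entries of modulus at most [c] has Euclidean operator norm at most
    [2 * c]. *)
Let C := 2 * semigroup_bound beta.

Lemma actP_expmx t j z :
  actP E (expmx (t *: Kmx lam beta j)) j z =
  (chi beta (lam j) t *: E j z.1 + psi beta (lam j) t *: E j z.2,
   - (lam j ^+ 2 * psi beta (lam j) t) *: E j z.1 +
   (chi beta (lam j) t - 2 * beta * (lam j * psi beta (lam j) t)) *: E j z.2).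
Proof.
have [e0 e1 e2 e3] := expmx_Kmx_entries t hbeta (lam_gt0 hE j).
by rewrite /actP e0 e1 e2 e3.
Qed.

Lemma mode_actP A j z : mode E j (actP E A j z).1 /\ mode E j (actP E A j z).2.
Proof.
by split; apply: (modeD hE); apply: (modeZ hE); exact: (mode_projE hE).
Qed.

Lemma actP_energy t j z : 0 <= t ->
  mode_energy lam E j (actP E (expmx (t *: Kmx lam beta j)) j z) <=
  C ^+ 2 * mode_energy lam E j z.
Proof.
move=> t0; have [m1 m2] := mode_actP (expmx (t *: Kmx lam beta j)) j z.
rewrite /mode_energy (l2norm_eqv m1) (l2norm_eqv m2) actP_expmx /=.
have l0 := lam_gt0 hE j.
have [b1 [b2 b3]] := psi_chi_bound hbeta l0 t0.
have c0 := semigroup_bound_ge0 hbeta.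
set c := semigroup_bound beta in b1 b2 b3 c0 *.
set p := l2norm (E j z.1); set q := l2norm (E j z.2).
have p0 : 0 <= p by exact: l2norm_ge0.
have q0 : 0 <= q by exact: l2norm_ge0.
have lp0 : 0 <= lam j * p by rewrite mulr_ge0// ltW.
have h1 : lam j * l2norm (chi beta (lam j) t *: E j z.1 + psi beta (lam j) t *: E j z.2) <=
    c * (lam j * p) + c * q.
  apply: (@le_trans _ _ (lam j * (`|chi beta (lam j) t| * p + `|psi beta (lam j) t| * q))).
    by rewrite ler_pM2l// (le_trans (l2normD _ _))// !l2normZ.
  rewrite mulrDr mulrCA lerD//; first by rewrite ler_wpM2r.
  rewrite mulrA ler_wpM2r//; apply: le_trans b1.
  by rewrite (normrM (lam j)) (gtr0_norm l0).
have h2 : l2norm (- (lam j ^+ 2 * psi beta (lam j) t) *: E j z.1 +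
   (chi beta (lam j) t - 2 * beta * (lam j * psi beta (lam j) t)) *: E j z.2) <=
    c * (lam j * p) + c * q.
  rewrite (le_trans (l2normD _ _))// !l2normZ lerD//; last by rewrite ler_wpM2r.
  rewrite -/p normrN expr2 -mulrA (normrM (lam j)) (gtr0_norm l0) mulrAC mulrC.
  by rewrite ler_wpM2r.
set y1 := l2norm (chi _ _ _ *: _ + _) in h1 *.
set y2 := l2norm _ in h2 *.
have y10 : 0 <= lam j * y1 by rewrite mulr_ge0 ?l2norm_ge0// ltW.
have y20 : 0 <= y2 by exact: l2norm_ge0.
rewrite /C -/c -exprMn.
apply: (@le_trans _ _ (2 * (c * (lam j * p) + c * q) ^+ 2)).
  rewrite mulr_natl mulr2n lerD// ler_pXn2r ?nnegrE//.
    by rewrite addr_ge0// mulr_ge0.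
  by rewrite addr_ge0// mulr_ge0.
rewrite -subr_ge0 (_ : _ - _ = 2 * c ^+ 2 * (lam j * p - q) ^+ 2).
  by apply: mulr_ge0; [apply: mulr_ge0|]; rewrite ?sqr_ge0.
by ring.
Qed.

(** [actP_energy] makes the modal series converge, so the [xget] in [Tsg] does not fall back on its
    default. All later facts about [Tsg] come from this description of its modes. *)
Lemma Tsg_spec t z : 0 <= t -> Z1 lam E z ->
  Z1 lam E (Tsg lam E beta t z) /\
  forall j, l2eqv (E j (Tsg lam E beta t z).1) (actP E (expmx (t *: Kmx lam beta j)) j z).1 /\
            l2eqv (E j (Tsg lam E beta t z).2) (actP E (expmx (t *: Kmx lam beta j)) j z).2.
Proof.
move=> t0 zZ.
pose y j := actP E (expmx (t *: Kmx lam beta j)) j z.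
have m1 j : mode E j (y j).1 := (mode_actP (expmx (t *: Kmx lam beta j)) j z).1.
have m2 j : mode E j (y j).2 := (mode_actP (expmx (t *: Kmx lam beta j)) j z).2.
have [Y [YZ YE cY]] : exists Y, [/\ Z1 lam E Y,
    forall j, l2eqv (E j Y.1) (y j).1 /\ l2eqv (E j Y.2) (y j).2 &
    znorm lam E (Y - \sum_(j < n) y j) @[n --> \oo] --> (0 : R)].
  apply: (@Z1_modes y (C ^+ 2 * znorm lam E z ^+ 2) m1 m2) => n.
  apply: (@le_trans _ _ (\sum_(j < n) C ^+ 2 * mode_energy lam E j z)).
    by apply: ler_sum => j _; exact: actP_energy.
  by rewrite -mulr_sumr ler_wpM2l ?sqr_ge0//; exact: znorm_ge_partial.
rewrite /Tsg; case: xgetP => [y' _ /= [yZ cy]|/(_ Y)]; last by move=> /(_ (conj YZ cY)).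
split => // j.
have SZ n : Z1 lam E (\sum_(j < n) y j).
  by apply: (Z1_sum hE) => i _; exact: Z1_mode (m1 i).
have yY : znorm lam E (y' - Y) = 0.
  apply/le_anti; rewrite znorm_ge0 andbT.
  have cs : znorm lam E (y' - \sum_(j < n) y j) + znorm lam E (Y - \sum_(j < n) y j)
      @[n --> \oo] --> (0 : R).
    by rewrite -[X in _ --> X](addr0 0); exact: (cvgD cy cY).
  rewrite -[leRHS](cvg_lim _ cs)//; apply: limr_ge; first exact: cvgP cs.
  apply: nearW => n; apply: le_trans (znorm_tri hE yZ (SZ n) YZ) _.
  by rewrite (znorm_distC hE (SZ n) YZ).
have /(znorm_eqvP yZ YZ)/(_ j)[e1 e2] := yY; have [f1 f2] := YE j.
by split; [exact: l2eqv_trans f1|exact: l2eqv_trans f2].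
Qed.

Lemma Z1_Tsg t z : 0 <= t -> Z1 lam E z -> Z1 lam E (Tsg lam E beta t z).
Proof. by move=> t0 zZ; have [] := Tsg_spec t0 zZ. Qed.

Lemma znorm_Tsg_le t z : 0 <= t -> Z1 lam E z ->
  znorm lam E (Tsg lam E beta t z) <= C * znorm lam E z.
Proof.
move=> t0 zZ; have [TZ TE] := Tsg_spec t0 zZ.
have C0 : 0 <= C by rewrite mulr_ge0// semigroup_bound_ge0.
apply: (znorm_le hE TZ); first by rewrite mulr_ge0 ?znorm_ge0.
move=> n; rewrite exprMn.
apply: (@le_trans _ _ (\sum_(j < n) C ^+ 2 * mode_energy lam E j z)); last first.
  by rewrite -mulr_sumr ler_wpM2l ?sqr_ge0//; exact: znorm_ge_partial.
apply: ler_sum => j _; apply: le_trans (actP_energy j z t0).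
have [e1 e2] := TE j; have [m1 m2] := mode_actP (expmx (t *: Kmx lam beta j)) j z.
by rewrite /mode_energy (l2norm_eqv e1) (l2norm_eqv e2) (l2norm_eqv m1) (l2norm_eqv m2).
Qed.

Lemma actP_lin A j a z z' :
  l2eqv (actP E A j (a *: z + z')).1 (a *: (actP E A j z).1 + (actP E A j z').1) /\
  l2eqv (actP E A j (a *: z + z')).2 (a *: (actP E A j z).2 + (actP E A j z').2).
Proof.
have h (c d : R) : l2eqv (c *: E j (a *: z + z').1 + d *: E j (a *: z + z').2)
    (a *: (c *: E j z.1 + d *: E j z.2) + (c *: E j z'.1 + d *: E j z'.2)).
  apply: (@l2eqv_trans (c *: (a *: E j z.1 + E j z'.1) + d *: (a *: E j z.2 + E j z'.2))).
    by apply: l2eqvD; apply: l2eqvZ; exact: l2eqv_projlin.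
  rewrite !scalerDr addrACA !scalerA (mulrC c) (mulrC d).
  exact: l2eqv_refl.
by split; exact: h.
Qed.

Lemma Tsg_lin t a z z' : 0 <= t -> Z1 lam E z -> Z1 lam E z' ->
  modes_eqv (Tsg lam E beta t (a *: z + z'))
    (a *: Tsg lam E beta t z + Tsg lam E beta t z').
Proof.
move=> t0 zZ zZ' j.
have [_ /(_ j)[s1 s2]] := Tsg_spec t0 (Z1D hE (Z1Z hE a zZ) zZ').
have [_ /(_ j)[u1 u2]] := Tsg_spec t0 zZ.
have [_ /(_ j)[v1 v2]] := Tsg_spec t0 zZ'.
have [w1 w2] := actP_lin (expmx (t *: Kmx lam beta j)) j a z z'.
split.
- apply: (l2eqv_trans s1); apply: (l2eqv_trans w1); apply: l2eqv_sym.
  apply: l2eqv_trans (l2eqv_projlin _ _ _ _) _.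
  exact: (l2eqvD (l2eqvZ a u1) v1).
- apply: (l2eqv_trans s2); apply: (l2eqv_trans w2); apply: l2eqv_sym.
  apply: l2eqv_trans (l2eqv_projlin _ _ _ _) _.
  exact: (l2eqvD (l2eqvZ a u2) v2).
Qed.

(** [Tsg] makes a separate choice for each function, so compatibility with equality up to norm zero
    has to be proved. *)
Lemma Tsg_eqv t z z' : 0 <= t -> Z1 lam E z -> Z1 lam E z' -> znorm lam E (z - z') = 0 ->
  znorm lam E (Tsg lam E beta t z - Tsg lam E beta t z') = 0.
Proof.
move=> t0 zZ zZ' /(znorm_eqvP zZ zZ') h.
apply/znorm_eqvP; [exact: Z1_Tsg|exact: Z1_Tsg|] => j.
have [_ /(_ j)[u1 u2]] := Tsg_spec t0 zZ.
have [_ /(_ j)[v1 v2]] := Tsg_spec t0 zZ'.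
have [h1 h2] := h j.
split.
- apply: (l2eqv_trans u1); apply: l2eqv_trans (l2eqv_sym v1).
  by apply: l2eqvD; exact: l2eqvZ.
- apply: (l2eqv_trans u2); apply: l2eqv_trans (l2eqv_sym v2).
  by apply: l2eqvD; exact: l2eqvZ.
Qed.

End semigroup.

(** * Bochner integration *)

Section lower_integral.
Context d (T : measurableType d) (R : realType) (mu : {measure set T -> \bar R}).

(* Neither [f] nor [g] is assumed measurable: the integrals are lower integrals. *)
Lemma ae_le_lower_integral (J : set T) (f g : T -> \bar R) :
  (forall t, J t -> 0 <= f t)%E -> (forall t, J t -> 0 <= g t)%E ->
  {ae mu, forall t, J t -> (f t <= g t)%E} ->
  (\int[mu]_(t in J) f t <= \int[mu]_(t in J) g t)%E.
Proof.
move=> f0 g0 [Z [mZ muZ fgZ]].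
rewrite ge0_integralE// (ge0_integralE _ g0).
apply: ge_ereal_sup => _ [phi /= phif <-].
have mZC : measurable (~` Z) by exact: measurableC.
(* Setting [phi] to zero on the null set [Z] keeps its integral and brings it below [g] at every
   point. *)
pose phi' := mul_nnsfun phi (indic_nnsfun R mZC).
have -> : sintegral mu phi = sintegral mu phi'.
  rewrite -!integralT_nnsfun; apply: ge0_ae_eq_integral => //.
  - exact/measurable_EFinP.
  - exact/measurable_EFinP.
  - by move=> x _; rewrite lee_fin.
  - by move=> x _; rewrite lee_fin.
  exists Z; split => // x /= xh; apply: contrapT => xZ; apply: xh => _.
  by rewrite -[mindic R mZC x]/(\1_(~` Z) x) indicE mem_set// mulr1.
apply: ereal_sup_ubound; exists phi' => //= x.
rewrite -[X in (X <= _)%E]/((phi x * \1_(~` Z) x)%:E) indicE.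
have [xZ|xZ] := pselect (Z x).
  rewrite memNset ?mulr0; last by move=> /(_ xZ).
  by rewrite patchE; case: ifPn => // /set_mem /g0.
rewrite mem_set// mulr1 (le_trans (phif x))// !patchE.
case: ifPn => // /set_mem Jx; apply: contrapT => fg.
by apply/xZ/fgZ => /(_ Jx).
Qed.

Lemma ae_eq_lower_integral (J : set T) (f g : T -> \bar R) :
  (forall t, J t -> 0 <= f t)%E -> (forall t, J t -> 0 <= g t)%E ->
  {ae mu, forall t, J t -> f t = g t} ->
  (\int[mu]_(t in J) f t = \int[mu]_(t in J) g t)%E.
Proof.
move=> f0 g0 fg; apply/le_anti/andP; split; apply: ae_le_lower_integral => //;
  by apply: filterS fg => t fg /fg ->.
Qed.

End lower_integral.

(** * Bochner integrals for a seminorm on a subspace *)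

Section bochner_theory.
Context (R : realType) (V : lmodType R) (D : set V) (nrm : V -> R).
Hypothesis D0 : D 0.
Hypothesis DD : forall x y, D x -> D y -> D (x + y).
Hypothesis DZ : forall a x, D x -> D (a *: x).
Hypothesis nrm_ge0 : forall x, 0 <= nrm x.
Hypothesis nrmD : forall x y, D x -> D y -> nrm (x + y) <= nrm x + nrm y.
Hypothesis nrmZ : forall a x, D x -> nrm (a *: x) = `|a| * nrm x.
Local Notation mu := (@lebesgue_measure R).

Let DN x : D x -> D (- x).
Proof. by rewrite -scaleN1r; exact: DZ. Qed.

Let DB x y : D x -> D y -> D (x - y).
Proof. by move=> Dx /DN; exact: DD. Qed.

Let Dsum I (s : seq I) (F : I -> V) : (forall i, D (F i)) -> D (\sum_(i <- s) F i).
Proof. by move=> DF; apply: big_ind => //; exact: DD. Qed.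

Let nrmN x : D x -> nrm (- x) = nrm x.
Proof. by move=> Dx; rewrite -scaleN1r nrmZ// normrN1 mul1r. Qed.

Let nrm_dist x y : D x -> D y -> `|nrm x - nrm y| <= nrm (x - y).
Proof.
move=> Dx Dy; rewrite ler_norml lerBrDr lerBlDr addrC.
have h1 : nrm x <= nrm (x - y) + nrm y by rewrite -{1}(subrK y x) nrmD//; exact: DB.
have h2 : nrm y <= nrm (x - y) + nrm x.
  rewrite -{1}(subrK x y) -(nrmN (DB Dx Dy)) opprB nrmD//; exact: DB.
by apply/andP; split; lra.
Qed.

Lemma vs_val_in (s : vsfun D) t : D (vs_val s t).
Proof. by apply: Dsum => i; apply: DZ; exact: vs_in. Qed.

Lemma vs_integral_in J (s : vsfun D) : D (vs_integral J s).
Proof. by apply: Dsum => i; apply: DZ; exact: vs_in. Qed.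

(** Concatenating the two lists of pieces suffices, since the sets [vs_dom] may overlap. *)
Lemma vsfun_lin (a : R) (s s' : vsfun D) : exists s2 : vsfun D,
  (forall t, vs_val s2 t = a *: vs_val s t + vs_val s' t) /\
  (forall J, vs_integral J s2 = a *: vs_integral J s + vs_integral J s').
Proof.
pose n := (vs_size s + vs_size s')%N.
pose dom (i : 'I_n) := match fintype.split i with inl j => vs_dom j | inr j => vs_dom j end.
pose cst (i : 'I_n) := match fintype.split i with inl j => a *: vs_cst j | inr j => vs_cst j end.
have mdom i : measurable (dom i).
  by rewrite /dom; case: (fintype.split i) => j; exact: vs_measurable.
have Dcst i : D (cst i).
  by rewrite /cst; case: (fintype.split i) => j; [apply: DZ|]; exact: vs_in.
exists (VSfun mdom Dcst).
have domL i : dom (lshift _ i) = vs_dom i by rewrite /dom -[lshift _ _]/(unsplit (inl i)) unsplitK.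
have domR i : dom (rshift _ i) = vs_dom i by rewrite /dom -[rshift _ _]/(unsplit (inr i)) unsplitK.
have cstL i : cst (lshift _ i) = a *: vs_cst i by rewrite /cst -[lshift _ _]/(unsplit (inl i)) unsplitK.
have cstR i : cst (rshift _ i) = vs_cst i by rewrite /cst -[rshift _ _]/(unsplit (inr i)) unsplitK.
split=> [t|J].
  rewrite /vs_val /= big_split_ord/= scaler_sumr; congr (_ + _); apply: eq_bigr => i _.
    by rewrite domL cstL !scalerA mulrC.
  by rewrite domR cstR.
rewrite /vs_integral /= big_split_ord/= scaler_sumr; congr (_ + _); apply: eq_bigr => i _.
  by rewrite domL cstL !scalerA mulrC.
by rewrite domR cstR.
Qed.

(** Induction on the number of pieces: on the last set its vector is moved into [c], elsewhere it
    disappears. The parameter [c] is there for this induction. *)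
Lemma measurable_nrm_sum n (A : 'I_n -> set (measurableTypeR R)) (v : 'I_n -> V) (c : V) :
  (forall i, measurable (A i)) ->
  measurable_fun setT (fun t : measurableTypeR R => nrm (c + \sum_(i < n) \1_(A i) t *: v i)).
Proof.
elim: n A v c => [|n IH] A v c mA.
  by under eq_fun do rewrite big_ord0 addr0; exact: measurable_cst.
rewrite (_ : (fun t => _) = (fun t => if t \in A ord_max then
    nrm (c + v ord_max + \sum_(i < n) \1_(A (widen_ord (leqnSn n) i)) t *: v (widen_ord (leqnSn n) i))
  else nrm (c + \sum_(i < n) \1_(A (widen_ord (leqnSn n) i)) t *: v (widen_ord (leqnSn n) i)))); last first.
  apply/funext => t; rewrite big_ord_recr/= {2}/indic; case: ifPn => _.
    by rewrite scale1r addrCA addrA [in RHS]addrC addrCA -!addrA; congr nrm; rewrite addrCA.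
  by rewrite scale0r addr0.
apply: measurable_fun_ifT.
- apply: (measurable_fun_bool true).
  rewrite setTI (_ : _ @^-1` _ = A ord_max)//.
  by apply/seteqP; split=> t /=; [move/set_mem|move/mem_set].
- exact: IH.
- exact: IH.
Qed.

Lemma measurable_nrm_vs_val (s : vsfun D) :
  measurable_fun setT (fun t : measurableTypeR R => nrm (vs_val s t)).
Proof.
have := @measurable_nrm_sum _ _ (@vs_cst _ _ _ s) 0 (@vs_measurable _ _ _ s).
by under eq_fun do rewrite add0r.
Qed.

(* The sets [A i] may overlap; the induction splits [J] along the last one. *)
Lemma nrm_integral_sum_le n (A : 'I_n -> set (measurableTypeR R)) (v : 'I_n -> V) (c : V)
    (J : set (measurableTypeR R)) :
  (forall i, measurable (A i)) -> (forall i, D (v i)) -> D c ->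
  measurable J -> (mu J < +oo)%E ->
  ((nrm (fine (mu J) *: c + \sum_(i < n) fine (mu (A i `&` J)) *: v i))%:E <=
   \int[mu]_(t in J) (nrm (c + \sum_(i < n) \1_(A i) t *: v i))%:E)%E.
Proof.
elim: n A v c J => [|n IH] A v c J mA Dv Dc mJ Joo.
  under eq_integral do rewrite big_ord0 addr0.
  rewrite big_ord0 addr0 nrmZ// integral_cst// ger0_norm ?fine_ge0//.
  by rewrite muleC EFinM fineK// ge0_fin_numE.
pose A' i := A (widen_ord (leqnSn n) i).
pose v' i := v (widen_ord (leqnSn n) i).
pose J1 := J `&` A ord_max; pose J2 := J `\` A ord_max.
have mJ1 : measurable J1 by exact: measurableI.
have mJ2 : measurable J2 by exact: measurableD.
have J1oo : (mu J1 < +oo)%E by apply: le_lt_trans Joo; apply: le_measure; rewrite ?inE//; exact: subIsetl.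
have J2oo : (mu J2 < +oo)%E by apply: le_lt_trans Joo; apply: le_measure; rewrite ?inE//; exact: subDsetl.
have split_mu B : measurable B -> fine (mu (B `&` J)) = fine (mu (B `&` J1)) + fine (mu (B `&` J2)).
  move=> mB; rewrite -fineD.
  - congr fine; rewrite -measureU.
    + by congr (mu _); rewrite -setIUr; congr (_ `&` _); rewrite /J1 /J2 setUIDK.
    + exact: measurableI.
    + exact: measurableI.
    + by rewrite -subset0 => t [[_ [_ At]] [_ [_ nAt]]].
  - rewrite ge0_fin_numE//; apply: le_lt_trans J1oo.
    apply: le_measure; rewrite ?inE//; try exact: measurableI; exact: subIsetr.
  - rewrite ge0_fin_numE//; apply: le_lt_trans J2oo.
    apply: le_measure; rewrite ?inE//; try exact: measurableI; exact: subIsetr.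
(* On [J1] the last vector joins the constant term; on [J2] it contributes nothing. *)
have IH1 := IH A' v' (c + v ord_max) J1 (fun i => mA _) (fun i => Dv _) (DD Dc (Dv _)) mJ1 J1oo.
have IH2 := IH A' v' c J2 (fun i => mA _) (fun i => Dv _) Dc mJ2 J2oo.
have JU : J = J1 `|` J2 by rewrite /J1 /J2 setUIDK.
pose G t := (nrm (c + \sum_(i < n.+1) \1_(A i) t *: v i))%:E.
have -> : (\int[mu]_(t in J) G t = \int[mu]_(t in J1) G t + \int[mu]_(t in J2) G t)%E.
  rewrite {1}JU ge0_integral_setU//.
  - apply: measurable_funTS; apply/measurable_EFinP; exact: measurable_nrm_sum.
  - by move=> t _; rewrite lee_fin.
  - by rewrite disj_set2E; apply/eqP; rewrite -subset0 => t [[_ At] [_ nAt]].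
have e1 : (\int[mu]_(t in J1) G t =
    \int[mu]_(t in J1) (nrm (c + v ord_max + \sum_(i < n) \1_(A' i) t *: v' i))%:E)%E.
  apply: eq_integral => t /set_mem[_ At]; rewrite /G big_ord_recr/=.
  by rewrite {2}/indic mem_set// scale1r addrCA addrC addrAC [c + _]addrC addrC.
have e2 : (\int[mu]_(t in J2) G t =
    \int[mu]_(t in J2) (nrm (c + \sum_(i < n) \1_(A' i) t *: v' i))%:E)%E.
  apply: eq_integral => t /set_mem[_ At]; rewrite /G big_ord_recr/=.
  by rewrite {2}/indic memNset// scale0r addr0.
rewrite e1 e2; apply: le_trans (leeD IH1 IH2).
rewrite -EFinD lee_fin.
have Dx : D (fine (mu J1) *: (c + v ord_max) + \sum_(i < n) fine (mu (A' i `&` J1)) *: v' i).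
  by apply: DD; [apply/DZ/DD => //; exact: Dv|apply: Dsum => i; apply: DZ; exact: Dv].
have Dy : D (fine (mu J2) *: c + \sum_(i < n) fine (mu (A' i `&` J2)) *: v' i).
  by apply: DD; [exact: DZ|apply: Dsum => i; apply: DZ; exact: Dv].
apply: le_trans (nrmD Dx Dy).
rewrite le_eqVlt; apply/orP; left; apply/eqP; congr nrm.
rewrite big_ord_recr/= -(setTI J) split_mu ?setTI//.
have -> : \sum_(i < n) fine (mu (A (widen_ord (leqnSn n) i) `&` J)) *: v (widen_ord (leqnSn n) i) =
    \sum_(i < n) fine (mu (A' i `&` J1)) *: v' i + \sum_(i < n) fine (mu (A' i `&` J2)) *: v' i.
  by rewrite -big_split/=; apply: eq_bigr => i _; rewrite split_mu// scalerDl.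
have -> : A ord_max `&` J = J1 by rewrite setIC.
rewrite scalerDl scalerDr.
set a := fine (mu J1) *: c; set b := fine (mu J2) *: c.
set e := fine (mu J1) *: v ord_max.
set x := \sum_(i < n) _; set y := \sum_(i < n) _.
by rewrite (AC (2*(2*1)) ((1*5*3)*(2*4))).
Qed.

(* [nrm (h - v)] is only a.e. equal to a Borel function, namely the limsup of
   [nrm (s n - v)]. *)
Lemma ae_limit_measurable_version (J : set (measurableTypeR R)) h (s : nat -> vsfun D) (v : vsfun D) :
  ae_limit_vsfun nrm J h s ->
  exists W : measurableTypeR R -> R, [/\ measurable_fun setT W, forall t, 0 <= W t,
    {ae mu, forall t : measurableTypeR R, J t -> W t = nrm (h t - vs_val v t)} &
    (\int[mu]_(t in J) (W t)%:E = \int[mu]_(t in J) (nrm (h t - vs_val v t))%:E)%E].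
Proof.
move=> hs.
pose F m (t : measurableTypeR R) := (nrm (vs_val (s m) t - vs_val v t))%:E.
(* [fine] sends an infinite limsup to 0, and the absolute value keeps [W] nonnegative also where the
   limit fails to exist. *)
pose W t := `|fine (limn_esup (F ^~ t))|.
have mW : measurable_fun setT W.
  apply: measurableT_comp => //; apply: measurableT_comp => //.
  apply: measurable_fun_limn_esup => m; apply/measurable_EFinP.
  have [s2 [s2E _]] := vsfun_lin (-1) v (s m).
  rewrite (_ : (fun t => _) = (fun t => nrm (vs_val s2 t))); first exact: measurable_nrm_vs_val.
  by apply/funext => t; rewrite s2E scaleN1r addrC.
have Wh : {ae mu, forall t : measurableTypeR R, J t -> W t = nrm (h t - vs_val v t)}.
  apply: filterS hs => t ht /ht[Dh cv].
  suff /cvg_limn_einf_sup[_ FE] : F n t @[n --> \oo] --> (nrm (h t - vs_val v t))%:E.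
    by rewrite /W FE /= ger0_norm.
  apply: cvg_EFin; first by near=> n.
  apply/cvgrPdist_le => /= e e0; move/cvgrPdist_le/(_ _ e0) : cv => cv.
  near=> n; have : `|0 - nrm (h t - vs_val (s n) t)| <= e by near: n.
  rewrite sub0r normrN ger0_norm// => le.
  rewrite /F /=; apply: le_trans (nrm_dist _ _) _; [exact/DB/vs_val_in|apply: DB; exact: vs_val_in|].
  by rewrite opprB addrA subrK.
exists W; split => //.
- by move=> t; exact: normr_ge0.
- apply: ae_eq_lower_integral => [t _|t _|]; rewrite ?lee_fin ?normr_ge0//.
  by apply: filterS Wh => t Wt /Wt ->.
Unshelve. all: end_near. Qed.

Lemma is_bochner_lin (a : R) (J : set (measurableTypeR R)) h h' I I' : measurable J ->
  is_bochner D nrm J h I -> is_bochner D nrm J h' I' ->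
  is_bochner D nrm J (fun t => a *: h t + h' t) (a *: I + I').
Proof.
move=> mJ [DI [s [hs ints cvs]]] [DI' [s' [hs' ints' cvs']]].
split; first by apply: DD => //; exact: DZ.
have /choice[s2 s2P] := fun n => vsfun_lin a (s n) (s' n).
have key x x' y y' : a *: x + x' - (a *: y + y') = a *: (x - y) + (x' - y').
  by rewrite opprD addrACA scalerBr.
have c0 (u u' : nat -> R) : u n @[n --> \oo] --> 0 -> u' n @[n --> \oo] --> 0 ->
    `|a| * u n + u' n @[n --> \oo] --> 0.
  move=> cu cu'; rewrite -[X in _ --> X](addr0 0) -[X in _ --> X + _](mulr0 `|a|).
  by apply: cvgD => //; apply: cvgM => //; exact: cvg_cst.
exists s2; split.
- apply: filterS2 hs hs' => t hs hs' Jt.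
  have [Dh ch] := hs Jt; have [Dh' ch'] := hs' Jt.
  split; first by apply: DD => //; exact: DZ.
  apply: squeeze_cvgr (cvg_cst 0) (c0 _ _ ch ch').
  apply: nearW => n; rewrite nrm_ge0/= (s2P n).1 key.
  have Dx : D (h t - vs_val (s n) t) by apply: DB => //; exact: vs_val_in.
  by rewrite -nrmZ// nrmD//; [exact: DZ|apply: DB => //; exact: vs_val_in].
(* Lower integrals are not additive in general, so both norms are first replaced by their Borel
   versions. *)
- have /choice[W WP] := fun n => ae_limit_measurable_version (s n) hs.
  have /choice[W' WP'] := fun n => ae_limit_measurable_version (s' n) hs'.
  apply: (@squeeze_cvge _ _ _ _ (cst 0%E) _
    (fun n => `|a|%:E * \int[mu]_(t in J) (W n t)%:E + \int[mu]_(t in J) (W' n t)%:E)%E).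
  + apply: nearW => n; rewrite integral_ge0 => [|t _]; last by rewrite lee_fin.
    have [mW W0 WE WI] := WP n; have [mW' W0' WE' WI'] := WP' n.
    have mW1 : measurable_fun J (EFin \o W n) by apply/measurable_EFinP; exact: measurable_funTS.
    have mW2 : measurable_fun J (EFin \o W' n) by apply/measurable_EFinP; exact: measurable_funTS.
    have <- : (\int[mu]_(t in J) (`|a|%:E * (W n t)%:E) = `|a|%:E * \int[mu]_(t in J) (W n t)%:E)%E.
      by apply: ge0_integralZl_EFin => // t _; rewrite lee_fin.
    have <- : (\int[mu]_(t in J) (`|a|%:E * (W n t)%:E + (W' n t)%:E) =
        \int[mu]_(t in J) (`|a|%:E * (W n t)%:E) + \int[mu]_(t in J) (W' n t)%:E)%E.
      apply: ge0_integralD => //.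
      - by move=> t _; rewrite mule_ge0// lee_fin.
      - by apply: emeasurable_funM => //; exact: measurable_cst.
      - by move=> t _; rewrite lee_fin.
    apply: ae_le_lower_integral => [t _|t _|].
    * by rewrite lee_fin.
    * by rewrite -EFinM -EFinD lee_fin addr_ge0// mulr_ge0.
    have aeD : {ae mu, forall t : measurableTypeR R, J t -> D (h t) /\ D (h' t)}.
      apply: filterS2 hs hs' => t ht ht' Jt.
      by have [] := ht Jt; have [] := ht' Jt.
    apply: filterS3 aeD WE WE' => t aeD WE WE' Jt; have [Dh Dh'] := aeD Jt.
    rewrite -EFinM -EFinD lee_fin WE// WE'// (s2P n).1 key -nrmZ//; last exact/DB/vs_val_in.
    by apply: nrmD; [apply/DZ/DB => //; exact: vs_val_in|apply: DB => //; exact: vs_val_in].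
  + exact: cvg_cst.
  + have i1 : (\int[mu]_(t in J) (W n t)%:E)%E @[n --> \oo] --> 0%E.
      by rewrite (_ : (fun n => _) = (fun n => \int[mu]_(t in J) (nrm (h t - vs_val (s n) t))%:E)%E)//; apply/funext => n; have [] := WP n.
    have i2 : (\int[mu]_(t in J) (W' n t)%:E)%E @[n --> \oo] --> 0%E.
      by rewrite (_ : (fun n => _) = (fun n => \int[mu]_(t in J) (nrm (h' t - vs_val (s' n) t))%:E)%E)//; apply/funext => n; have [] := WP' n.
    have i3 : (`|a|%:E * \int[mu]_(t in J) (W n t)%:E)%E @[n --> \oo] --> 0%E.
      by rewrite -[X in _ --> X](mule0 `|a|%:E); exact: cvgeZl.
    by rewrite -[X in _ --> X](adde0 0%E); apply: cvgeD.
- apply: squeeze_cvgr (cvg_cst 0) (c0 _ _ cvs cvs').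
  apply: nearW => n; rewrite nrm_ge0/= (s2P n).2 key.
  have Dx : D (vs_integral J (s n) - I) by apply: DB => //; exact: vs_integral_in.
  by rewrite -nrmZ// nrmD//; [exact: DZ|apply: DB => //; exact: vs_integral_in].
Qed.

Lemma is_bochnerB (J : set (measurableTypeR R)) h h' I I' : measurable J ->
  is_bochner D nrm J h I -> is_bochner D nrm J h' I' ->
  is_bochner D nrm J (fun t => h t - h' t) (I - I').
Proof.
move=> mJ b b'; have := is_bochner_lin (-1) mJ b' b.
rewrite scaleN1r addrC.
by under eq_fun do rewrite scaleN1r addrC.
Qed.

Lemma nrm_vs_integral_le (J : set (measurableTypeR R)) (s : vsfun D) :
  measurable J -> (mu J < +oo)%E ->
  ((nrm (vs_integral J s))%:E <= \int[mu]_(t in J) (nrm (vs_val s t))%:E)%E.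
Proof.
move=> mJ Joo.
have := @nrm_integral_sum_le _ _ (@vs_cst _ _ _ s) 0 J (@vs_measurable _ _ _ s) (@vs_in _ _ _ s) D0 mJ Joo.
by rewrite scaler0 add0r; under eq_integral do rewrite add0r.
Qed.

(** Bound the simple integrals by [nrm (s n) <= c + nrm (h - s n)] and let [n] tend to infinity.
    Measurability of the majorant [c] allows the integral of the sum to be split. *)
Lemma nrm_bochner_le (J : set (measurableTypeR R)) h I (c : measurableTypeR R -> R) :
  measurable J -> (mu J < +oo)%E -> measurable_fun J c -> (forall t, 0 <= c t) ->
  {ae mu, forall t : measurableTypeR R, J t -> nrm (h t) <= c t} ->
  is_bochner D nrm J h I -> ((nrm I)%:E <= \int[mu]_(t in J) (c t)%:E)%E.
Proof.
move=> mJ Joo mc c0 hc [DI [s [hs ints cvs]]].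
have /choice[W WP] := fun n => ae_limit_measurable_version (s n) hs.
have le n : ((nrm I)%:E <= (nrm (vs_integral J (s n) - I))%:E +
    (\int[mu]_(t in J) (c t)%:E + \int[mu]_(t in J) (nrm (h t - vs_val (s n) t))%:E))%E.
  have [mW W0 WE <-] := WP n.
  apply: (@le_trans _ _ ((nrm (vs_integral J (s n) - I))%:E + (nrm (vs_integral J (s n)))%:E)%E).
    rewrite -EFinD lee_fin -(nrmN (DB (vs_integral_in J (s n)) DI)) opprB.
    rewrite -{1}(subrK (vs_integral J (s n)) I) nrmD//; last exact: vs_integral_in.
    by apply: DB => //; exact: vs_integral_in.
  apply: leeD => //; apply: le_trans (nrm_vs_integral_le _ mJ Joo) _.
  have mW1 : measurable_fun J (EFin \o W n) by apply/measurable_EFinP; exact: measurable_funTS.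
  have <- : (\int[mu]_(t in J) ((c t)%:E + (W n t)%:E) =
      \int[mu]_(t in J) (c t)%:E + \int[mu]_(t in J) (W n t)%:E)%E.
    apply: ge0_integralD => //.
    - by move=> t _; rewrite lee_fin.
    - exact/measurable_EFinP.
    - by move=> t _; rewrite lee_fin.
  apply: ae_le_lower_integral => [t _|t _|].
  - by rewrite lee_fin.
  - by rewrite -EFinD lee_fin addr_ge0.
  apply: filterS3 hc WE hs => t hc WE hs Jt; have [Dh _] := hs Jt.
  rewrite -EFinD lee_fin WE//; apply: le_trans (lerD (hc Jt) (lexx _)).
  have Dx : D (h t - vs_val (s n) t) by apply: DB => //; exact: vs_val_in.
  rewrite -(nrmN Dx) opprB -{1}(subrK (h t) (vs_val (s n) t)) addrC nrmD//.
  by apply: DB => //; exact: vs_val_in.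
have cc : ((nrm (vs_integral J (s n) - I))%:E +
    (\int[mu]_(t in J) (c t)%:E + \int[mu]_(t in J) (nrm (h t - vs_val (s n) t))%:E))%E
    @[n --> \oo] --> (0 + (\int[mu]_(t in J) (c t)%:E + 0))%E.
  have i0 : (0 <= \int[mu]_(t in J) (c t)%:E)%E by apply: integral_ge0 => t _; rewrite lee_fin.
  apply: cvgeD.
  - by rewrite adde0 ge0_adde_def ?inE.
  - by apply: cvg_EFin => //; near=> n.
  - by apply: cvgeD => //; [rewrite ge0_adde_def ?inE|exact: cvg_cst].
rewrite add0e adde0 in cc.
rewrite -(cvg_lim _ cc)//; apply: lime_ge; first exact: cvgP cc.
exact: nearW.
Unshelve. all: end_near. Qed.

(** The norm estimate for the difference, with majorant 0. As [is_bochner] is a relation, this is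
    what identifies the integrals occurring in different mild solutions. *)
Lemma is_bochner_uniq (J : set (measurableTypeR R)) h h' I I' :
  measurable J -> (mu J < +oo)%E ->
  {ae mu, forall t : measurableTypeR R, J t -> nrm (h t - h' t) = 0} ->
  is_bochner D nrm J h I -> is_bochner D nrm J h' I' -> nrm (I - I') = 0.
Proof.
move=> mJ Joo hh' b b'; apply/le_anti; rewrite nrm_ge0 andbT -lee_fin.
have m0 : measurable_fun J (cst (0 : R)) by exact: measurable_cst.
have := @nrm_bochner_le J _ _ (cst 0) mJ Joo m0 (fun=> lexx _) _ (is_bochnerB mJ b b').
rewrite integral0; apply.
by apply: filterS hh' => t h0 /h0 ->.
Qed.

(** The one source of Bochner integrals built from scratch: the steered trajectory is a finite sum
    of scalar functions times fixed vectors. Each fibre of a scalar simple function becomes a piece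
    of a [vsfun]. *)
Lemma is_bochner_scale (J : set (measurableTypeR R)) (c : R -> R) (v : V) :
  measurable J -> (mu J < +oo)%E -> D v -> mu.-integrable J (EFin \o c) ->
  is_bochner D nrm J (fun t => c t *: v) ((\int[mu]_(t in J) c t) *: v).
Proof.
move=> mJ Joo Dv ic; split; first exact: DZ.
have [g [ig cg intg]] := approximation_sfun_integrable mJ ic.
have /choice[s sP] : forall n, exists s : vsfun D,
    (forall t, vs_val s t = g n t *: v) /\
    vs_integral J s = (\int[mu]_(t in J) g n t) *: v.
  move=> n; pose r := finmap.enum_fset (fset_set (range (g n))).
  pose A (i : 'I_(size r)) : set (measurableTypeR R) := g n @^-1` [set tnth (in_tuple r) i].
  have mA i : measurable (A i) by exact: measurable_funPTI.
  have Dr (i : 'I_(size r)) : D (tnth (in_tuple r) i *: v) by exact: DZ.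
  have gE t : g n t = \sum_(i < size r) tnth (in_tuple r) i * \1_(A i) t.
    by rewrite fimfunE fsbig_finite//= big_tnth.
  exists (VSfun mA Dr); split => [t|].
    rewrite /vs_val /= gE scaler_suml; apply: eq_bigr => i _.
    by rewrite scalerA mulrC.
  rewrite /vs_integral /=.
  have iA i : mu.-integrable J (fun t => (\1_(A i) t)%:E).
    apply/integrableP; split; first exact/measurable_EFinP.
    under eq_integral do rewrite gee0_abs ?lee_fin//.
    rewrite integral_indic//; apply: le_lt_trans Joo.
    apply: le_measure; rewrite ?inE//; try exact: measurableI; exact: subIsetr.
  have -> : \int[mu]_(t in J) g n t = \sum_(i < size r) tnth (in_tuple r) i * fine (mu (A i `&` J)).
    apply: EFin_inj; rewrite -sumEFin fineK; last exact: integrable_fin_num (ig n).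
    under eq_integral do rewrite gE -sumEFin.
    rewrite integral_sum//; last first.
      by move=> i; under eq_fun do rewrite EFinM; exact: integrableZl.
    apply: eq_bigr => i _; under eq_integral do rewrite EFinM.
    rewrite integralZl// integral_indic// EFinM fineK// ge0_fin_numE//.
    apply: le_lt_trans Joo.
    apply: le_measure; rewrite ?inE//; try exact: measurableI; exact: subIsetr.
  rewrite scaler_suml; apply: eq_bigr => i _.
  by rewrite scalerA mulrC.
have mc : measurable_fun J c by case/integrableP : ic => /measurable_EFinP.
have mg n : measurable_fun J (g n) by exact: measurable_funTS.
have dE n : (\int[mu]_(t in J) (`|c t - g n t|)%:E = \int[mu]_(t in J) `|(EFin \o c) t - (g n t)%:E|)%E.
  by apply: eq_integral => t _.
have mcg n : measurable_fun J (fun t => `|c t - g n t|).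
  by apply: measurableT_comp => //; exact: measurable_funB.
exists s; split.
- apply: aeW => t Jt; split; first exact: DZ.
  have ct : g n t @[n --> \oo] --> c t by exact: fine_cvg (cg t Jt).
  rewrite (_ : (fun n => _) = (fun n => `|c t - g n t| * nrm v)); last first.
    by apply/funext => n; rewrite (sP n).1 -scalerBl nrmZ.
  have c0 : `|c t - g n t| @[n --> \oo] --> `|c t - c t|.
    by apply: cvg_norm; apply: cvgB => //; exact: cvg_cst.
  rewrite subrr normr0 in c0; rewrite -[X in _ --> X](mul0r (nrm v)).
  by apply: cvgM => //; exact: cvg_cst.
- rewrite (_ : (fun n => _) = (fun n => (nrm v)%:E * \int[mu]_(t in J) `|(EFin \o c) t - (g n t)%:E|)%E).
    by rewrite -[X in _ --> X](mule0 (nrm v)%:E); exact: cvgeZl.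
  apply/funext => n; rewrite -dE.
  have <- : (\int[mu]_(t in J) ((nrm v)%:E * (`|c t - g n t|)%:E) =
      (nrm v)%:E * \int[mu]_(t in J) (`|c t - g n t|)%:E)%E.
    by apply: ge0_integralZl_EFin => //; exact/measurable_EFinP.
  by apply: eq_integral => t _; rewrite (sP n).1 -scalerBl nrmZ// mulrC EFinM.
- have ci : fine (\int[mu]_(t in J) `|(EFin \o c) t - (g n t)%:E|)%E @[n --> \oo] --> (0 : R).
    exact: fine_cvg intg.
  have ci' : fine (\int[mu]_(t in J) `|(EFin \o c) t - (g n t)%:E|)%E * nrm v @[n --> \oo] --> (0 : R).
    by rewrite -[X in _ --> X](mul0r (nrm v)); apply: cvgM => //; exact: cvg_cst.
  apply: squeeze_cvgr (cvg_cst 0) ci'; apply: nearW => n.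
  rewrite nrm_ge0/= (sP n).2 -scalerBl nrmZ// ler_wpM2r//.
  have icg : mu.-integrable J (EFin \o (fun t => c t - g n t)).
    exact: eq_integrable (integrableB mJ ic (ig n)).
  rewrite -normrN opprB -(RintegralB mJ ic (ig n)) -dE.
  exact: le_normr_Rintegral mJ icg.
Qed.

End bochner_theory.

(** * Causality *)

(** In use, [b] is the free evolution, the [c] and [d] are the two integrals, and the [e] are the
    impulse sums. *)
Lemma variation_difference (V : zmodType) (x x' b c1 c2 d1 d2 e1 e2 : V) :
  x - (b + c1 + d1 + e1) - (x' - (b + c2 + d2 + e2)) + (e1 - e2) =
  x - x' - (c1 - c2 + (d1 - d2)).
Proof.
rewrite !opprD !opprK !addrA.
rewrite [LHS](ACl ((1*6*3*8*4*9)*(2*7)*(5*11)*(10*12))) /=.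
by rewrite !addNr subrr !addr0.
Qed.

(** * Intervals shifted by the delay *)

Section shifted_intervals.
Context (R : realDomainType).
Implicit Types l r t : R.

Lemma subr_itv_shift l r t : 0 <= l -> l <= t -> l - r \in `[- r, t - r].
Proof. by move=> l0 lt; rewrite in_itv/= lerD2r lt andbT lerBrDr addNr. Qed.

Lemma subr_itv l r t : 0 <= r -> 0 <= l -> l <= t -> l - r \in `[- r, t].
Proof.
move=> r0 l0 lt; rewrite in_itv/= lerBrDr addNr l0/=.
by rewrite lerBlDr (le_trans lt)// lerDl.
Qed.

Lemma mem_itvN l r t : 0 <= r -> 0 <= l -> l <= t -> l \in `[- r, t].
Proof. by move=> r0 l0 lt; rewrite in_itv/= lt andbT (le_trans _ l0)// oppr_le0. Qed.

End shifted_intervals.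

Section causality.
Context (R : realType) (N : nat) (Omega : set 'rV[R]_N) (oO : open Omega).
Local Notation mu := (lebesgue_dom oO).
Local Notation L2 := (L2 oO).
Variables (lam : nat -> R) (E : nat -> L2 -> L2).
Hypothesis hE : dirichlet_spectrum lam E.
Local Notation Z1 := (Z1 lam E).
Local Notation nz := (znorm lam E).
Local Notation leb := (@lebesgue_measure R).

(** Membership is included because [znorm] carries no information outside [Z1]. *)
Definition znull (d : L2 * L2) := Z1 d /\ nz d = 0.

Lemma znullD d d' : znull d -> znull d' -> znull (d + d').
Proof.
move=> [Zd d0] [Zd' d0']; split; first exact: (Z1D hE).
by apply/le_anti; rewrite znorm_ge0 andbT (le_trans (znormD hE _ _))// d0 d0' addr0.
Qed.

Lemma znullN d : znull d -> znull (- d).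
Proof. by move=> [Zd d0]; split; [exact: (Z1N hE)|rewrite (znormN hE)]. Qed.

Lemma znullB d d' : znull d -> znull d' -> znull (d - d').
Proof. by move=> h /znullN; exact: znullD. Qed.

Lemma znull_sum I (s : seq I) (P : pred I) (F : I -> L2 * L2) :
  (forall i, P i -> znull (F i)) -> znull (\sum_(i <- s | P i) F i).
Proof.
move=> h; apply: big_ind => //; last exact: znullD.
by split; [exact: (Z10 hE)|exact: (znorm0 hE)].
Qed.

Lemma znorm_eqv d d' : Z1 d -> znull (d - d') -> nz d = nz d' /\ Z1 d'.
Proof.
move=> Zd [Zdd dd]; have Zd' : Z1 d'.
  by rewrite -(subKr d d'); exact: (Z1B hE).
split => //; apply/le_anti/andP; split.
  by rewrite -{1}(subrK d' d) (le_trans (znormD hE _ _))// dd add0r.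
rewrite -{1}(subrK d d') (le_trans (znormD hE _ _))//; first exact: (Z1B hE).
by rewrite (znorm_distC hE)// dd add0r.
Qed.

Lemma bochner_uniq (J : set (measurableTypeR R)) h h' I I' :
  measurable J -> (leb J < +oo)%E ->
  {ae leb, forall t : measurableTypeR R, J t -> nz (h t - h' t) = 0} ->
  is_bochner Z1 nz J h I -> is_bochner Z1 nz J h' I' -> znull (I - I').
Proof.
move=> mJ Joo hh' b b'; split; first by apply: (Z1B hE); [case: b|case: b'].
by apply: (is_bochner_uniq (Z10 hE) (Z1D hE) (Z1Z hE) (@znorm_ge0 _ _ _ _ _ _)
  (znormD hE) (fun a x => @znormZ _ _ _ _ _ _ hE a x) mJ Joo hh' b b').
Qed.

Lemma znull_snd (y y' : L2 * L2) : y.1 = 0 -> y'.1 = 0 ->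
  {ae mu, forall s, y.2 s = y'.2 s} -> znull (y - y').
Proof.
case: y y' => [y1 y2] [y1' y2'] /= -> -> h.
have -> : (0, y2) - (0, y2') = (0, y2 - y2') :> L2 * L2 by congr (_, _); rewrite /= subr0.
split; first exact: (Z1_snd hE).
by rewrite (znorm_snd hE); exact: l2normB_ae.
Qed.

Lemma znull_ae (z z' : L2 * L2) : Z1 z -> Z1 z' -> nz (z - z') = 0 ->
  {ae mu, forall s, z.1 s = z'.1 s} /\ {ae mu, forall s, z.2 s = z'.2 s}.
Proof.
move=> Zz Zz' d0; have [h1 h2] := znorm0_ae hE (Z1B hE Zz Zz') d0.
split; [apply: filterS h1|apply: filterS h2] => s /=; rewrite -[X in X = _]/(_ s - _ s) => /eqP;
  by rewrite subr_eq0 => /eqP.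
Qed.

Lemma nemytskii_eqv h z z' u y y' : Z1 z -> Z1 z' -> nz (z - z') = 0 ->
  is_nemytskii h z u y -> is_nemytskii h z' u y' -> znull (y - y').
Proof.
move=> Zz Zz' /(znull_ae Zz Zz')[z1 z2] [y1 y2] [y1' y2'].
apply: znull_snd => //; pose proof (filterI z1 z2) as z12.
by apply: filterS3 z12 y2 y2' => s [-> ->] -> ->.
Qed.

Lemma memory_eqv M g t s z z' y y' : Z1 z -> Z1 z' -> nz (z - z') = 0 ->
  is_memory M g t s z y -> is_memory M g t s z' y' -> znull (y - y').
Proof.
move=> Zz Zz' /(znull_ae Zz Zz')[z1 z2] [y1 y2] [y1' y2'].
apply: znull_snd => //.
by apply: filterS3 z1 y2 y2' => x -> -> ->.
Qed.

Lemma lebesgue_itv_lty (a b : R) : (leb `[a, b] < +oo)%E.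
Proof. by rewrite lebesgue_measure_itv/=; case: ifP => _; rewrite ltry. Qed.

Variables (beta tau r : R) (p : nat) (tk : 'I_p -> R).
Variables (M : R -> 'rV[R]_N -> R) (g : R -> R) (f : R -> R -> R -> R -> R).
Variable Ik : 'I_p -> R -> R -> R -> R -> R.
Hypotheses (hbeta : 1 < beta) (hr : 0 < r).
Hypothesis tk_itv : forall k, 0 < tk k < tau.
Local Notation T := (Tsg lam E beta).
Local Notation mild := (mild_solution lam E beta tau r tk M g f Ik).

(* Memory and impulses depend on the solution up to time [t - r] and at the
   impulse times before [t] only. *)
Lemma mild_difference Phi u u' z z' t : C_initial lam E r Phi ->
  mild Phi u z -> mild Phi u' z' -> t \in `[0, tau] ->
  (forall l, l \in `[- r, t - r] -> nz (z l - z' l) = 0) ->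
  (forall k, tk k < t -> nz (z (tk k) - z' (tk k)) = 0 /\ u (tk k) = u' (tk k)) ->
  exists (FF FF' m m' : R -> L2 * L2) (S1 S1' S2 S2' : L2 * L2),
  [/\ {ae leb, forall s : measurableTypeR R, s \in `[0, t] ->
        [/\ is_nemytskii (f s) (z (s - r)) (u s) (FF s),
            is_nemytskii (f s) (z' (s - r)) (u' s) (FF' s) &
            [/\ Z1 (m s), Z1 (m' s) & nz (m s - m' s) = 0]]},
      is_bochner Z1 nz `[0, t] (fun s => T (t - s) ((0, u s) + m s)) S1 /\
      is_bochner Z1 nz `[0, t] (fun s => T (t - s) ((0, u' s) + m' s)) S1',
      is_bochner Z1 nz `[0, t] (fun s => T (t - s) (FF s)) S2 /\
      is_bochner Z1 nz `[0, t] (fun s => T (t - s) (FF' s)) S2' &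
      znull (z t - z' t - ((S1 - S1') + (S2 - S2')))].
Proof.
move=> CPhi [Zz _ _ [FF [MG [m [J [hFF hm hJ hz]]]]]].
move=> [Zz' _ _ [FF' [MG' [m' [J' [hFF' hm' hJ' hz']]]]]] tI zz' zk.
have [t0 tT] : 0 <= t /\ t <= tau by move: tI; rewrite in_itv/= => /andP.
have [S1 [S2 [b1 b2 zt]]] := hz _ tI.
have [S1' [S2' [b1' b2' zt']]] := hz' _ tI.
exists FF, FF', m, m', S1, S1', S2, S2'; split => //.
- pose proof (filterI hm hm') as hmm.
  apply: filterS3 hFF hFF' hmm => s {}hFF {}hFF' [{}hm {}hm'] st.
  have sT : s \in `[0, tau].
    by move: st; rewrite !in_itv/= => /andP[-> s1]; exact: le_trans tT.
  have [s0 st'] : 0 <= s /\ s <= t by move: st; rewrite /= in_itv/= => /andP.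
  split; [exact: hFF|exact: hFF'|].
  have [hMG bm] := hm sT; have [hMG' bm'] := hm' sT.
  have [Zm _] := bm; have [Zm' _] := bm'; split => //.
  apply: (bochner_uniq _ _ _ bm bm').2 => //; first exact: lebesgue_itv_lty.
  apply: filterS2 hMG hMG' => l hMG hMG' ls.
  have [l0 ls'] : 0 <= l /\ l <= s by move: ls; rewrite /= in_itv/= => /andP.
  have lI : l - r \in `[- r, tau].
    by apply: subr_itv; [exact: ltW|exact: l0|exact: le_trans ls' (le_trans st' tT)].
  apply: (memory_eqv (Zz _ lI) (Zz' _ lI) _ (hMG ls) (hMG' ls)).2.
  by apply: zz'; apply: subr_itv_shift => //; exact: le_trans st'.
- have ZPhi0 : Z1 (Phi 0) by have [] := CPhi 0; rewrite ?in_itv/= ?oppr_le0 ?lexx ?ltW.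
  have tI' : t \in `[- r, tau] by apply: mem_itvN => //; exact: ltW.
  have ZJ k : Z1 (J k).
    by have [+ _] := hJ k; case: (J k) => [a b] /= ->; exact: (Z1_snd hE).
  have ZJ' k : Z1 (J' k).
    by have [+ _] := hJ' k; case: (J' k) => [a b] /= ->; exact: (Z1_snd hE).
  have ZT k (y : L2 * L2) : tk k < t -> Z1 y -> Z1 (T (t - tk k) y).
    by move=> kt Zy; apply: (Z1_Tsg hE) => //; rewrite subr_ge0 ltW.
  have ZA : Z1 (T t (Phi 0)) by exact: (Z1_Tsg hE).
  have nX : znull (z t - (T t (Phi 0) + S1 + S2 + \sum_(k < p | tk k < t) T (t - tk k) (J k))).
    split => //; apply: (Z1B hE); first exact: Zz.
    apply: (Z1D hE); last by apply: (Z1_sum hE) => k kt; exact: ZT.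
    by apply: (Z1D hE); [apply: (Z1D hE) => //; case: b1|case: b2].
  have nX' : znull (z' t - (T t (Phi 0) + S1' + S2' + \sum_(k < p | tk k < t) T (t - tk k) (J' k))).
    split => //; apply: (Z1B hE); first exact: Zz'.
    apply: (Z1D hE); last by apply: (Z1_sum hE) => k kt; exact: ZT.
    by apply: (Z1D hE); [apply: (Z1D hE) => //; case: b1'|case: b2'].
  have nJ : znull (\sum_(k < p | tk k < t) (T (t - tk k) (J k) - T (t - tk k) (J' k))).
    apply: znull_sum => k kt; split; first by apply: (Z1B hE); exact: ZT.
    apply: (Tsg_eqv hE) => //; first by rewrite subr_ge0 ltW.
    have [zk0 uk] := zk _ kt; have /andP[k0 kT] := tk_itv k.
    have kI : tk k \in `[- r, tau] by apply: mem_itvN; exact: ltW.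
    by have := hJ' k; rewrite -uk => hJk; exact: (nemytskii_eqv (Zz _ kI) (Zz' _ kI) zk0 (hJ k) hJk).2.
  have nn := znullD (znullB nX nX') nJ.
  by rewrite sumrB variation_difference in nn.
Qed.

(* Method of steps: induction on the number of delays in [t] and on the number of
   impulses before [t]. *)
Lemma causality Phi u u' z z' sigma : C_initial lam E r Phi ->
  mild Phi u z -> mild Phi u' z' -> sigma <= tau ->
  (forall s, s \in `[0, sigma] -> u s = u' s) ->
  forall t, t \in `[- r, sigma] -> nz (z t - z' t) = 0.
Proof.
move=> CPhi mz mz' sT uu'.
have [Zz zPhi _ _] := mz; have [Zz' zPhi' _ _] := mz'.
suff main : forall n c t, t \in `[- r, sigma] -> t <= n%:R * r -> (#|[pred k | (tk k < t)%R]| < c)%N ->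
    nz (z t - z' t) = 0.
  move=> t tI; pose n := (Num.truncn (t / r)).+1.
  apply: (main n (#|[pred k | (tk k < t)%R]|).+1) => //.
  by rewrite -ler_pdivrMr// ltW// truncnS_gt.
have neg t : t \in `[- r, sigma] -> t <= 0 -> nz (z t - z' t) = 0.
  rewrite in_itv/= => /andP[rt ts] t0.
  have tI : t \in `[- r, 0] by rewrite in_itv/= rt.
  have tI' : t \in `[- r, tau] by rewrite in_itv/= rt (le_trans ts).
  have [ZP _] := CPhi _ tI.
  apply/le_anti; rewrite znorm_ge0 andbT.
  apply: le_trans (znorm_tri hE (Zz _ tI') ZP (Zz' _ tI')) _.
  by rewrite zPhi// add0r (znorm_distC hE) ?zPhi'//; exact: Zz'.
elim=> [|n IHn] c t; first by move=> tI t0 _; apply: neg => //; rewrite (le_trans t0)// mul0r.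
elim: c t => // c IHc t tI tn tc.
have [t0|t0] := leP t 0; first exact: neg.
have [rt ts] : - r <= t /\ t <= sigma by move: tI; rewrite in_itv/= => /andP.
have tIT : t \in `[0, tau] by rewrite in_itv/= ltW//= (le_trans ts).
(* One delay back lowers [n], whatever the number of earlier impulses. Back to an impulse time [n]
   is kept, but the count drops strictly, since that impulse is not before itself. *)
have hl l : l \in `[- r, t - r] -> nz (z l - z' l) = 0.
  rewrite in_itv/= => /andP[l1 l2].
  apply: (IHn (#|[pred k | (tk k < l)%R]|).+1) => //.
    by rewrite in_itv/= l1/= (le_trans l2)// (le_trans _ ts)// lerBlDr lerDl ltW.
  by rewrite (le_trans l2)// lerBlDr (le_trans tn)// -natr1 mulrDl mul1r.
have hk k : tk k < t -> nz (z (tk k) - z' (tk k)) = 0 /\ u (tk k) = u' (tk k).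
  move=> kt; have /andP[k0 kT] := tk_itv k; split; last first.
    by apply: uu'; rewrite in_itv/= ltW//= (le_trans (ltW kt)).
  apply: IHc; [|exact: le_trans (ltW kt) tn|].
    by apply: mem_itvN; [exact: ltW|exact: ltW|exact: le_trans (ltW kt) ts].
  rewrite -ltnS (leq_trans _ tc)// ltnS; apply: proper_card.
  apply/properP; split.
    by apply/fintype.subsetP => i; rewrite !inE => ik; exact: lt_trans kt.
  by exists k; rewrite !inE ?ltxx.
have [FF [FF' [m [m' [S1 [S1' [S2 [S2' [hae [b1 b1'] [b2 b2'] nd]]]]]]]]] :=
  mild_difference CPhi mz mz' tIT hl hk.
have mI : measurable (`[0, t] : set (measurableTypeR R)) by exact: measurable_itv.
have nS1 : znull (S1 - S1').
  apply: (bochner_uniq mI (lebesgue_itv_lty _ _) _ b1 b1').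
  apply: filterS hae => s hs sI; have [_ _ [Zm Zm' mm']] := hs sI.
  have [s0 st] : 0 <= s /\ s <= t by move: sI; rewrite /= in_itv/= => /andP.
  have -> : u' s = u s by apply/esym/uu'; rewrite in_itv/= s0/= (le_trans st).
  apply: (Tsg_eqv hE) => //; first by rewrite subr_ge0.
  - by apply: (Z1D hE) => //; exact: (Z1_snd hE).
  - by apply: (Z1D hE) => //; exact: (Z1_snd hE).
  - by rewrite opprD addrACA subrr add0r.
have nS2 : znull (S2 - S2').
  apply: (bochner_uniq mI (lebesgue_itv_lty _ _) _ b2 b2').
  apply: filterS hae => s hs sI; have [hF hF' _] := hs sI.
  have [s0 st] : 0 <= s /\ s <= t by move: sI; rewrite /= in_itv/= => /andP.
  have us : u' s = u s by apply/esym/uu'; rewrite in_itv/= s0/= (le_trans st).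
  have sI' : s - r \in `[- r, tau].
    by apply: subr_itv; [exact: ltW|exact: s0|exact: le_trans st (le_trans ts sT)].
  rewrite us in hF'.
  have zs : nz (z (s - r) - z' (s - r)) = 0.
    by apply: hl; exact: subr_itv_shift.
  have ZF y h w : is_nemytskii h w (u s) y -> Z1 y.
    by case=> + _; case: y => [a b] /= ->; exact: (Z1_snd hE).
  apply: (Tsg_eqv hE) => //; [by rewrite subr_ge0|exact: ZF hF|exact: ZF hF'|].
  exact: (nemytskii_eqv (Zz _ sI') (Zz' _ sI') zs hF hF').2.
have := znullD nd (znullD nS1 nS2); rewrite subrK => -[].
by [].
Qed.

End causality.

(** * Steering finitely many modes *)

Section scalar_control.
Context (R : realType).
Local Notation leb := (@lebesgue_measure R).

Lemma integral_expR_itv (m T c d : R) : m != 0 -> c < d ->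
  (\int[leb]_(s in `[c, d]) (expR (- (m * (T - s))))%:E)%E =
  ((expR (- (m * (T - d))) - expR (- (m * (T - c)))) / m)%:E.
Proof.
move=> m0 cd.
pose F (s : R) := m^-1 * expR (- (m * (T - s))) : R.
have dF (s : R) : is_derive s 1 F (expR (- (m * (T - s)))).
  rewrite /F; apply: is_derive_eq.
  rewrite /GRing.scale /=; field; exact: m0.
have cF s : {for s, continuous F}.
  by apply: differentiable_continuous; apply/derivable1_diffP; case: (dF s).
rewrite (@continuous_FTC2 _ (fun s => expR (- (m * (T - s)))) F c d)//.
- by rewrite -EFinB /F -mulrBr mulrC.
- apply: continuous_subspaceT => s.
  apply: continuous_comp; last exact: continuous_expR.
  apply: cvgN; apply: cvgM; first exact: cvg_cst.
  by apply: cvgB; [exact: cvg_cst|exact: cvg_id].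
- split.
  + by move=> s _; case: (dF s).
  + by apply: cvg_at_right_filter; exact: cF.
  + by apply: cvg_at_left_filter; exact: cF.
- by move=> s _; rewrite derive1E; exact: derive_val.
Qed.

Lemma integrable_indic_expR (m tau c d : R) : m != 0 -> 0 <= c -> c < d -> d <= tau ->
  leb.-integrable `[0, tau] (EFin \o (fun s => \1_(`]c, d]%classic : set R) s * expR (- (m * (tau - s))))) /\
  \int[leb]_(s in `[0, tau]) (\1_(`]c, d]%classic : set R) s * expR (- (m * (tau - s)))) =
  (expR (- (m * (tau - d))) - expR (- (m * (tau - c)))) / m.
Proof.
move=> m0 c0 cd dt.
have me : measurable_fun setT (fun s : measurableTypeR R => expR (- (m * (tau - s)))).
  apply: measurableT_comp => //; apply: measurableT_comp => //.
  by apply: measurable_funM => //; exact: measurable_funB.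
have I0 : (\int[leb]_(s in `[0%R, tau]) (\1_(`]c, d]%classic : set R) s * expR (- (m * (tau - s))))%:E =
   ((expR (- (m * (tau - d))) - expR (- (m * (tau - c)))) / m)%:E)%E.
  rewrite -integral_expR_itv// -[RHS]integral_itv_obnd_cbnd; last first.
    by apply/measurable_EFinP; exact: measurable_funTS.
  rewrite [RHS]integral_mkcond [LHS]integral_mkcond; apply: eq_integral => s _.
  rewrite !patchE indicE; case: ifPn => [|sN]; case: ifPn => //.
  - by rewrite mul1r.
  - by rewrite mul0r.
  - move=> /set_mem; rewrite /= in_itv/= => /andP[cs sd]; exfalso; move/negP: sN; apply.
    by apply/mem_set; rewrite /= in_itv/= (le_trans c0 (ltW cs)) (le_trans sd dt).
split; last by rewrite /Rintegral I0.
apply/integrableP; split.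
  by apply/measurable_EFinP; apply: measurable_funTS; apply: measurable_funM.
under eq_integral do rewrite gee0_abs ?lee_fin ?mulr_ge0 ?expR_ge0//.
by rewrite /= I0 ltry.
Qed.

Definition two_step (tau delta a1 a2 s : R) : R :=
  a1 * \1_(`]tau - delta, tau - delta / 2]%classic : set R) s +
  a2 * \1_(`]tau - delta / 2, tau]%classic : set R) s.

(** At rate [m] the moment is [(a1 * q m + a2) * x m]: the first half is the second one shifted by
    [h], which costs the factor [q m]. The resulting 2 by 2 system is invertible because [q m1] and
    [q m2] differ. *)
Lemma two_step_moments (m1 m2 tau delta P Q : R) :
  0 < m1 -> 0 < m2 -> m1 != m2 -> 0 < delta -> delta <= tau ->
  exists a1 a2 : R,
    (leb.-integrable `[0, tau] (EFin \o (fun s => two_step tau delta a1 a2 s * expR (- (m1 * (tau - s))))) /\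
     \int[leb]_(s in `[0, tau]) (two_step tau delta a1 a2 s * expR (- (m1 * (tau - s)))) = P) /\
    (leb.-integrable `[0, tau] (EFin \o (fun s => two_step tau delta a1 a2 s * expR (- (m2 * (tau - s))))) /\
     \int[leb]_(s in `[0, tau]) (two_step tau delta a1 a2 s * expR (- (m2 * (tau - s)))) = Q).
Proof.
move=> m10 m20 m12 d0 dt.
pose h := delta / 2; have h0 : 0 < h by rewrite divr_gt0.
have hd : h < delta by rewrite /h ltr_pdivrMr// ltr_pMr// ltr1n.
pose q (m : R) := expR (- (m * h)).
pose x (m : R) := (1 - q m) / m.
have q1 m : 0 < m -> q m < 1 by move=> m0; rewrite expR_lt1 oppr_lt0 mulr_gt0.
have x0 m : 0 < m -> x m != 0.
  by move=> m0; rewrite gt_eqF// divr_gt0// subr_gt0 q1.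
have main (m a1 a2 : R) : 0 < m ->
    leb.-integrable `[0, tau] (EFin \o (fun s => two_step tau delta a1 a2 s * expR (- (m * (tau - s))))) /\
    \int[leb]_(s in `[0, tau]) (two_step tau delta a1 a2 s * expR (- (m * (tau - s)))) =
    (a1 * q m + a2) * x m.
  move=> m0; have mn0 : m != 0 by rewrite gt_eqF.
  have c10 : 0 <= tau - delta by rewrite subr_ge0.
  have c12 : tau - delta < tau - h by rewrite ltrD2l ltrN2.
  have c2t : tau - h <= tau by rewrite gerBl ltW.
  have c20 : 0 <= tau - h by rewrite subr_ge0 (le_trans (ltW hd)).
  have c2t' : tau - h < tau by rewrite gtrBl.
  have [i1 v1] := integrable_indic_expR mn0 c10 c12 c2t.
  have [i2 v2] := integrable_indic_expR mn0 c20 c2t' (lexx _).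
  set g1 := (fun s => \1_(`]tau - delta, tau - h]%classic : set R) s * expR (- (m * (tau - s)))) in i1 v1.
  set g2 := (fun s => \1_(`]tau - h, tau]%classic : set R) s * expR (- (m * (tau - s)))) in i2 v2.
  rewrite (_ : (fun s => _) = (fun s => a1 * g1 s + a2 * g2 s)); last first.
    by apply/funext => s; rewrite /two_step /g1 /g2 -/h mulrDl !mulrA.
  have mI : measurable (`[0, tau]%classic : set (measurableTypeR R)) by exact: measurable_itv.
  have j1 : leb.-integrable `[0, tau] (EFin \o (fun s => a1 * g1 s)).
    exact: eq_integrable (integrableZl mI a1 i1).
  have j2 : leb.-integrable `[0, tau] (EFin \o (fun s => a2 * g2 s)).
    exact: eq_integrable (integrableZl mI a2 i2).
  split; first exact: eq_integrable (integrableD mI j1 j2).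
  rewrite (RintegralD mI j1 j2) (RintegralZl _ mI i1) (RintegralZl _ mI i2) v1 v2.
  rewrite !subKr subrr mulr0 oppr0 expR0 /x /q.
  have -> : expR (- (m * delta)) = expR (- (m * h)) * expR (- (m * h)).
    by rewrite -expRD -opprD -mulrDr /h -splitr.
  by field.
pose b1 := P / x m1; pose b2 := Q / x m2.
have qq : q m1 - q m2 != 0.
  rewrite subr_eq0; apply/eqP => /expR_inj/oppr_inj mm.
  by move/eqP: m12; apply; apply: (mulIf _ mm); rewrite gt_eqF.
pose a1 := (b1 - b2) / (q m1 - q m2); pose a2 := b1 - a1 * q m1.
exists a1, a2.
have [i1 v1] := main m1 a1 a2 m10; have [i2 v2] := main m2 a1 a2 m20.
split; split => //.
- by rewrite v1 /a2 addrC subrK /b1 divfK// x0.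
- rewrite v2 (_ : a1 * q m2 + a2 = b2) ?divfK ?x0//.
  by rewrite /a2 /a1; field.
Qed.

(** The two kernels are the second column of the modal exponential at time [tau - s], that is, the
    response of one mode to a force. *)
Lemma two_step_controllable (beta l tau delta P Q : R) :
  1 < beta -> 0 < l -> 0 < delta -> delta <= tau ->
  exists a1 a2 : R,
    (leb.-integrable `[0, tau] (EFin \o (fun s => two_step tau delta a1 a2 s * psi beta l (tau - s))) /\
     \int[leb]_(s in `[0, tau]) (two_step tau delta a1 a2 s * psi beta l (tau - s)) = P) /\
    (leb.-integrable `[0, tau] (EFin \o (fun s => two_step tau delta a1 a2 s *
        (chi beta l (tau - s) - 2 * beta * (l * psi beta l (tau - s))))) /\
     \int[leb]_(s in `[0, tau]) (two_step tau delta a1 a2 s *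
        (chi beta l (tau - s) - 2 * beta * (l * psi beta l (tau - s)))) = Q).
Proof.
move=> b1 l0 d0 dt; have [r1 r12 rs rp] := rhoP b1.
have r2 : 0 < rho2 beta by exact: lt_trans r12.
have m1 : 0 < l * rho1 beta by rewrite mulr_gt0.
have m2 : 0 < l * rho2 beta by rewrite mulr_gt0.
have m12 : l * rho1 beta != l * rho2 beta by rewrite lt_eqF// ltr_pM2l.
(* Inverting the kernels: the exponential of rate [l * rho1 beta] is [rho2 beta * l] times the first
   kernel plus the second; exchange the roots for the other rate. *)
have [a1 [a2 [[i1 v1] [i2 v2]]]] := two_step_moments
  (rho2 beta * P * l + Q) (rho1 beta * P * l + Q) m1 m2 m12 d0 dt.
exists a1, a2.
set al := two_step tau delta a1 a2 in i1 v1 i2 v2 *.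
set e1 := (fun s => al s * expR (- (l * rho1 beta * (tau - s)))) in i1 v1.
set e2 := (fun s => al s * expR (- (l * rho2 beta * (tau - s)))) in i2 v2.
have d0' : rho2 beta - rho1 beta != 0 by rewrite gt_eqF// subr_gt0.
have ln0 : l != 0 by rewrite gt_eqF.
have mI : measurable (`[0, tau]%classic : set (measurableTypeR R)) by exact: measurable_itv.
have comb (c1 c2 : R) : leb.-integrable `[0, tau] (EFin \o (fun s => c1 * e1 s + c2 * e2 s)) /\
    \int[leb]_(s in `[0, tau]) (c1 * e1 s + c2 * e2 s) =
    c1 * (rho2 beta * P * l + Q) + c2 * (rho1 beta * P * l + Q).
  have j1 : leb.-integrable `[0, tau] (EFin \o (fun s => c1 * e1 s)).
    exact: eq_integrable (integrableZl mI c1 i1).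
  have j2 : leb.-integrable `[0, tau] (EFin \o (fun s => c2 * e2 s)).
    exact: eq_integrable (integrableZl mI c2 i2).
  split; first exact: eq_integrable (integrableD mI j1 j2).
  by rewrite (RintegralD mI j1 j2) (RintegralZl _ mI i1) (RintegralZl _ mI i2) v1 v2.
have [k1 w1] := comb (l * (rho2 beta - rho1 beta))^-1 (- (l * (rho2 beta - rho1 beta))^-1).
have [k2 w2] := comb (- rho1 beta / (rho2 beta - rho1 beta)) (rho2 beta / (rho2 beta - rho1 beta)).
split.
- rewrite (_ : (fun s => _) = (fun s => (l * (rho2 beta - rho1 beta))^-1 * e1 s +
    - (l * (rho2 beta - rho1 beta))^-1 * e2 s)).
    by split => //; rewrite w1; field; rewrite d0' ln0.
  by apply/funext => s; rewrite /psi /e1 /e2; field; rewrite d0' ln0.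
- rewrite (_ : (fun s => _) = (fun s => - rho1 beta / (rho2 beta - rho1 beta) * e1 s +
    rho2 beta / (rho2 beta - rho1 beta) * e2 s)).
    by split => //; rewrite w2; field.
  apply/funext => s; rewrite /psi /chi -rs /e1 /e2; field; rewrite d0'.
  by rewrite ln0.
Qed.

End scalar_control.

(** * From scalar moments to controls with values in L^2 *)

Section steering.
Context (R : realType) (N : nat) (Omega : set 'rV[R]_N) (oO : open Omega).
Local Notation mu := (lebesgue_dom oO).
Local Notation L2 := (L2 oO).
Variables (lam : nat -> R) (E : nat -> L2 -> L2).
Hypothesis hE : dirichlet_spectrum lam E.
Local Notation Z1 := (Z1 lam E).
Local Notation nz := (znorm lam E).
Local Notation leb := (@lebesgue_measure R).

(** Stronger than [L2_control] but stable under finite sums, and measurability needs only a constant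
    approximating sequence. *)
Definition simple_control (u : R -> L2) : Prop :=
  (exists s : vsfun (setT : set L2), forall t, vs_val s t = u t) /\
  (exists B, forall t, l2norm (u t) <= B).

Lemma simple_control_lin a u u' : simple_control u -> simple_control u' ->
  simple_control (fun t => a *: u t + u' t).
Proof.
move=> [[s su] [B uB]] [[s' su'] [B' uB']]; split.
  have [s2 [s2E _]] := vsfun_lin (fun _ _ _ => I : setT _) a s s'.
  by exists s2 => t; rewrite s2E su su'.
exists (`|a| * B + B') => t; rewrite (le_trans (l2normD _ _))// lerD// l2normZ.
by rewrite ler_wpM2l.
Qed.

Lemma simple_control_indic (A : set (measurableTypeR R)) (v : L2) : measurable A ->
  simple_control (fun t => \1_A t *: v).
Proof.
move=> mA; split.
  exists (@VSfun R _ setT 1 (fun=> A) (fun=> v) (fun=> mA) (fun=> I)) => t.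
  by rewrite /vs_val /= big_ord1.
exists (l2norm v) => t; rewrite l2normZ indicE; case: (_ \in _).
  by rewrite normr1 mul1r.
by rewrite normr0 mul0r l2norm_ge0.
Qed.

Lemma simple_control0 : simple_control (fun=> 0).
Proof.
have := simple_control_indic (0 : L2) (@measurable0 _ (measurableTypeR R)).
by under eq_fun do rewrite scaler0.
Qed.

Lemma simple_control_sum n (u : nat -> R -> L2) : (forall j, simple_control (u j)) ->
  simple_control (fun t => \sum_(j < n) u j t).
Proof.
move=> hu; elim: n => [|n IH].
  by under eq_fun do rewrite big_ord0; exact: simple_control0.
under eq_fun do rewrite big_ord_recr/= addrC -[u n _]scale1r.
exact: simple_control_lin.
Qed.

Lemma simple_control_two_step tau delta a1 a2 (v : L2) :
  simple_control (fun t => two_step tau delta a1 a2 t *: v).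
Proof.
rewrite (_ : (fun t => _) = (fun t => a1 *: (\1_(`]tau - delta, tau - delta / 2]%classic : set R) t *: v) +
   (a2 *: (\1_(`]tau - delta / 2, tau]%classic : set R) t *: v) + 0))); last first.
  by apply/funext => t; rewrite /two_step scalerDl !scalerA addr0.
apply: simple_control_lin; first by apply: simple_control_indic; exact: measurable_itv.
apply: simple_control_lin; first by apply: simple_control_indic; exact: measurable_itv.
exact: simple_control0.
Qed.

Lemma L2_control_simple tau u : simple_control u -> L2_control tau u.
Proof.
move=> [[s su] [B uB]]; split.
  exists (fun=> s); apply: aeW => t _; split => //.
  rewrite (_ : (fun n => _) = (fun=> 0)); first exact: cvg_cst.
  by apply/funext => n; rewrite su subrr l2norm0.
apply: (@le_lt_trans _ _ (\int[leb]_(t in `[0%R, tau]) (B ^+ 2)%:E)%E).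
  apply: ae_le_lower_integral => [t _|t _|].
  - by rewrite lee_fin sqr_ge0.
  - by rewrite lee_fin sqr_ge0.
  apply: aeW => t _; rewrite lee_fin.
  have B0 : 0 <= B by exact: le_trans (l2norm_ge0 _) (uB t).
  by rewrite ler_pXn2r// nnegrE l2norm_ge0.
rewrite integral_cst; last exact: measurable_itv.
by rewrite lte_mul_pinfty ?lee_fin ?sqr_ge0//; exact: lebesgue_itv_lty.
Qed.

(** The endpoint [s = tau - delta] is included, thanks to the half-open pieces: it may be an impulse
    time. *)
Lemma two_step_eq0 (tau delta a1 a2 s : R) : 0 <= delta -> s <= tau - delta ->
  two_step tau delta a1 a2 s = 0.
Proof.
move=> d0 sd; rewrite /two_step !indicE !memNset ?mulr0 ?addr0//= in_itv/=.
  by move=> /andP[h _]; have := lt_le_trans h sd; rewrite ltrD2l ltrN2 ltNge ler_pdivrMr// ler_peMr// ler1n.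
by move=> /andP[h _]; have := lt_le_trans h sd; rewrite ltxx.
Qed.

Lemma Z1_bochner_scale (c : R -> R) (v : L2 * L2) tau : Z1 v ->
  leb.-integrable `[0, tau] (EFin \o c) ->
  is_bochner Z1 nz `[0, tau] (fun t => c t *: v) ((\int[leb]_(t in `[0, tau]) c t) *: v).
Proof.
move=> Zv ic; apply: (is_bochner_scale (Z1Z hE) (@znorm_ge0 _ _ _ _ _ _)
  (fun a x => @znormZ _ _ _ _ _ _ hE a x)) => //.
exact: lebesgue_itv_lty.
Qed.

Lemma Z1_bochnerD (J : set (measurableTypeR R)) h h' I I' : measurable J ->
  is_bochner Z1 nz J h I -> is_bochner Z1 nz J h' I' ->
  is_bochner Z1 nz J (fun t => h t + h' t) (I + I').
Proof.
move=> mJ b b'; have := is_bochner_lin (Z10 hE) (Z1D hE) (Z1Z hE) (@znorm_ge0 _ _ _ _ _ _)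
  (znormD hE) (fun a x => @znormZ _ _ _ _ _ _ hE a x) 1 mJ b b'.
by rewrite scale1r; under eq_fun do rewrite scale1r.
Qed.

Lemma Z1_bochner_sum n tau (h : nat -> R -> L2 * L2) (I : nat -> L2 * L2) :
  (forall j, is_bochner Z1 nz `[0, tau] (h j) (I j)) ->
  is_bochner Z1 nz `[0, tau] (fun t => \sum_(j < n) h j t) (\sum_(j < n) I j).
Proof.
move=> hI; elim: n => [|n IH].
  have i0 : leb.-integrable `[0, tau] (EFin \o (fun _ : R => 0 : R)).
    exact: eq_integrable (integrable0 _ _).
  have h0 := Z1_bochner_scale (Z10 hE) i0; rewrite !scaler0 in h0.
  have e : (fun t : R => \sum_(j < 0) h j t) = (fun=> 0).
    by apply/funext => t; rewrite big_ord0.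
  rewrite e big_ord0; exact: h0.
rewrite big_ord_recr/= (_ : (fun t => _) = (fun t => \sum_(j < n) h j t + h n t)).
  by apply: Z1_bochnerD => //; exact: measurable_itv.
by apply/funext => t; rewrite big_ord_recr.
Qed.

(** [Tsg] is known only up to norm zero, so the integral is computed for an explicit [w], and [Tsg]
    is compared with [w] at each time. *)
Lemma steering (beta tau delta : R) (y : L2 * L2) n : 1 < beta -> 0 < delta -> delta <= tau ->
  exists (u : R -> L2) (w : R -> L2 * L2),
  [/\ simple_control u, forall s, s <= tau - delta -> u s = 0,
      is_bochner Z1 nz `[0, tau] w (\sum_(j < n) (E j y.1, E j y.2)) &
      forall s, 0 <= s -> s <= tau -> znull lam E (Tsg lam E beta (tau - s) (0, u s) - w s)].
Proof.
move=> b1 d0 dt.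
(* The coefficients [a1], [a2] produce a unit displacement at rest, and [c1], [c2] a unit velocity
   at zero displacement; a general target is their combination. *)
have /choice[a1 a1P] := fun j => two_step_controllable 1 0 b1 (lam_gt0 hE j) d0 dt.
have /choice[a2 a2P] := a1P.
have /choice[c1 c1P] := fun j => two_step_controllable 0 1 b1 (lam_gt0 hE j) d0 dt.
have /choice[c2 c2P] := c1P.
pose al j := two_step tau delta (a1 j) (a2 j).
pose ga j := two_step tau delta (c1 j) (c2 j).
pose uj j s := al j s *: E j y.1 + ga j s *: E j y.2.
pose ps j s := psi beta (lam j) (tau - s).
pose ph j s := chi beta (lam j) (tau - s) - 2 * beta * (lam j * psi beta (lam j) (tau - s)).
(* The modal exponential at time [tau - s] applied to the force [uj j s], with [ps] and [ph] as its
   second column. *)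
pose wj j s : L2 * L2 := (ps j s *: uj j s, ph j s *: uj j s).
have mu_j j s : mode E j (uj j s).
  by apply: (modeD hE); apply: (modeZ hE); exact: (mode_projE hE).
exists (fun s => \sum_(j < n) uj j s), (fun s => \sum_(j < n) wj j s); split.
- apply: simple_control_sum => j; rewrite /uj /al /ga.
  under eq_fun do rewrite -[_ *: E j y.1]scale1r.
  by apply: simple_control_lin; exact: simple_control_two_step.
- move=> s sd; rewrite big1// => j _.
  by rewrite /uj /al /ga !(two_step_eq0 _ _ (ltW d0) sd) !scale0r addr0.
- apply: (Z1_bochner_sum n (h := wj) (I := fun j => (E j y.1, E j y.2))) => j.
  have [[i1 v1] [i2 v2]] := a2P j; have [[k1 w1] [k2 w2]] := c2P j.
  have Zf x : Z1 (E j x, 0) by apply: (Z1_mode hE (j := j)); exact: (mode_projE hE).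
  have Zs x : Z1 (0, E j x) by exact: (Z1_snd hE).
  have mI : measurable (`[0, tau]%classic : set (measurableTypeR R)) by exact: measurable_itv.
  have B1 := Z1_bochner_scale (Zf y.1) i1.
  have B2 := Z1_bochner_scale (Zf y.2) k1.
  have B3 := Z1_bochner_scale (Zs y.1) i2.
  have B4 := Z1_bochner_scale (Zs y.2) k2.
  have := Z1_bochnerD mI (Z1_bochnerD mI B1 B2) (Z1_bochnerD mI B3 B4).
  rewrite v1 v2 w1 w2 !scale0r !scale1r addr0 add0r.
  rewrite (_ : (E j y.1, 0) + (0, E j y.2) = (E j y.1, E j y.2) :> L2 * L2); last first.
    by congr (_, _); rewrite /= ?addr0 ?add0r.
  rewrite (_ : (fun t => _) = wj j)//; apply/funext => s.
  rewrite /wj /uj /al /ga /ps /ph; congr (_, _) => /=.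
    by rewrite !scaler0 !addr0 scalerDr !scalerA ![psi _ _ _ * _]mulrC.
  by rewrite !scaler0 !add0r scalerDr !scalerA ![_ * two_step _ _ _ _ _]mulrC.
move=> s s0 st; have ts0 : 0 <= tau - s by rewrite subr_ge0.
have Zw : Z1 (\sum_(j < n) wj j s).
  apply: (Z1_sum hE) => j _; apply: (Z1_mode hE (j := j)).
  by apply: (modeZ hE); exact: mu_j.
have ZU : Z1 (0, \sum_(j < n) uj j s) by exact: (Z1_snd hE).
have [ZT TE] := Tsg_spec hE b1 ts0 ZU.
split; first exact: (Z1B hE).
apply/(znorm_eqvP hE) => // j; have [e1 e2] := TE j.
rewrite (actP_expmx hE b1) /= in e1 e2.
have E0 : l2eqv (E j 0) 0 by have := mode0 hE j.
have Eu := projE_sum_modes hE j n (fun i => mu_j i s).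
have m1 i : mode E i (wj i s).1 by apply: (modeZ hE); exact: mu_j.
have m2 i : mode E i (wj i s).2 by apply: (modeZ hE); exact: mu_j.
have w1 := projE_sum_modes hE j n m1; have w2 := projE_sum_modes hE j n m2.
rewrite (raddf_sum (fst : L2 * L2 -> L2)) (raddf_sum (snd : L2 * L2 -> L2)).
split.
- apply: (l2eqv_trans e1); apply: l2eqv_trans (l2eqv_sym w1).
  apply: l2eqv_trans (l2eqvD (l2eqvZ _ E0) (l2eqvZ _ Eu)) _.
  rewrite scaler0 add0r /wj /=; case: ifP => _; rewrite ?scaler0; exact: l2eqv_refl.
- apply: (l2eqv_trans e2); apply: l2eqv_trans (l2eqv_sym w2).
  apply: l2eqv_trans (l2eqvD (l2eqvZ _ E0) (l2eqvZ _ Eu)) _.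
  rewrite scaler0 add0r /wj /=; case: ifP => _; rewrite ?scaler0; exact: l2eqv_refl.
Qed.

(** [Z1_modes] sums the modes of [z] to some [Y], which has the same modes as [z] and hence lies at
    distance zero from it. *)
Lemma modes_dense (z : L2 * L2) : Z1 z ->
  nz (z - \sum_(j < n) (E j z.1, E j z.2)) @[n --> \oo] --> (0 : R).
Proof.
move=> Zz; pose y j : L2 * L2 := (E j z.1, E j z.2).
have m1 j : mode E j (y j).1 by exact: (mode_projE hE).
have m2 j : mode E j (y j).2 by exact: (mode_projE hE).
have yB n : \sum_(j < n) mode_energy lam E j (y j) <= nz z ^+ 2.
  apply: le_trans (znorm_ge_partial hE n Zz); apply: ler_sum => j _.
  by rewrite /mode_energy (l2norm_eqv (m1 j)) (l2norm_eqv (m2 j)).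
have [Y [ZY YE cY]] := Z1_modes hE m1 m2 yB.
have nY : nz (z - Y) = 0.
  apply/(znorm_eqvP hE) => // j; have [e1 e2] := YE j.
  by split; exact: l2eqv_sym.
have ZS n : Z1 (\sum_(j < n) y j).
  by apply: (Z1_sum hE) => j _; exact: (Z1_mode hE (m1 j)).
apply: squeeze_cvgr (cvg_cst 0) cY; apply: nearW => n.
rewrite znorm_ge0/=; apply: le_trans (znorm_tri hE Zz ZY (ZS n)) _.
by rewrite nY add0r.
Qed.

End steering.

(** * Approximate controllability *)

(** Finite measure makes the constant [b] of the growth bound square-integrable. *)
Lemma lebesgue_dom_lty (R : realType) (N : nat) (Omega : set 'rV[R]_N) (oO : open Omega) :
  bounded_set Omega -> (lebesgue_dom oO setT < +oo)%E.
Proof.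
move=> /pinfty_ex_gt0[K K0 OK].
pose c := K + 1; have c0 : 0 < c by rewrite addr_gt0.
pose B := [set x : 'rV[R]_N | forall i, - c < x ord0 i <= c].
have mB : measurable B.
  rewrite (_ : B = \bigcap_(i in [set: 'I_N]) (@rV_coord R N i @^-1` `](- c), c])).
    apply: fin_bigcap_measurable => // i _.
    by rewrite -[X in measurable X]setTI; exact: measurable_rV_coord.
  apply/seteqP; split => x /= H i => [_|]; first by rewrite /= in_itv; exact: H.
  by have := H i I; rewrite /= in_itv.
have OB : Omega `<=` B.
  move=> x Ox i; have xc : `|x| < c by rewrite (le_lt_trans (OK _ Ox))// ltrDl.
  have : ball (0 : 'rV[R]_N) c x by rewrite mx_norm_ball /ball_ /= sub0r normrN.
  move=> [_ /(_ ord0 i)]; rewrite /ball /= mxE sub0r normrN ltr_norml => /andP[-> /ltW].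
  by [].
rewrite /lebesgue_dom /mrestr setTI.
apply: (@le_lt_trans _ _ (lebesgue_rV R N B)).
  by apply: le_measure; rewrite ?inE//; exact: open_measurable_rV.
by rewrite lebesgue_rV_box ?ltry// => i; rewrite ge0_cp// ltW.
Qed.

Lemma telescoping_difference (V : zmodType) (a b c d w : V) :
  a - (b + c) + (c - d) + (b - w) = a - d - w.
Proof.
rewrite opprD !addrA (ACl ((1*5*7)*(2*6)*(3*4))) /=.
by rewrite !addNr !addr0.
Qed.

(** In use, [s] and [d] are the differences of the two integrals and [y] the truncated target. The
    first two groups on the right have norm zero, the third is the truncation error and the last the
    effect of the forcing. *)
Lemma steering_difference (V : zmodType) (x x0 x1 s d y : V) :
  x - x1 = x - x0 - (s + d) + (s - y) + - (x1 - x0 - y) + d.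
Proof.
rewrite !opprD !opprK !addrA.
rewrite [RHS](ACl ((1*7)*(2*8)*(3*5)*(4*10)*(6*9))) /=.
by rewrite !addNr !addr0.
Qed.

Section approximate_controllability.
Context (R : realType) (N : nat) (Omega : set 'rV[R]_N) (oO : open Omega).
Local Notation mu := (lebesgue_dom oO).
Local Notation L2 := (L2 oO).
Variables (lam : nat -> R) (E : nat -> L2 -> L2).
Hypothesis hE : dirichlet_spectrum lam E.
Local Notation Z1 := (Z1 lam E).
Local Notation nz := (znorm lam E).
Local Notation leb := (@lebesgue_measure R).

Lemma nemytskii_bound (a b K : R) : 0 <= a -> 0 <= b -> (mu setT < +oo)%E ->
  exists2 B, 0 <= B & forall (h : R -> R -> R -> R) z u y,
    (forall y v u, `|h y v u| <= a * Num.sqrt (`|y| ^+ 2 + `|v| ^+ 2) + b) ->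
    Z1 z -> nz z <= K -> is_nemytskii h z u y -> nz y <= B.
Proof.
move=> a0 b0 muoo.
pose V := fine (mu setT).
have V0 : 0 <= V by exact: fine_ge0.
(* From [(p + q) ^+ 2 <= 2 * p ^+ 2 + 2 * q ^+ 2]; the quotient [K / lam 0] bounds the displacement
   and [V] is the measure of the domain. *)
pose B2 := 2 * a ^+ 2 * ((K / lam 0%N) ^+ 2 + K ^+ 2) + 2 * b ^+ 2 * V.
have B20 : 0 <= B2 by rewrite addr_ge0 ?mulr_ge0 ?addr_ge0 ?sqr_ge0.
exists (Num.sqrt B2); first exact: sqrtr_ge0.
move=> h z u [y1 y] hh Zz zK [/= -> hy].
rewrite (znorm_snd hE) -(@ler_pXn2r _ 2)// ?nnegrE ?l2norm_ge0 ?sqrtr_ge0//.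
rewrite sqr_sqrtr//.
have l0 := lam_gt0 hE 0.
have z1K : l2norm z.1 <= K / lam 0%N.
  by rewrite ler_pdivlMr// mulrC (le_trans (l2norm_fst_le hE Zz)).
have z2K : l2norm z.2 <= K by exact: le_trans (l2norm_snd_le _ _ _) zK.
have K0 : 0 <= K by exact: le_trans (znorm_ge0 _ _ _) zK.
rewrite -lee_fin l2norm_sqrE.
have msq (x : L2) : measurable_fun setT (fun s => (x s ^+ 2)%:E).
  by apply/measurable_EFinP; exact: measurable_funX.
have sq0 (c : R) (x : L2) s : (0 <= (2 * c ^+ 2)%:E * (x s ^+ 2)%:E)%E.
  by rewrite mule_ge0 ?lee_fin ?sqr_ge0// mulr_ge0 ?sqr_ge0.
have mZ (c : R) (x : L2) : measurable_fun setT (fun s => ((2 * c ^+ 2)%:E * (x s ^+ 2)%:E)%E).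
  by apply: emeasurable_funM => //; exact: measurable_cst.
apply: (@le_trans _ _ (\int[mu]_s ((2 * a ^+ 2)%:E * (z.1 s ^+ 2)%:E +
    (2 * a ^+ 2)%:E * (z.2 s ^+ 2)%:E + (2 * b ^+ 2)%:E))%E).
  apply: ae_le_lower_integral => [s _|s _|].
  - by rewrite lee_fin sqr_ge0.
  - by rewrite !adde_ge0// lee_fin mulr_ge0 ?sqr_ge0.
  apply: filterS hy => s -> _; rewrite -!EFinM -!EFinD lee_fin.
  have := hh (z.1 s) (z.2 s) (u s).
  rewrite !real_normK ?num_real//.
  set q := z.1 s ^+ 2 + z.2 s ^+ 2 => hq.
  have q0 : 0 <= q by rewrite addr_ge0 ?sqr_ge0.
  rewrite -(real_normK (num_real (h _ _ _))).
  apply: (@le_trans _ _ ((a * Num.sqrt q + b) ^+ 2)).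
    by rewrite ler_pXn2r ?nnegrE ?addr_ge0 ?mulr_ge0 ?sqrtr_ge0.
  rewrite -mulrDr -/q -{2}(sqr_sqrtr q0) -subr_ge0.
  by rewrite (_ : _ - _ = (a * Num.sqrt q - b) ^+ 2) ?sqr_ge0//; ring.
rewrite ge0_integralD//; last 3 first.
- by move=> s _; rewrite adde_ge0.
- exact: emeasurable_funD.
- by move=> s _; rewrite lee_fin mulr_ge0 ?sqr_ge0.
rewrite ge0_integralD//.
have c0 : 0 <= 2 * a ^+ 2 by rewrite mulr_ge0 ?sqr_ge0.
have sqE (x : L2) : (\int[mu]_s ((2 * a ^+ 2)%:E * (x s ^+ 2)%:E) = (2 * a ^+ 2 * l2norm x ^+ 2)%:E)%E.
  rewrite [RHS]EFinM l2norm_sqrE; apply: ge0_integralZl_EFin => // s _.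
  by rewrite lee_fin sqr_ge0.
have bE : (\int[mu]_s (2 * b ^+ 2)%:E = (2 * b ^+ 2 * V)%:E)%E.
  by rewrite integral_cst// [RHS]EFinM; congr (_ * _)%E; rewrite fineK// ge0_fin_numE.
rewrite !sqE bE.
rewrite -!EFinD lee_fin /B2 lerD2r -mulrDr ler_wpM2l//.
by rewrite lerD// ler_pXn2r ?nnegrE ?l2norm_ge0 ?divr_ge0// ltW.
Qed.

(** * Choice of the window and the final estimate *)

Variables (beta tau r : R) (p : nat) (tk : 'I_p -> R).
Variables (M : R -> 'rV[R]_N -> R) (g : R -> R) (f : R -> R -> R -> R -> R).
Variable Ik : 'I_p -> R -> R -> R -> R -> R.
Hypotheses (hbeta : 1 < beta) (htau : 0 < tau) (hr : 0 < r).
Hypothesis tk_itv : forall k, 0 < tk k < tau.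
Local Notation T := (Tsg lam E beta).
Local Notation mild := (mild_solution lam E beta tau r tk M g f Ik).

Lemma znorm_near_bound (w : R -> L2 * L2) (A : set R) (t0 : R) (y : L2 * L2) :
  Z1 y -> (forall s, A s -> Z1 (w s)) ->
  (\forall s \near t0, A s -> nz (w s - y) <= 1) ->
  exists2 d, 0 < d & forall s, A s -> `|t0 - s| < d -> nz (w s) <= nz y + 1.
Proof.
move=> Zy Zw /nbhs_ballP[d /= d0 hd]; exists d => // s As sd.
rewrite -(subrK y (w s)) addrC (le_trans (znormD hE _ _))//.
  by apply: (Z1B hE) => //; exact: Zw.
by rewrite lerD2l; apply: hd.
Qed.

(** The delayed times approach [tau - r] from the left. Boundedness there comes from continuity of
    [Phi] if [tau - r <= 0], and otherwise from continuity, or left continuity at an impulse, of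
    [z]. *)
Lemma mild_locally_bounded Phi u z : C_initial lam E r Phi -> mild Phi u z ->
  exists d K, 0 < d /\ forall s, s \in `[0, tau] -> tau - d < s -> nz (z (s - r)) <= K.
Proof.
move=> CPhi [Zz zPhi [zc zk] _].
have cvg1 (F : set_system R) (FF : Filter F) (v : R -> R) : v s @[s --> F] --> (0 : R) ->
    \forall s \near F, v s <= 1.
  move=> /cvgrPdist_le/(_ _ ltr01); apply: filterS => s.
  by rewrite sub0r normrN; exact: le_trans (ler_norm _).
have [tr|tr] := leP (tau - r) 0.
  have tI : tau - r \in `[- r, 0] by rewrite in_itv/= tr andbT lerBrDr addNr ltW.
  have [ZP cP] := CPhi _ tI.
  have [d d0 hd] := znorm_near_bound ZP (fun s h => (CPhi s h).1)
    (cvg1 _ _ _ cP : \forall s \near tau - r, s \in `[- r, 0] -> nz (Phi s - Phi (tau - r)) <= 1).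
  exists d, (nz (Phi (tau - r)) + 1); split => // s sI sd.
  have [s0 st] : 0 <= s /\ s <= tau by move: sI; rewrite in_itv/= => /andP.
  have sr : s - r \in `[- r, 0].
    by rewrite in_itv/= lerBrDr addNr s0/= (le_trans _ tr)// lerD2r.
  have srT : s - r \in `[- r, tau] by apply: subr_itv => //; exact: ltW.
  have [ZPs _] := CPhi _ sr.
  rewrite (znorm_eqv hE (Zz _ srT) (conj (Z1B hE (Zz _ srT) ZPs) (zPhi _ sr))).1.
  apply: hd => //; rewrite opprB addrA subrK ger0_norm ?subr_ge0//.
  by rewrite ltrBlDr -ltrBlDl.
have tI : tau - r \in `[0, tau] by rewrite in_itv/= ltW//= gerBl ltW.
have tI' : tau - r \in `[- r, tau] by apply: subr_itv => //; exact: ltW.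
have dist s d : s <= tau -> tau - d < s -> `|tau - r - (s - r)| < d.
  move=> st sd; rewrite opprB addrA subrK ger0_norm ?subr_ge0//.
  by rewrite ltrBlDr -ltrBlDl.
(* At an impulse time the left-hand limit covers [s < tau], and the value at [s = tau] is bounded
   directly. *)
have [[k tkE]|ntk] := pselect (exists k, tau - r = tk k).
  have [ck _] := zk k; rewrite -tkE in ck.
  have nk : \forall s \near tau - r, (s < tau - r /\ s \in `[- r, tau]) -> nz (z s - z (tau - r)) <= 1.
    pose proof (cvg1 _ _ _ ck) as h; rewrite /at_left /within /= in h.
    have {}h : nbhs (tau - r) [set s | s < tau - r -> nz (z s - z (tau - r)) <= 1] := h.
    by apply: filterS h => s hs [/hs].
  have [d d0 hd] := znorm_near_bound (Zz _ tI') (fun s (h : s < tau - r /\ s \in `[- r, tau]) => Zz s h.2) nk.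
  exists d, (nz (z (tau - r)) + 1); split => // s sI sd.
  have [s0 st] : 0 <= s /\ s <= tau by move: sI; rewrite in_itv/= => /andP.
  have [->|sn] := eqVneq s tau; first by rewrite lerDl.
  apply: hd; last exact: dist.
  split; first by rewrite ltrD2r lt_neqAle sn st.
  by apply: subr_itv => //; exact: ltW.
have i0 s : s \in `[0, tau] -> s \in `[- r, tau].
  by rewrite !in_itv/= => /andP[s0 ->]; rewrite (le_trans _ s0)// oppr_le0 ltW.
have ntk' k : tau - r != tk k by apply/eqP => h; apply: ntk; exists k.
have [d d0 hd] := znorm_near_bound (Zz _ tI')
  (fun s h => Zz s (i0 s h))
  (cvg1 _ _ _ (zc _ tI ntk') : \forall s \near tau - r, s \in `[0, tau] -> nz (z s - z (tau - r)) <= 1).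
(* The minimum with [tau - r] keeps [s - r] nonnegative, where continuity of [z] is available. *)
exists (Num.min d (tau - r)), (nz (z (tau - r)) + 1); split; first by rewrite lt_min d0.
move=> s sI sd.
have [s0 st] : 0 <= s /\ s <= tau by move: sI; rewrite in_itv/= => /andP.
apply: hd.
  rewrite in_itv/= subr_ge0; apply/andP; split; last by rewrite (le_trans _ st)// gerBl ltW.
  apply: ltW; apply: le_lt_trans sd.
  by rewrite -{1}(subKr tau r) lerD2l lerN2 ge_min lexx orbT.
by apply: dist => //; apply: le_lt_trans sd; rewrite lerD2l lerN2 ge_min lexx.
Qed.

(** The bounds serve, in turn, the local boundedness, the final estimate, the delay, the length of
    the horizon and the impulses. Equality with [tau - tk k] is allowed, as the control still
    vanishes at [tau - delta]. *)
Lemma small_delay_window (d0 e : R) : 0 < d0 -> 0 < e ->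
  exists delta, [/\ 0 < delta, delta <= d0, delta <= e, delta <= r &
    delta <= tau /\ forall k, delta <= tau - tk k].
Proof.
move=> d00 e0; pose m := \big[Num.min/tau]_(k < p) (tau - tk k).
have m0 : 0 < m.
  by apply/bigmin_gtP; split => // k _; rewrite subr_gt0; case/andP: (tk_itv k).
exists (Num.min (Num.min d0 e) (Num.min r m)); split.
- by rewrite !lt_min d00 e0 hr m0.
- by rewrite !ge_min lexx.
- by rewrite !ge_min lexx !orbT.
- by rewrite !ge_min lexx !orbT.
have le : Num.min (Num.min d0 e) (Num.min r m) <= m by rewrite !ge_min lexx !orbT.
split; first by rewrite (le_trans le)// bigmin_le_id.
by move=> k; rewrite (le_trans le)// bigmin_le.
Qed.

Lemma Z1_nemytskii h z u y : is_nemytskii h z u y -> Z1 y.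
Proof. by case=> + _; case: y => [y1 y2] /= ->; exact: (Z1_snd hE). Qed.

Lemma memory_steering_difference t u0 m m' w : 0 <= t -> Z1 m -> Z1 m' -> nz (m - m') = 0 ->
  Z1 w -> znull lam E (T t (0, u0) - w) ->
  nz (T t ((0, u0) + m) - T t ((0, 0) + m') - w) = 0.
Proof.
move=> t0 Zm Zm' mm Zw Tw.
have ZU : Z1 (0, u0) by exact: (Z1_snd hE).
rewrite (_ : (0, 0) + m' = m') ?add0r//.
have Z12 := Z1_Tsg hE hbeta t0 (Z1D hE ZU Zm).
have ZTU := Z1_Tsg hE hbeta t0 ZU; have ZTm := Z1_Tsg hE hbeta t0 Zm.
have ZTm' := Z1_Tsg hE hbeta t0 Zm'.
have n1 : znull lam E (T t ((0, u0) + m) - (T t (0, u0) + T t m)).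
  split; first exact: (Z1B hE Z12 (Z1D hE ZTU ZTm)).
  apply/(znorm_eqvP hE Z12 (Z1D hE ZTU ZTm)).
  by have := Tsg_lin hE hbeta 1 t0 ZU Zm; rewrite !scale1r.
have n2 : znull lam E (T t m - T t m').
  exact: conj (Z1B hE ZTm ZTm') (Tsg_eqv hE hbeta t0 Zm Zm' mm).
have nn := (znullD hE (znullD hE n1 n2) Tw).2.
by rewrite telescoping_difference in nn.
Qed.

Lemma window_difference_bound (delta B : R) (FF FF' : R -> L2 * L2) (S S' : L2 * L2) :
  0 < delta -> delta <= tau -> 0 <= B ->
  {ae leb, forall s : measurableTypeR R, s \in `[0, tau] ->
    [/\ Z1 (FF s), Z1 (FF' s), s <= tau - delta -> nz (FF s - FF' s) = 0 &
        tau - delta < s -> nz (FF s) <= B /\ nz (FF' s) <= B]} ->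
  is_bochner Z1 nz `[0, tau] (fun s => T (tau - s) (FF s)) S ->
  is_bochner Z1 nz `[0, tau] (fun s => T (tau - s) (FF' s)) S' ->
  nz (S - S') <= 2 * (2 * semigroup_bound beta * B) * delta.
Proof.
move=> d0 dt B0 hF b b'.
have mI : measurable (`[0, tau]%classic : set (measurableTypeR R)) by exact: measurable_itv.
have mA : measurable (`]tau - delta, tau]%classic : set (measurableTypeR R)) by exact: measurable_itv.
have sg0 := semigroup_bound_ge0 hbeta.
(* Two forcing terms of norm at most [B], each amplified by at most [2 * semigroup_bound beta]. *)
pose c := 2 * (2 * semigroup_bound beta * B).
have c0 : 0 <= c by apply: mulr_ge0 => //; apply: mulr_ge0 => //; exact: mulr_ge0.
have bd := is_bochnerB (Z10 hE) (Z1D hE) (Z1Z hE) (@znorm_ge0 _ _ _ _ _ _)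
  (znormD hE) (fun a x => @znormZ _ _ _ _ _ _ hE a x) mI b b'.
have := @nrm_bochner_le _ _ _ _ (Z10 hE) (Z1D hE) (Z1Z hE) (@znorm_ge0 _ _ _ _ _ _)
  (znormD hE) (fun a x => @znormZ _ _ _ _ _ _ hE a x) _ _ _
  (fun s => c * \1_(`]tau - delta, tau]%classic : set (measurableTypeR R)) s)
  mI (lebesgue_itv_lty _ _) _ _ _ bd.
have -> : (\int[leb]_(s in `[0%R, tau]) (c * \1_(`]tau - delta, tau]%classic : set (measurableTypeR R)) s)%:E =
    (c * delta)%:E)%E.
  under eq_integral do rewrite EFinM.
  have -> : (\int[leb]_(s in `[0%R, tau]) (c%:E * (\1_(`]tau - delta, tau]%classic : set (measurableTypeR R)) s)%:E) =
      c%:E * \int[leb]_(s in `[0%R, tau]) (\1_(`]tau - delta, tau]%classic : set (measurableTypeR R)) s)%:E)%E.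
    apply: ge0_integralZl_EFin => //.
    by apply/measurable_EFinP; exact: measurable_indic.
  rewrite integral_indic// [RHS]EFinM; congr (_ * _)%E.
  rewrite (_ : _ `&` _ = `]tau - delta, tau]%classic).
    have := lebesgue_measure_itv `]tau - delta, tau]; rewrite /= lte_fin gtrBl d0 => ->.
    by rewrite -EFinB subKr.
  apply: setIidl => s; rewrite /= !in_itv/= => /andP[h ->]; rewrite andbT ltW//.
  by apply: le_lt_trans h; rewrite subr_ge0.
rewrite lee_fin; apply.
- by apply: measurable_funM => //; exact: measurable_indic.
- by move=> s; rewrite mulr_ge0.
apply: filterS hF => s hF sI; have [ZF ZF' h1 h2] := hF sI.
have [s0 st] : 0 <= s /\ s <= tau by move: sI; rewrite /= in_itv/= => /andP.
have ts0 : 0 <= tau - s by rewrite subr_ge0.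
rewrite indicE; have [sd|sd] := leP s (tau - delta).
  rewrite memNset ?mulr0; last by rewrite /= in_itv/= ltNge sd.
  by rewrite (Tsg_eqv hE hbeta ts0 ZF ZF' (h1 sd)).
rewrite mem_set; last by rewrite /= in_itv/= sd.
have [F1 F2] := h2 sd.
have TF1 := znorm_Tsg_le hE hbeta ts0 ZF; have TF2 := znorm_Tsg_le hE hbeta ts0 ZF'.
have ZT1 := Z1_Tsg hE hbeta ts0 ZF; have ZT2 := Z1_Tsg hE hbeta ts0 ZF'.
rewrite mulr1 (le_trans (znormD hE ZT1 (Z1N hE ZT2)))// (znormN hE ZT2).
have k0 : 0 <= 2 * semigroup_bound beta by rewrite mulr_ge0.
rewrite /c mulr_natl mulr2n lerD//.
  by rewrite (le_trans TF1)// ler_wpM2l.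
by rewrite (le_trans TF2)// ler_wpM2l.
Qed.

Lemma approximately_controllable_of_linear_growth :
  (mu setT < +oo)%E ->
  uniquely_solvable lam E beta tau r tk M g f Ik ->
  (exists a b : R, [/\ 0 <= a, 0 <= b & forall t y v u : R, t \in `[0, tau] ->
    `|f t y v u| <= a * Num.sqrt (`|y| ^+ 2 + `|v| ^+ 2) + b]) ->
  approximately_controllable lam E beta tau r tk M g f Ik.
Proof.
move=> muoo H1 [a [b [a0 b0 fab]]] eps Phi z1 eps0 CPhi Zz1.
have [z0 mz0 _] := H1 Phi (fun=> 0) CPhi (L2_control_simple tau (simple_control0 oO)).
have [d0 [K [d00 hK]]] := mild_locally_bounded CPhi mz0.
have [B B0 hB] := nemytskii_bound K a0 b0 muoo.
have sg0 := semigroup_bound_ge0 hbeta.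
pose c := 2 * (2 * semigroup_bound beta * B).
have c0 : 0 <= c by apply: mulr_ge0 => //; apply: mulr_ge0 => //; exact: mulr_ge0.
(* The summand 1 guards against [c = 0]; then [c * delta] is at most [eps / 2]. *)
have e0 : 0 < eps / (2 * (c + 1)) by rewrite divr_gt0// mulr_gt0// ltr_wpDl.
have [delta [delta0 dd0 de dr [dt dtk]]] := small_delay_window d00 e0.
have [Zz0 _ _ _] := mz0.
have tauI : tau \in `[- r, tau] by rewrite in_itv/= lexx andbT (le_trans _ (ltW htau))// oppr_le0 ltW.
have tauI0 : tau \in `[0, tau] by rewrite in_itv/= lexx ltW.
(* The uncontrolled solution already reaches [z0 tau], so only the remaining gap is to be
   steered. *)
have Zy : Z1 (z1 - z0 tau) := Z1B hE Zz1 (Zz0 _ tauI).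
have e20 : 0 < eps / 2 by rewrite divr_gt0.
have /cvgrPdist_lt/(_ _ e20)[n _ hn] := modes_dense hE Zy.
pose Yn := \sum_(j < n) (E j (z1 - z0 tau).1, E j (z1 - z0 tau).2).
have {}hn : `|0 - nz (z1 - z0 tau - Yn)| < eps / 2 := hn n (leqnn n).
rewrite sub0r normrN (ger0_norm (znorm_ge0 _ _ _)) in hn.
have [u [w [su u0 bw Tw]]] := steering hE (z1 - z0 tau) n hbeta delta0 dt.
have cu := L2_control_simple tau su.
have [z mz _] := H1 Phi u CPhi cu.
exists u => //; exists z => //.
have [Zz zPhi _ _] := mz.
have ZYn : Z1 Yn by have [] := bw.
have zero_in : (0 : R) \in `[- r, 0] by rewrite in_itv/= lexx oppr_le0 ltW.
split; first exact: zPhi.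
have agree : forall t, t \in `[- r, tau - delta] -> nz (z t - z0 t) = 0.
  apply: (causality hE hbeta hr tk_itv CPhi mz mz0) => [|s].
    by rewrite gerBl ltW.
  by rewrite in_itv/= => /andP[_ sd]; exact: u0.
have hl l : l \in `[- r, tau - r] -> nz (z l - z0 l) = 0.
  rewrite in_itv/= => /andP[l1 l2]; apply: agree.
  by rewrite in_itv/= l1 (le_trans l2)// lerD2l lerN2.
have hk k : tk k < tau -> nz (z (tk k) - z0 (tk k)) = 0 /\ u (tk k) = 0.
  move=> kt; have /andP[k0 _] := tk_itv k.
  have kd : tk k <= tau - delta by rewrite lerBrDr -lerBrDl.
  split; last exact: u0.
  by apply: agree; apply: mem_itvN => //; exact: ltW.
have [FF [FF' [m [m' [S1 [S1' [S2 [S2' [hae [b1 b1'] [b2 b2'] nd]]]]]]]]] :=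
  mild_difference hE hbeta hr tk_itv CPhi mz mz0 tauI0 hl hk.
have mI : measurable (`[0, tau]%classic : set (measurableTypeR R)) by exact: measurable_itv.
have nS1 : znull lam E (S1 - S1' - Yn).
  have bd := is_bochnerB (Z10 hE) (Z1D hE) (Z1Z hE) (@znorm_ge0 _ _ _ _ _ _)
    (znormD hE) (fun a x => @znormZ _ _ _ _ _ _ hE a x) mI b1 b1'.
  apply: (bochner_uniq hE mI (lebesgue_itv_lty _ _) _ bd bw).
  (* Membership of [w s] in [Z1] is read off, almost everywhere, from its Bochner integrability. *)
  have [_ [sw [hw _ _]]] := bw.
  apply: filterS2 hae hw => s hs hw sI; have [_ _ [Zm Zm' mm']] := hs sI.
  have [Zw _] := hw sI.
  have [s0 st] : 0 <= s /\ s <= tau by move: sI; rewrite /= in_itv/= => /andP.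
  have ts0 : 0 <= tau - s by rewrite subr_ge0.
  exact: (memory_steering_difference ts0 Zm Zm' mm' Zw (Tw _ s0 st)).
have nS2 : nz (S2 - S2') <= c * delta.
  apply: (@window_difference_bound delta B FF FF') => //.
  apply: filterS hae => s hs sI; have [hF hF' _] := hs sI.
  have [s0 st] : 0 <= s /\ s <= tau by move: sI; rewrite in_itv/= => /andP.
  have srI : s - r \in `[- r, tau] by apply: subr_itv => //; exact: ltW.
  have zs : nz (z (s - r) - z0 (s - r)) = 0 by apply: hl; exact: subr_itv_shift.
  have Zs := Zz _ srI; have Zs0 := Zz0 _ srI.
  split; [exact: Z1_nemytskii hF|exact: Z1_nemytskii hF'| |].
    by move=> sd; rewrite (u0 _ sd) in hF; exact: (nemytskii_eqv hE Zs Zs0 zs hF hF').2.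
  move=> sd; have zK : nz (z0 (s - r)) <= K.
    by apply: hK => //; apply: le_lt_trans sd; rewrite lerD2l lerN2.
  split; last exact: (hB _ _ _ _ (fun y v u => fab s y v u sI) Zs0 zK hF').
  apply: (hB _ _ _ _ (fun y v u => fab s y v u sI) Zs _ hF).
  by rewrite (znorm_eqv hE Zs (conj (Z1B hE Zs Zs0) zs)).1.
have ZS2 : Z1 (S2 - S2') by apply: (Z1B hE); [case: b2|case: b2'].
have key : z tau - z1 = (z tau - z0 tau - (S1 - S1' + (S2 - S2'))) + (S1 - S1' - Yn) +
    (- (z1 - z0 tau - Yn)) + (S2 - S2').
  exact: steering_difference.
have [Z2 n2] := znullD hE nd nS1.
have ZyY := Z1B hE Zy ZYn.
rewrite key; apply: le_lt_trans (znormD hE (Z1D hE Z2 (Z1N hE ZyY)) ZS2) _.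
have h1 := znormD hE Z2 (Z1N hE ZyY); rewrite n2 add0r (znormN hE ZyY) in h1.
apply: le_lt_trans (lerD h1 nS2) _; rewrite [ltRHS]splitr.
apply: ltr_leD => //; apply: (@le_trans _ _ (c * (eps / (2 * (c + 1))))).
  exact: ler_wpM2l.
have c1 : 0 < c + 1 by rewrite ltr_wpDl.
rewrite mulrA ler_pdivrMr ?mulr_gt0// mulrA divfK ?pnatr_eq0// mulrC.
by rewrite ler_pM2l// lerDl.
Qed.

End approximate_controllability.

Theorem theorem4p1 (R : realType) (N : nat) (hN : (1 <= N)%N)
    (Omega : set 'rV[R]_N) (oO : open Omega) (Omega_neq0 : Omega !=set0)
    (Omega_connected : connected Omega) (Omega_bounded : bounded_set Omega)
    (lam : nat -> R) (E : nat -> L2 oO -> L2 oO)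
    (hE : dirichlet_spectrum lam E)
    (beta tau r : R) (hbeta : 1 < beta) (htau : 0 < tau) (hr : 0 < r)
    (p : nat) (tk : 'I_p -> R)
    (tk_lt : forall k l : 'I_p, (k < l)%N -> tk k < tk l)
    (tk_itv : forall k, 0 < tk k < tau)
    (M : R -> 'rV[R]_N -> R) (hM : mem_Linfty Omega tau M)
    (g : R -> R) (f : R -> R -> R -> R -> R)
    (Ik : 'I_p -> R -> R -> R -> R -> R)
    (H1 : uniquely_solvable lam E beta tau r tk M g f Ik)
    (H2 : exists a b : R, [/\ 0 <= a, 0 <= b &
      forall t y v u : R, t \in `[0, tau] ->
        `|f t y v u| <= a * Num.sqrt (`|y| ^+ 2 + `|v| ^+ 2) + b]) :
  approximately_controllable lam E beta tau r tk M g f Ik.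
Proof.
have muoo := lebesgue_dom_lty oO Omega_bounded.
exact: (approximately_controllable_of_linear_growth hE hbeta htau hr tk_itv muoo H1 H2).
Qed.
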